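(* Let $d\in\{1,2,3,\dots\}$ and let $\Omega\subset\mathbb{R}^d$ be a smooth connected bounded open set. There exists a constant $C=C(d,\Omega)>0$, depending only on $d$ and $\Omega$, such that for every $\alpha\in(0,1)$, every $\varphi\in C^\infty(\overline\Omega)$ and every nonnegative Borel measure $\mu$ in $\Omega$ satisfying $\mu\le\mathcal{H}^{d-\alpha}_\infty$ in $\Omega$, $$\Big\|\varphi-\frac{1}{|\Omega|}\int_\Omega\varphi\,dx\Big\|_{L^1(\Omega,d\mu)}\le C(1-\alpha)\int_\Omega\int_\Omega\frac{|\varphi(y)-\varphi(z)|}{|y-z|^{\alpha+d}}\,dy\,dz.$$
   Context: $|\Omega|$ is the Lebesgue measure of $\Omega$. For $s>0$ and $A\subset\mathbb{R}^d$, the Hausdorff content of dimension $s$ is $$\mathcal{H}^s_\infty(A):=\inf\Big\{\sum_{i=0}^\infty\omega_s r_i^s: A\subset\bigcup_{i=0}^\infty B_{r_i}(x_i)\Big\},\qquad \omega_s:=\frac{\pi^{s/2}}{\Gamma(\frac s2+1)},$$ where the infimum is over countable coverings by open balls (finite coverings allowed). The condition $\mu\le\mathcal{H}^{d-\alpha}_\infty$ in $\Omega$ means $\mu(A)\le\mathcal{H}^{d-\alpha}_\infty(A)$ for every Borel set $A\subset\Omega$. ''Smooth'' means with smooth boundary. *)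

(* Defs.v *)
From HB Require Import structures.
From mathcomp Require Import all_boot all_order all_algebra.
From mathcomp Require Import all_classical all_reals all_analysis.
From mathcomp Require Import measurable_realfun.

Set Implicit Arguments.
Unset Strict Implicit.
Unset Printing Implicit Defensive.

Import Order.TTheory GRing.Theory Num.Theory.
Import numFieldNormedType.Exports.

Local Open Scope classical_set_scope.
Local Open Scope ring_scope.

Definition borel_rV_display : measure_display.
Proof. exact: default_measure_display. Qed.

(* R^d is ['rV[R]_d] with its Borel sigma-algebra. *)
HB.instance Definition _ (R : realType) (d : nat) :=
  @isMeasurable.Build borel_rV_display 'rV[R]_d
    <<s @open 'rV[R]_d >> (@sigma_algebra0 _ setT open) (@sigma_algebraC _ open)
    (@sigma_algebra_bigcup _ setT open).

Section borel_rV.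
Context {R : realType}.

Lemma open_measurable_rV d (U : set 'rV[R]_d) : open U -> measurable U.
Proof. exact: sub_sigma_algebra. Qed.

Lemma measurable_coord d (i : 'I_d) :
  measurable_fun [set: 'rV[R]_d] (fun x => x ord0 i).
Proof.
apply: (measurability _ (RGenOpens.measurableE R)) => _ [_ [a [b ->] <-]].
rewrite setTI; apply: open_measurable_rV.
by apply: open_comp => [x _|]; [exact: coord_continuous|exact: interval_open].
Qed.

Let rat_rV d (q : 'rV[rat]_d) : 'rV[R]_d := map_mx ratr q.

Let open_rV_bigcup d (U : set 'rV[R]_d) : open U ->
  U = \bigcup_(qk in [set qk : 'rV[rat]_d * nat |
                      ball (rat_rV qk.1) qk.2.+1%:R^-1 `<=` U])
        ball (rat_rV qk.1) qk.2.+1%:R^-1.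
Proof.
move=> oU; apply/seteqP; split => [x Ux|x [qk /= + xqk]]; last exact.
have /nbhs_ballP[e /= e0 xeU] := open_nbhs_nbhs (conj oU Ux).
have e20 : 0 < e / 2 by rewrite divr_gt0.
have [k _ /(_ k (leqnn k)) /= ke] := near_infty_natSinv_lt (PosNum e20).
have k0 : 0 < k.+1%:R^-1 :> R by rewrite invr_gt0.
have qP i : exists q : rat, `|x ord0 i - ratr q| < k.+1%:R^-1.
  have xk : x ord0 i - k.+1%:R^-1 < x ord0 i + k.+1%:R^-1.
    by rewrite ltrBlDr -addrA ltrDl addr_gt0.
  by have [q] := rat_in_itvoo xk; rewrite in_itv/= => qx; exists q; rewrite distrC ltr_distl.
pose q : 'rV[rat]_d := \row_i projT1 (cid (qP i)).
have xq : ball (rat_rV q) k.+1%:R^-1 x.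
  by split => // i j; rewrite ord1 !mxE /ball /= distrC; case: cid.
exists (q, k) => //= y yq; apply: xeU.
rewrite [e]splitr; apply: (@ball_triangle _ _ (rat_rV q)).
  by apply: ball_sym; apply: le_ball xq; exact: ltW.
by apply: le_ball yq; exact: ltW.
Qed.

Lemma measurable_fun_rV dT (T : measurableType dT) d (f : T -> 'rV[R]_d) :
  (forall i, measurable_fun [set: T] (fun t => f t ord0 i)) ->
  measurable_fun [set: T] f.
Proof.
move=> mf; apply: (@measurability _ _ _ _ _ _ (@open 'rV[R]_d)) => //.
move=> _ [U oU <-]; rewrite setTI (open_rV_bigcup oU) preimage_bigcup.
rewrite bigcup_mkcond; apply: countable_bigcupT_measurable => // -[q k].
case: ifP => // _ /=.
have k0 : 0 < k.+1%:R^-1 :> R by rewrite invr_gt0.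
rewrite (_ : _ @^-1` _ = \bigcap_(i in [set: 'I_d])
    [set t | ball (ratr (q ord0 i) : R) k.+1%:R^-1 (f t ord0 i)]).
  apply: fin_bigcap_measurable => // i _.
  rewrite -[X in measurable X]setTI; apply: mf => //.
  by apply: open_measurable; exact: ball_open.
apply/seteqP; split => t /=.
  by move=> [_ tq] i _; have := tq ord0 i; rewrite mxE.
by move=> tq; split => // i j; rewrite ord1 mxE; exact: tq.
Qed.

Definition cons_rV d (p : R * 'rV[R]_d) : 'rV[R]_d.+1 := row_mx (p.1)%:M p.2.

Lemma cons_rV0 d (p : R * 'rV[R]_d) : cons_rV p ord0 ord0 = p.1.
Proof.
have := row_mxEl (p.1)%:M p.2 ord0 (ord0 : 'I_1); rewrite [RHS]mxE eqxx mulr1n => <-.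
by congr (row_mx _ _ _ _); exact: val_inj.
Qed.

Lemma cons_rVS d (p : R * 'rV[R]_d) i :
  cons_rV p ord0 (lift ord0 i) = p.2 ord0 i.
Proof.
rewrite -(row_mxEr (p.1)%:M p.2 ord0 i).
by congr (row_mx _ _ _ _); exact: val_inj.
Qed.

Lemma measurable_cons_rV d : measurable_fun setT (@cons_rV d).
Proof.
apply: measurable_fun_rV => i; case: (unliftP ord0 i) => [j|] ->.
  under eq_fun do rewrite cons_rVS.
  by apply: (measurableT_comp (measurable_coord j)); exact: measurable_snd.
by under eq_fun do rewrite cons_rV0; exact: measurable_fst.
Qed.

Definition uncons_rV d (x : 'rV[R]_d.+1) : R * 'rV[R]_d :=
  (x ord0 ord0, \row_i x ord0 (lift ord0 i)).

Lemma cons_rVK d : cancel (@cons_rV d) (@uncons_rV d).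
Proof.
move=> [t y]; rewrite /uncons_rV cons_rV0; congr pair.
by apply/rowP => i; rewrite mxE cons_rVS.
Qed.

Lemma measurable_uncons_rV d : measurable_fun setT (@uncons_rV d).
Proof.
apply/measurable_fun_pairP; split; first exact: measurable_coord.
apply: measurable_fun_rV => i; under eq_fun do rewrite mxE.
exact: measurable_coord.
Qed.

End borel_rV.

Section lebesgue_rV.
Context {R : realType}.

(* d-dimensional Lebesgue measure, restricted to the Borel sets *)
Fixpoint lebesgue_rV d : set 'rV[R]_d -> \bar R :=
  match d with
  | 0 => \d_ (0 : 'rV[R]_0)
  | d'.+1 => pushforward (lebesgue_measure \x @lebesgue_rV d')%E (@cons_rV R d')
  end.

Let sigma_finite_prod d1 d2 (T1 : measurableType d1) (T2 : measurableType d2)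
  (m1 : {sigma_finite_measure set T1 -> \bar R})
  (m2 : {sigma_finite_measure set T2 -> \bar R}) :
  sigma_finite setT (m1 \x m2)%E.
Proof.
have /sigma_finiteP[F [TF ndF Foo]] := sigma_finiteT m1.
have /sigma_finiteP[G [TG ndG Goo]] := sigma_finiteT m2.
exists (fun n => F n `*` G n).
  rewrite -setXTT TF TG predeqE => -[x y]; split.
    move=> [/= [n _ Fnx] [k _ Gky]]; exists (maxn n k) => //; split.
    - by move: x Fnx; exact/subsetPset/ndF/leq_maxl.
    - by move: y Gky; exact/subsetPset/ndG/leq_maxr.
  by move=> [n _ []/= ? ?]; split; exists n.
move=> k; have [? ?] := Foo k; have [? ?] := Goo k.
split; first exact: measurableX.
by rewrite product_measure1E// lte_mul_pinfty// ge0_fin_numE.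
Qed.

Let pushforward_cons d (m : {sigma_finite_measure set 'rV[R]_d -> \bar R}) :
  exists mu : {sigma_finite_measure set 'rV[R]_d.+1 -> \bar R},
    pushforward (lebesgue_measure \x m)%E (@cons_rV R d) = mu :> (set _ -> _).
Proof.
set P := pushforward _ _.
have [nu nuE] : exists nu, nu = P by exists P.
have nu0 : nu set0 = 0%E by rewrite nuE /P /pushforward preimage_set0 measure0.
have nu_ge0 A : (0 <= nu A)%E.
  by rewrite nuE; exact: (measure_ge0 (lebesgue_measure \x m)%E).
have nuD : semi_sigma_additive nu.
  rewrite nuE => F mF tF mUF; rewrite /P /pushforward preimage_bigcup.
  apply: (@measure_semi_sigma_additive _ _ _ (lebesgue_measure \x m)%E).
  - by move=> n; rewrite -[X in measurable X]setTI; exact: measurable_cons_rV.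
  - apply/trivIsetP => /= i j _ _ ij; rewrite -preimage_setI.
    by move/trivIsetP : tF => /(_ _ _ _ _ ij) ->//; rewrite preimage_set0.
  - rewrite -preimage_bigcup -[X in measurable X]setTI.
    exact: measurable_cons_rV.
pose nuM : {measure set 'rV[R]_d.+1 -> \bar R} :=
  HB.pack nu (isMeasure.Build _ _ _ nu nu0 nu_ge0 nuD).
have nuS : sigma_finite setT nuM.
  have [F TF Foo] : sigma_finite setT (lebesgue_measure \x m)%E.
    exact: sigma_finite_prod.
  exists (fun k => @uncons_rV R d @^-1` F k).
    by rewrite -preimage_bigcup -TF preimage_setT.
  move=> k; have [mF Fk] := Foo k; split.
    by rewrite -[X in measurable X]setTI; exact: measurable_uncons_rV.
  suff -> : nuM (uncons_rV (d:=d) @^-1` F k) = (lebesgue_measure \x m)%E (F k) by [].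
  rewrite /= nuE /P /pushforward; congr (_ _).
  by apply/seteqP; split => p; rewrite /= cons_rVK.
pose nuSM : {sigma_finite_measure set 'rV[R]_d.+1 -> \bar R} :=
  HB.pack (Measure.sort nuM) (Measure_isSigmaFinite.Build _ _ _ nuM nuS).
by exists nuSM; rewrite -nuE.
Qed.

Let lebesgue_rV_measure d :
  exists mu : {sigma_finite_measure set 'rV[R]_d -> \bar R},
    @lebesgue_rV d = mu :> (set _ -> _).
Proof.
elim: d => [|d [mu /= ->]]; first by exists (\d_ (0 : 'rV[R]_0)).
exact: pushforward_cons.
Qed.

Let lebesgue_rV0 d : @lebesgue_rV d set0 = 0%E.
Proof. by have [mu ->] := lebesgue_rV_measure d; exact: measure0. Qed.

Let lebesgue_rV_ge0 d A : (0 <= @lebesgue_rV d A)%E.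
Proof. by have [mu ->] := lebesgue_rV_measure d; exact: measure_ge0. Qed.

Let lebesgue_rV_sigma_additive d : semi_sigma_additive (@lebesgue_rV d).
Proof.
have [mu ->] := lebesgue_rV_measure d; exact: measure_semi_sigma_additive.
Qed.

HB.instance Definition _ d := isMeasure.Build _ _ _ (@lebesgue_rV d)
  (@lebesgue_rV0 d) (@lebesgue_rV_ge0 d) (@lebesgue_rV_sigma_additive d).

Let lebesgue_rV_sigma_finite d : sigma_finite setT (@lebesgue_rV d).
Proof. by have [mu ->] := lebesgue_rV_measure d; exact: sigma_finiteT. Qed.

HB.instance Definition _ d := Measure_isSigmaFinite.Build _ _ _
  (@lebesgue_rV d) (@lebesgue_rV_sigma_finite d).

Lemma lebesgue_rV_box d (a b : 'rV[R]_d) : (forall i, a ord0 i <= b ord0 i) ->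
  lebesgue_rV [set x : 'rV[R]_d | forall i, x ord0 i \in `[a ord0 i, b ord0 i]] =
  (\prod_i (b ord0 i - a ord0 i))%:E.
Proof.
elim: d => [|d IH] in a b *  => ab.
  by rewrite big_ord0 /= diracE mem_set// => -[].
set X := [set x : 'rV[R]_d.+1 | _].
have -> : lebesgue_rV X =
  (lebesgue_measure \x @lebesgue_rV d)%E (@cons_rV R d @^-1` X) by [].
have -> : @cons_rV R d @^-1` X = `[a ord0 ord0, b ord0 ord0]%classic `*`
    [set y : 'rV[R]_d | forall i,
       y ord0 i \in `[(uncons_rV a).2 ord0 i, (uncons_rV b).2 ord0 i]].
  apply/seteqP; split => [[t y]|[t y]] /=.
    move=> h; split; first by have := h ord0; rewrite cons_rV0.
    by move=> i; have := h (lift ord0 i); rewrite cons_rVS !mxE.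
  move=> [ht hy] i; case: (unliftP ord0 i) => [j|] ->; last by rewrite cons_rV0.
  by have := hy j; rewrite cons_rVS !mxE.
rewrite product_measure1E//; last first.
  rewrite (_ : mkset _ = \bigcap_(i in [set: 'I_d]) [set y : 'rV[R]_d |
      y ord0 i \in `[(uncons_rV a).2 ord0 i, (uncons_rV b).2 ord0 i]]).
    apply: fin_bigcap_measurable => // i _; rewrite -[X in measurable X]setTI.
    exact: (measurable_coord i measurableT (measurable_itv _)).
  by apply/seteqP; split => y yab i; [move=> _; exact: yab|exact: yab i I].
rewrite big_ord_recl EFinM; congr (_ * _)%E.
  rewrite [LHS](lebesgue_measure_itv `[a ord0 ord0, b ord0 ord0]) /= lte_fin.
  have := ab ord0; rewrite le_eqVlt => /predU1P[->|ab0].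
    by rewrite ltxx subrr.
  by rewrite ab0 -EFinB.
rewrite [LHS](IH (uncons_rV a).2 (uncons_rV b).2); last first.
  by move=> i; rewrite !mxE.
by congr EFin; apply: eq_bigr => i _; rewrite !mxE.
Qed.

End lebesgue_rV.

Section defs.
Context {R : realType}.

(* The library's norm on ['rV[R]_d] is the sup norm; it induces the same
   topology and the same bounded sets as the Euclidean one. *)
Definition enorm d (x : 'rV[R]_d) : R := Num.sqrt (\sum_i x ord0 i ^+ 2).

Definition eball d (x : 'rV[R]_d) (r : R) : set 'rV[R]_d :=
  [set y | enorm (y - x) < r].

Definition Gamma (s : R) : R :=
  \int[lebesgue_measure]_(t in `]0, +oo[) (t `^ (s - 1) * expR (- t)).

Definition omega (s : R) : R := pi `^ (s / 2) / Gamma (s / 2 + 1).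

(* Radii may be 0: such a ball is empty and contributes [0 `^ s = 0] for
   [s > 0], so that finite coverings are included. *)
Definition hausdorff_content d (s : R) (A : set 'rV[R]_d) : \bar R :=
  ereal_inf [set z | exists (x : nat -> 'rV[R]_d) (r : nat -> R),
    [/\ forall i, 0 <= r i,
        A `<=` \bigcup_i eball (x i) (r i) &
        z = (\sum_(0 <= i <oo) (omega s * r i `^ s)%:E)%E]].

Fixpoint partial d (s : seq 'I_d) (f : 'rV[R]_d -> R) : 'rV[R]_d -> R :=
  if s is i :: s' then fun x => 'D_(delta_mx ord0 i) (partial s' f) x else f.

Definition smooth_on d (U : set 'rV[R]_d) (f : 'rV[R]_d -> R) :=
  forall (s : seq 'I_d) (x : 'rV[R]_d), U x ->
    {for x, continuous (partial s f)} /\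
    forall i : 'I_d, derivable (partial s f) x (delta_mx ord0 i).

(* C^oo of the closure of the open set [U]: all partial derivatives in [U]
   extend continuously to the closure. The values of [f] off the closure are
   irrelevant. *)
Definition smooth_on_closure d (U : set 'rV[R]_d) (f : 'rV[R]_d -> R) :=
  [/\ smooth_on U f,
      {within closure U, continuous f} &
      forall s : seq 'I_d, exists g : 'rV[R]_d -> R,
        {within closure U, continuous g} /\
        forall x, U x -> g x = partial s f x].

(* Near each boundary point, and up to relabelling and reorienting the
   coordinate axes, the open set [U] is the region above the graph of a smooth
   function of d - 1 variables. *)
Definition smooth_boundary d (U : set 'rV[R]_d) :=
  forall p, (closure U `\` U) p ->
    exists (i : 'I_d) (b : bool) (g : 'rV[R]_d.-1 -> R) (r : R),
      [/\ 0 < r, smooth_on setT g &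
          forall x, eball p r x ->
            (U x <-> g (col' i x) < (-1) ^+ b * x ord0 i)].

Definition mean d (U : set 'rV[R]_d) (f : 'rV[R]_d -> R) : R :=
  (fine (lebesgue_rV U))^-1 * \int[@lebesgue_rV R d]_(x in U) f x.

End defs.

(* Main.v *)
From HB Require Import structures.
Require Import Defs.
From mathcomp Require Import all_boot all_order all_algebra.
From mathcomp Require Import all_classical all_reals all_analysis.
From mathcomp Require Import measurable_realfun.
From mathcomp Require Import ring lra.
Import Order.TTheory GRing.Theory Num.Theory.
Import numFieldNormedType.Exports.
Local Open Scope classical_set_scope.
Local Open Scope ring_scope.

Set Implicit Arguments.
Unset Strict Implicit.
Unset Printing Implicit Defensive.

(** The idea is to reduce the inequality to sets by the coarea formula, and to
    pay for the [mu]-mass of a set by the energy it has in a family of disjoint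
    boxes.

    Throughout, the content enters only through the consequence
    [mu A <= K r ^ (d - alpha)] for [A] inside a ball of radius [r]
    ([frostman], [frostman_content]); [K] depends on [d] alone because [omega]
    is bounded on [[0, d]].

    Isoperimetry with the factor [1 - alpha].  In a convex set [Q] let [G t] be
    the part of the energy of a function that comes from pairs of points at
    distance at most [t].  Passing through the midpoint of a pair shows
    [G (2 t) <= 2 ^ (1 - alpha) G t] ([energy_midpoint]).  Hence the pairs at
    distance between [t] and [64 t] contribute at most
    [(2 ^ (6 (1 - alpha)) - 1) G t], which is at most [63 (1 - alpha)] times
    the energy ([energy_annulus]).  If [Q] is a box with sides comparable to
    [l], and [A] fills between a quarter and a half of it, these distant pairs
    alone contribute a multiple of [l ^ (d - alpha)] to the energy of the
    indicator of [A] ([box_isoperimetry]).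

    Boxing.  Let [A] be open in a box [Q] and fill at most half of it.
    Bisecting [Q], one stops at the first boxes in which [A] has density at
    least a quarter.  They are disjoint, cover [A], and have density at most a
    half because their parents have density less than a quarter.  So the
    [mu]-mass of each is at most a multiple of [(1 - alpha)] times the energy
    of the indicator of [A] in it, and these energies add up ([bisection],
    [boxing]).

    Functions.  Applied to [{u > t}] for all [t] above a median of [u], and to
    [{u < t}] for [t] below, this integrates to a bound on the [mu]-integral of
    [|u - m|] by [(1 - alpha)] times the energy of [u] in [Q]
    ([coarea], [cube_oscillation]).

    Domains.  Near a boundary point a shear, which preserves Lebesgue measure
    and is locally Lipschitz, maps boxes resting on a coordinate hyperplane into
    the domain, so every point of the closure has a neighbourhood on which the
    inequality holds with some constant [m] in place of the mean
    ([interior_patch], [boundary_patch]).  The constant [m] does not depend on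
    the measure.  Lebesgue measure, which is also admissible, therefore compares
    the constants of two overlapping patches ([trace_poincare_union]), and
    compactness and connectedness give the inequality on the whole domain
    ([trace_poincare_compact]).  A last use of Lebesgue measure replaces [m] by
    the mean ([mean_close]). *)

(** * Boxes and Lebesgue measure in R^d *)

Section boxes.
Context {R : realType}.

Lemma rV_normP d (x : 'rV[R]_d) (r : R) : 0 <= r ->
  reflect (forall i, `|x ord0 i| <= r) (`|x| <= r).
Proof.
move=> r0; rewrite [`|x|]/Num.norm/= mx_normrE.
apply: (iffP idP) => [h i|h].
  apply: le_trans h; apply: (@le_trans _ _ `|x (ord0, i).1 (ord0, i).2|) => //.
  exact: (le_bigmax _ (fun i : 'I_1 * 'I_d => `|x i.1 i.2|) (ord0, i)).
by apply: bigmax_le => // -[i j] _ /=; rewrite ord1.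
Qed.

Lemma rV_coord_le d (x : 'rV[R]_d) i : `|x ord0 i| <= `|x|.
Proof. by apply/rV_normP; rewrite ?normr_ge0. Qed.

Lemma continuous_measurable_rV d (f : 'rV[R]_d -> R) :
  continuous f -> measurable_fun [set: 'rV[R]_d] f.
Proof.
move=> cf; apply: (measurability _ (RGenOpens.measurableE R)) => _ [_ [a [b ->] <-]].
rewrite setTI; apply: open_measurable_rV.
by apply: open_comp => [x _|]; [exact: cf|exact: interval_open].
Qed.

Lemma measurable_rV_norm d dT (T : measurableType dT) (f : T -> 'rV[R]_d) :
  measurable_fun setT f -> measurable_fun setT (fun x => `|f x|).
Proof.
move=> mf; apply: (@measurableT_comp _ _ _ _ _ _ (fun x : 'rV[R]_d => `|x|)) mf.
by apply: continuous_measurable_rV; exact: norm_continuous.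
Qed.

Lemma measurable_rV_coord d dT (T : measurableType dT) (f : T -> 'rV[R]_d) i :
  measurable_fun setT f -> measurable_fun setT (fun x => f x ord0 i).
Proof. by move=> mf; exact: (measurableT_comp (measurable_coord i) mf). Qed.

Lemma measurable_rVD d dT (T : measurableType dT) (f g : T -> 'rV[R]_d) :
  measurable_fun setT f -> measurable_fun setT g ->
  measurable_fun setT (fun x => f x + g x).
Proof.
move=> mf mg; apply: measurable_fun_rV => i; under eq_fun do rewrite mxE.
by apply: measurable_funD; exact: measurable_rV_coord.
Qed.

Lemma measurable_rVZ d dT (T : measurableType dT) (c : R) (f : T -> 'rV[R]_d) :
  measurable_fun setT f -> measurable_fun setT (fun x => c *: f x).
Proof.
move=> mf; apply: measurable_fun_rV => i; under eq_fun do rewrite mxE.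
by apply: measurable_funM => //; exact: measurable_rV_coord.
Qed.

Lemma measurable_rVB d dT (T : measurableType dT) (f g : T -> 'rV[R]_d) :
  measurable_fun setT f -> measurable_fun setT g ->
  measurable_fun setT (fun x => f x - g x).
Proof.
move=> mf mg; apply: measurable_fun_rV => i; under eq_fun do rewrite !mxE.
by apply: measurable_funB; exact: measurable_rV_coord.
Qed.

Lemma measurable_rV_closed_ball d (y : 'rV[R]_d) (r : R) :
  measurable [set z | `|y - z| <= r].
Proof.
rewrite (_ : mkset _ = (fun z => `|y - z|) @^-1` `]-oo, r]%classic).
  have mn : measurable_fun setT (fun z : 'rV[R]_d => `|y - z|).
    by apply: measurable_rV_norm; apply: measurable_rVB.
  by rewrite -[X in measurable X]setTI; exact: mn.
by apply/seteqP; split => z; rewrite /= in_itv/=.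
Qed.

Lemma measurable_cylinder d (S : 'I_d -> set R) :
  (forall i, measurable (S i)) ->
  measurable [set x : 'rV[R]_d | forall i, S i (x ord0 i)].
Proof.
move=> mS; rewrite (_ : mkset _ = \bigcap_(i in [set: 'I_d])
    [set x : 'rV[R]_d | S i (x ord0 i)]).
  apply: fin_bigcap_measurable => // i _; rewrite -[X in measurable X]setTI.
  exact: (measurable_coord i measurableT (mS i)).
by apply/seteqP; split => y ySi i; [move=> _; exact: ySi|exact: ySi i I].
Qed.

Lemma lebesgue_rV_cylinder d (S : 'I_d -> set R) (c : 'I_d -> R) :
  (forall i, measurable (S i)) ->
  (forall i, lebesgue_measure (S i) = (c i)%:E) ->
  lebesgue_rV [set x : 'rV[R]_d | forall i, S i (x ord0 i)] = (\prod_i c i)%:E.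
Proof.
elim: d => [|d IH] in S c *  => mS Sc.
  by rewrite big_ord0 /= diracE mem_set// => -[].
set X := [set x : 'rV[R]_d.+1 | _].
have -> : lebesgue_rV X =
  (lebesgue_measure \x @lebesgue_rV R d)%E (@cons_rV R d @^-1` X) by [].
have -> : @cons_rV R d @^-1` X = S ord0 `*`
    [set y : 'rV[R]_d | forall i, S (lift ord0 i) (y ord0 i)].
  apply/seteqP; split => [[t y]|[t y]] /=.
    move=> h; split; first by have := h ord0; rewrite cons_rV0.
    by move=> i; have := h (lift ord0 i); rewrite cons_rVS.
  move=> [ht hy] i; case: (unliftP ord0 i) => [j|] ->; last by rewrite cons_rV0.
  by have := hy j; rewrite cons_rVS.
rewrite product_measure1E//; last first.
  by apply: (@measurable_cylinder d (fun i => S (lift ord0 i))).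
  exact: mS.
rewrite big_ord_recl EFinM; congr (_ * _)%E; first exact: Sc.
by apply: (IH (fun i => S (lift ord0 i)) (fun i => c (lift ord0 i))).
Qed.

(** Half-open, so that bisecting a box gives a partition of it. *)
Definition box d (a b : 'rV[R]_d) : set 'rV[R]_d :=
  [set x | forall i, x ord0 i \in `]a ord0 i, b ord0 i]].

Lemma measurable_box d (a b : 'rV[R]_d) : measurable (box a b).
Proof.
exact: (@measurable_cylinder d (fun i => [set` `]a ord0 i, b ord0 i]])).
Qed.

Lemma lebesgue_rV_ocbox d (a b : 'rV[R]_d) :
  (forall i, a ord0 i <= b ord0 i) ->
  lebesgue_rV (box a b) = (\prod_i (b ord0 i - a ord0 i))%:E.
Proof.
move=> ab; apply: (@lebesgue_rV_cylinder d (fun i => [set` `]a ord0 i, b ord0 i]])) => // i.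
rewrite lebesgue_measure_itv/= lte_fin.
have := ab i; rewrite le_eqVlt => /predU1P[->|abi].
  by rewrite ltxx subrr.
by rewrite abi -EFinB.
Qed.

(** The identity from R^d with the sigma-algebra of boxes to R^d with the
    Borel one is measurable because its coordinates are. *)
Lemma borel_rV_boxes d :
  (@measurable _ 'rV[R]_d) =
  <<s [set B | exists a b : 'rV[R]_d, B = box a b] >>.
Proof.
set G := [set B | _].
apply/seteqP; split => [A mA|]; last first.
  apply: smallest_sub; first exact: sigma_algebra_measurable.
  by move=> _ [a [b ->]]; exact: measurable_box.
have mG : measurable_fun [set: g_sigma_algebraType G]
    (id : g_sigma_algebraType G -> 'rV[R]_d).
  apply: measurable_fun_rV => i.
  apply: (measurability _ (RGenOInfty.measurableE R)) => _ [_ [t ->] <-].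
  rewrite setTI (_ : _ @^-1` _ = \bigcup_k
    box (\row_j if j == i then t else - k%:R) (const_mx k%:R)).
    by apply: bigcupT_measurable => k; apply: sub_sigma_algebra; eexists; eexists.
  apply/seteqP; split => x /=.
    rewrite in_itv/= andbT => tx.
    exists (Num.truncn `|x|).+1 => // j; rewrite !mxE.
    have xk : `|x ord0 j| < (Num.truncn `|x|).+1%:R.
      by apply: le_lt_trans (rV_coord_le x j) _; exact: truncnS_gt.
    have [xk1 xk2] := andP (eqbLR (ltr_norml _ _) xk).
    by rewrite in_itv/= (ltW xk2) andbT; case: eqP => // ->.
  move=> [k _ /(_ i)]; rewrite !mxE eqxx !in_itv/= => /andP[-> _] //.
by have := mG measurableT A mA; rewrite setTI.
Qed.

(** A change of variables is thus determined by its effect on boxes. *)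
Lemma lebesgue_rV_unique d (m : {measure set 'rV[R]_d -> \bar R}) :
  (forall a b : 'rV[R]_d, (forall i, a ord0 i <= b ord0 i) ->
    m (box a b) = (\prod_i (b ord0 i - a ord0 i))%:E) ->
  forall A, measurable A -> lebesgue_rV A = m A.
Proof.
move=> mE A mA.
pose G := [set B | exists a b : 'rV[R]_d, B = box a b].
have LE B : G B -> lebesgue_rV B = m B.
  move=> [a [b ->]].
  have [ab|] := pselect (forall i, a ord0 i <= b ord0 i).
    by rewrite mE// lebesgue_rV_ocbox.
  move/existsNP => [i /negP]; rewrite -ltNge => ba.
  rewrite (_ : box a b = set0) ?measure0//.
  apply/seteqP; split => x //= /(_ i); rewrite in_itv/= => /andP[ax xb].
  by have := lt_le_trans ax xb; rewrite ltNge (ltW ba).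
apply: (measure_unique G (fun k => box (const_mx (- k%:R)) (const_mx k%:R))) => //.
- exact: borel_rV_boxes.
- move=> _ _ [a1 [b1 ->]] [a2 [b2 ->]].
  exists (\row_i Num.max (a1 ord0 i) (a2 ord0 i)).
  exists (\row_i Num.min (b1 ord0 i) (b2 ord0 i)).
  apply/seteqP; split => x /=.
    move=> [h1 h2] i; move: (h1 i) (h2 i); rewrite !in_itv/= !mxE.
    by rewrite gt_max le_min => /andP[-> ->] /andP[-> ->].
  by move=> h; split=> i; have := h i; rewrite !in_itv/= !mxE gt_max le_min
    => /andP[/andP[h1 h2] /andP[h3 h4]]; rewrite ?h1 ?h2 ?h3 ?h4.
- by move=> k; exists (const_mx (- k%:R)), (const_mx k%:R).
- apply/seteqP; split => // x _; exists (Num.truncn `|x|).+1 => // j; rewrite !mxE.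
  have xk : `|x ord0 j| < (Num.truncn `|x|).+1%:R.
    by apply: le_lt_trans (rV_coord_le x j) _; exact: truncnS_gt.
  have [xk1 xk2] := andP (eqbLR (ltr_norml _ _) xk).
  by rewrite in_itv/= (ltW xk2) andbT.
- move=> k; apply: (@le_lt_trans _ _ (\prod_(i < d) ((const_mx k%:R : 'rV[R]_d) ord0 i
    - (const_mx (- k%:R) : 'rV[R]_d) ord0 i))%:E); last exact: ltry.
  rewrite le_eqVlt; apply/orP; left; apply/eqP.
  by apply: lebesgue_rV_ocbox => i; rewrite !mxE ge0_cp.
Qed.

End boxes.

(** * Midpoints, splitting off a coordinate, and shears *)

Section change_of_variables.
Context {R : realType}.

Lemma integral_pushforward_scale d1 d2 (T1 : measurableType d1)
    (T2 : measurableType d2) (m1 : {measure set T1 -> \bar R})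
    (m2 : {measure set T2 -> \bar R}) (c : R) (phi : T1 -> T2) (f : T2 -> R) :
  0 <= c -> measurable_fun setT phi ->
  (forall A, measurable A -> m1 (phi @^-1` A) = (c%:E * m2 A)%E) ->
  measurable_fun setT f -> (forall x, 0 <= f x) ->
  (\int[m1]_x (f (phi x))%:E = c%:E * \int[m2]_x (f x)%:E)%E.
Proof.
move=> c0 mphi m12 mf f0.
have mEf : measurable_fun setT (EFin \o f) by exact/measurable_EFinP.
transitivity (\int[pushforward m1 phi]_x (f x)%:E)%E.
  by rewrite ge0_integral_pushforward// => x _; rewrite lee_fin.
rewrite -(@ge0_integral_mscale _ _ _ m2 setT measurableT (NngNum c0))//; last first.
  by move=> x _; rewrite lee_fin.
by apply: eq_measure_integral => A mA _; exact: m12.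
Qed.

Definition midpoint d (y z : 'rV[R]_d) : 'rV[R]_d := 2^-1 *: (y + z).

Lemma midpointC d (y z : 'rV[R]_d) : midpoint y z = midpoint z y.
Proof. by rewrite /midpoint addrC. Qed.

Lemma measurable_midpoint d dT (T : measurableType dT) (f g : T -> 'rV[R]_d) :
  measurable_fun setT f -> measurable_fun setT g ->
  measurable_fun setT (fun x => midpoint (f x) (g x)).
Proof. by move=> mf mg; apply: measurable_rVZ; exact: measurable_rVD. Qed.

Lemma lebesgue_rV_midpoint d (y : 'rV[R]_d) (A : set 'rV[R]_d) :
  measurable A ->
  (lebesgue_rV (midpoint y @^-1` A) = (2 ^+ d)%:E * lebesgue_rV A)%E.
Proof.
move=> mA.
have mm : measurable_fun setT (midpoint y) by exact: measurable_midpoint.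
have c0 : 0 <= (2 ^+ d)^-1 :> R by rewrite invr_ge0 exprn_ge0.
pose m : {measure set 'rV[R]_d -> \bar R} :=
  mscale (NngNum c0) (measure_function_pushforward__canonical__measure_function_Measure (@lebesgue_rV R d) mm).
have mE : (lebesgue_rV A = (2 ^+ d)^-1%:E * lebesgue_rV (midpoint y @^-1` A))%E.
  apply: (@lebesgue_rV_unique _ _ m) => // a b ab.
  transitivity ((2 ^+ d)^-1%:E * lebesgue_rV (midpoint y @^-1` box a b))%E => //.
  rewrite (_ : _ @^-1` _ = box (2 *: a - y) (2 *: b - y)); last first.
    apply/seteqP; split => x /= h i; have := h i;
    rewrite !in_itv/= !mxE => /andP[h1 h2]; apply/andP; split; lra.
  rewrite [lebesgue_rV _]lebesgue_rV_ocbox; last first.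
    by move=> i; rewrite !mxE lerB// ler_pM2l.
  rewrite -EFinM; congr EFin; rewrite -[d in 2 ^+ d]card_ord -prodr_const -prodfV -big_split/=.
  by apply: eq_bigr => i _; rewrite !mxE; lra.
by rewrite mE muleA -EFinM mulfV ?mul1e// expf_neq0.
Qed.

Lemma integral_midpoint d (y : 'rV[R]_d) (f : 'rV[R]_d -> R) :
  measurable_fun setT f -> (forall x, 0 <= f x) ->
  (\int[@lebesgue_rV R d]_z (f (midpoint y z))%:E =
   (2 ^+ d)%:E * \int[@lebesgue_rV R d]_z (f z)%:E)%E.
Proof.
apply: integral_pushforward_scale; first by rewrite exprn_ge0.
  exact: measurable_midpoint.
exact: lebesgue_rV_midpoint.
Qed.

Definition insert_coord d (i : 'I_d.+1) (t : R) (y : 'rV[R]_d) : 'rV[R]_d.+1 :=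
  \row_j if unlift i j is Some k then y ord0 k else t.

Lemma insert_coord_same d (i : 'I_d.+1) t (y : 'rV[R]_d) :
  insert_coord i t y ord0 i = t.
Proof. by rewrite mxE unlift_none. Qed.

Lemma insert_coord_lift d (i : 'I_d.+1) t (y : 'rV[R]_d) j :
  insert_coord i t y ord0 (lift i j) = y ord0 j.
Proof. by rewrite mxE liftK. Qed.

Lemma col'_insert_coord d (i : 'I_d.+1) t (y : 'rV[R]_d) :
  col' i (insert_coord i t y) = y.
Proof. by apply/rowP => j; rewrite mxE insert_coord_lift. Qed.

Lemma insert_coord_col' d (i : 'I_d.+1) (x : 'rV[R]_d.+1) :
  insert_coord i (x ord0 i) (col' i x) = x.
Proof.
apply/rowP => j; case: (unliftP i j) => [k|] ->.
  by rewrite insert_coord_lift mxE.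
by rewrite insert_coord_same.
Qed.

Lemma measurable_insert_coord d (i : 'I_d.+1) dT (T : measurableType dT)
    (f : T -> R) (g : T -> 'rV[R]_d) :
  measurable_fun setT f -> measurable_fun setT g ->
  measurable_fun setT (fun x => insert_coord i (f x) (g x)).
Proof.
move=> mf mg; apply: measurable_fun_rV => j; case: (unliftP i j) => [k|] ->.
  by under eq_fun do rewrite insert_coord_lift; exact: measurable_rV_coord.
by under eq_fun do rewrite insert_coord_same.
Qed.

(** By definition Lebesgue measure splits off the first coordinate; the charts
    split off an arbitrary one. *)
Lemma lebesgue_rV_insert d (i : 'I_d.+1) (A : set 'rV[R]_d.+1) :
  measurable A ->
  lebesgue_rV A = (lebesgue_measure \x @lebesgue_rV R d)%E
    ((fun p => insert_coord i p.1 p.2) @^-1` A).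
Proof.
move=> mA.
have mi : measurable_fun setT (fun p : R * 'rV[R]_d => insert_coord i p.1 p.2).
  by apply: measurable_insert_coord.
pose m : {measure set 'rV[R]_d.+1 -> \bar R} :=
  measure_function_pushforward__canonical__measure_function_Measure
    (lebesgue_measure \x @lebesgue_rV R d)%E mi.
apply: (@lebesgue_rV_unique _ _ m) => // a b ab.
transitivity ((lebesgue_measure \x @lebesgue_rV R d)%E
    ((fun p => insert_coord i p.1 p.2) @^-1` box a b)) => //.
rewrite (_ : _ @^-1` _ = `]a ord0 i, b ord0 i]%classic
   `*` box (col' i a) (col' i b)).
  rewrite product_measure1E//; last exact: measurable_box.
  rewrite (bigD1_ord i)//= EFinM; congr (_ * _)%E.
    rewrite [LHS](lebesgue_measure_itv `]a ord0 i, b ord0 i]) /= lte_fin.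
    have := ab i; rewrite le_eqVlt => /predU1P[->|abi].
      by rewrite ltxx subrr.
    by rewrite abi -EFinB.
  rewrite [LHS]lebesgue_rV_ocbox => [|j]; rewrite ?mxE//.
  by congr EFin; apply: eq_bigr => j _; rewrite !mxE.
apply/seteqP; split => -[t y] /=.
  move=> h; split; first by have := h i; rewrite insert_coord_same.
  by move=> j; have := h (lift i j); rewrite insert_coord_lift !mxE.
move=> [h1 h2] j; case: (unliftP i j) => [k|] ->.
  by rewrite insert_coord_lift; have := h2 k; rewrite !mxE.
by rewrite insert_coord_same.
Qed.

End change_of_variables.

Section charts.
Context {R : realType}.

(** Maps the half-space [0 < x i] onto the region above the graph of [g], in
    the form in which a smooth boundary is described. *)
Definition chart d (i : 'I_d.+1) (b : bool) (g : 'rV[R]_d -> R) (x : 'rV[R]_d.+1) :=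
  insert_coord i ((-1) ^+ b * (x ord0 i + g (col' i x))) (col' i x).

Definition unchart d (i : 'I_d.+1) (b : bool) (g : 'rV[R]_d -> R) (x : 'rV[R]_d.+1) :=
  insert_coord i ((-1) ^+ b * x ord0 i - g (col' i x)) (col' i x).

Lemma unchartK d (i : 'I_d.+1) b (g : 'rV[R]_d -> R) :
  cancel (unchart i b g) (chart i b g).
Proof.
move=> x; rewrite /chart /unchart col'_insert_coord insert_coord_same.
by rewrite subrK signrMK insert_coord_col'.
Qed.

Lemma chartK d (i : 'I_d.+1) b (g : 'rV[R]_d -> R) :
  cancel (chart i b g) (unchart i b g).
Proof.
move=> x; rewrite /chart /unchart col'_insert_coord insert_coord_same.
by rewrite signrMK addrK insert_coord_col'.
Qed.

Lemma measurable_col' d (i : 'I_d.+1) :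
  measurable_fun setT (col' i : 'rV[R]_d.+1 -> 'rV[R]_d).
Proof.
apply: measurable_fun_rV => j; under eq_fun do rewrite mxE.
exact: measurable_coord.
Qed.

Lemma measurable_chart d (i : 'I_d.+1) b (g : 'rV[R]_d -> R) :
  measurable_fun setT g -> measurable_fun setT (chart i b g).
Proof.
move=> mg; apply: measurable_insert_coord; last exact: measurable_col'.
apply: measurable_funM => //; apply: measurable_funD; first exact: measurable_coord.
by apply: (measurableT_comp mg); exact: measurable_col'.
Qed.

Lemma measurable_unchart d (i : 'I_d.+1) b (g : 'rV[R]_d -> R) :
  measurable_fun setT g -> measurable_fun setT (unchart i b g).
Proof.
move=> mg; apply: measurable_insert_coord; last exact: measurable_col'.
apply: measurable_funB; last first.
  by apply: (measurableT_comp mg); exact: measurable_col'.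
by apply: measurable_funM => //; exact: measurable_coord.
Qed.

Lemma lebesgue_measure_sign_shift (b : bool) (u v c : R) : u <= v ->
  lebesgue_measure [set t : R | (-1) ^+ b * (t + c) \in `]u, v]] = (v - u)%:E.
Proof.
move=> uv; case: b; rewrite ?expr0 ?expr1.
  rewrite (_ : mkset _ = `[- v - c, - u - c[%classic); last first.
    apply/seteqP; split => t /=; rewrite !in_itv/= => /andP[h1 h2];
      apply/andP; split; lra.
  rewrite lebesgue_measure_itv/= lte_fin; case: ltP => h.
    by rewrite -EFinB; congr EFin; lra.
  by congr EFin; lra.
rewrite (_ : mkset _ = `]u - c, v - c]%classic); last first.
  apply/seteqP; split => t /=; rewrite !in_itv/= => /andP[h1 h2];
    apply/andP; split; lra.
rewrite lebesgue_measure_itv/= lte_fin; case: ltP => h.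
  by rewrite -EFinB; congr EFin; lra.
by congr EFin; lra.
Qed.

(** A shear along one axis moves every line parallel to that axis by a
    translation, so Cavalieri's principle applies. *)
Lemma lebesgue_rV_chart d (i : 'I_d.+1) b (g : 'rV[R]_d -> R) A :
  measurable_fun setT g -> measurable A ->
  lebesgue_rV (chart i b g @^-1` A) = lebesgue_rV A.
Proof.
move=> mg mA; apply/esym.
have mc := measurable_chart i b mg.
pose m : {measure set 'rV[R]_d.+1 -> \bar R} :=
  measure_function_pushforward__canonical__measure_function_Measure
    (@lebesgue_rV R d.+1) mc.
apply: (@lebesgue_rV_unique _ _ m) => // u v uv.
transitivity (lebesgue_rV (chart i b g @^-1` box u v)) => //.
have mS : measurable (chart i b g @^-1` box u v).
  by rewrite -[X in measurable X]setTI; apply: (mc) => //; exact: measurable_box.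
rewrite (lebesgue_rV_insert i)//.
set S := _ @^-1` _.
have {}mS : measurable S.
  rewrite -[X in measurable X]setTI.
  exact: (measurable_insert_coord i measurable_fst measurable_snd).
have SE t y : S (t, y) <->
    (-1) ^+ b * (t + g y) \in `]u ord0 i, v ord0 i] /\ box (col' i u) (col' i v) y.
  rewrite /S/= /chart/= insert_coord_same col'_insert_coord; split.
    move=> h; split; first by have := h i; rewrite insert_coord_same.
    by move=> j; have := h (lift i j); rewrite insert_coord_lift !mxE.
  move=> [h1 h2] j; case: (unliftP i j) => [k|] ->.
    by rewrite insert_coord_lift; have := h2 k; rewrite !mxE.
  by rewrite insert_coord_same.
rewrite -[S]setIT -integral_indic//.
rewrite (@fubini_tonelli2 _ _ _ _ _ lebesgue_measure (@lebesgue_rV R d) (fun p => (\1_S p)%:E)); last 2 first.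
- by apply/measurable_EFinP; exact: measurable_indic.
- by move=> p; rewrite lee_fin.
rewrite /fubini_G.
transitivity (\int[@lebesgue_rV R d]_y
   ((v ord0 i - u ord0 i)%:E * (\1_(box (col' i u) (col' i v)) y)%:E))%E.
  apply: eq_integral => y _.
  have [yB|yB] := pselect (box (col' i u) (col' i v) y); last first.
    rewrite [in RHS]indicE memNset// mule0 integral0_eq// => t _.
    by rewrite indicE memNset// => /SE[].
  rewrite [in RHS]indicE mem_set// mule1 -(lebesgue_measure_sign_shift b (g y))//.
  rewrite -[in RHS](setIT [set _ | _]) -integral_indic//; last first.
    rewrite (_ : mkset _ = (fun t : R => (-1) ^+ b * (t + g y)) @^-1` [set` `]u ord0 i, v ord0 i]])//.
    rewrite -[X in measurable X]setTI.
    have mf : measurable_fun setT (fun t : R => (-1) ^+ b * (t + g y)).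
      by apply: measurable_funM => //; exact: measurable_funD.
    exact: mf.
  apply: eq_integral => t _; congr EFin; rewrite !indicE; congr (nat_of_bool _)%:R.
  by apply/idP/idP => /set_mem h; apply/mem_set; [have [] := (SE t y).1 h | apply/SE].
rewrite ge0_integralZl//; last 2 first.
- by apply/measurable_EFinP; apply: measurable_indic; exact: measurable_box.
- by rewrite lee_fin subr_ge0.
rewrite integral_indic//; last exact: measurable_box.
rewrite setIT (bigD1_ord i)//= EFinM; congr (_ * _)%E.
rewrite [LHS]lebesgue_rV_ocbox => [|j]; rewrite ?mxE//.
by congr EFin; apply: eq_bigr => j _; rewrite !mxE.
Qed.

End charts.

(** * Nonlocal energies *)

Section real_integrals.
Local Open Scope ereal_scope.
Context d (T : measurableType d) (R : realType) (m : {measure set T -> \bar R}).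

Lemma le_integral_real (f g : T -> R) :
  measurable_fun setT f -> measurable_fun setT g ->
  (forall x, 0 <= f x)%R -> (forall x, f x <= g x)%R ->
  \int[m]_x (f x)%:E <= \int[m]_x (g x)%:E.
Proof.
move=> mf mg f0 fg; apply: ge0_le_integral => //.
- by move=> x _; rewrite lee_fin.
- exact/measurable_EFinP.
- exact/measurable_EFinP.
- by move=> x _; rewrite lee_fin.
Qed.

Lemma integral_realD (f g : T -> R) :
  measurable_fun setT f -> measurable_fun setT g ->
  (forall x, 0 <= f x)%R -> (forall x, 0 <= g x)%R ->
  \int[m]_x (f x + g x)%:E = \int[m]_x (f x)%:E + \int[m]_x (g x)%:E.
Proof.
move=> mf mg f0 g0; under eq_integral do rewrite EFinD.
rewrite ge0_integralD//; first by move=> x _; rewrite lee_fin.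
- exact/measurable_EFinP.
- by move=> x _; rewrite lee_fin.
- exact/measurable_EFinP.
Qed.

Lemma integral_realZ (c : R) (f : T -> R) :
  measurable_fun setT f -> (forall x, 0 <= f x)%R -> (0 <= c)%R ->
  \int[m]_x (c * f x)%:E = c%:E * \int[m]_x (f x)%:E.
Proof.
move=> mf f0 c0; under eq_integral do rewrite EFinM.
rewrite ge0_integralZl//; first exact/measurable_EFinP.
by move=> x _; rewrite lee_fin.
Qed.

Lemma integral_real_ge0 (f : T -> R) : (forall x, 0 <= f x)%R ->
  0 <= \int[m]_x (f x)%:E.
Proof. by move=> f0; apply: integral_ge0 => x _; rewrite lee_fin. Qed.

End real_integrals.

Section energies.
Context {R : realType}.
Local Notation leb d := (@lebesgue_rV R d).
Local Notation leb2 d := (leb d \x leb d)%E.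

Lemma integral2_real d (w : 'rV[R]_d * 'rV[R]_d -> R) :
  measurable_fun setT w -> (forall p, 0 <= w p) ->
  (\int[leb2 d]_p (w p)%:E = \int[leb d]_y \int[leb d]_z (w (y, z))%:E)%E.
Proof.
move=> mw w0; rewrite (@fubini_tonelli1 _ _ _ _ _ (leb d) (leb d) (fun p => (w p)%:E))//.
  exact/measurable_EFinP.
Qed.

Lemma integral2_realC d (w : 'rV[R]_d * 'rV[R]_d -> R) :
  measurable_fun setT w -> (forall p, 0 <= w p) ->
  (\int[leb2 d]_p (w p)%:E = \int[leb d]_z \int[leb d]_y (w (y, z))%:E)%E.
Proof.
move=> mw w0; rewrite (@fubini_tonelli2 _ _ _ _ _ (leb d) (leb d) (fun p => (w p)%:E))//.
  exact/measurable_EFinP.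
Qed.

Lemma measurable_integral2l d (w : 'rV[R]_d * 'rV[R]_d -> R) :
  measurable_fun setT w -> (forall p, 0 <= w p) ->
  measurable_fun setT (fun y => \int[leb d]_z (w (y, z))%:E)%E.
Proof.
move=> mw w0.
apply: (@measurable_fun_fubini_tonelli_F _ _ _ _ _ (leb d) (fun p => (w p)%:E)) => //.
exact/measurable_EFinP.
Qed.

Lemma measurable_integral2r d (w : 'rV[R]_d * 'rV[R]_d -> R) :
  measurable_fun setT w -> (forall p, 0 <= w p) ->
  measurable_fun setT (fun z => \int[leb d]_y (w (y, z))%:E)%E.
Proof.
move=> mw w0.
apply: (@measurable_fun_fubini_tonelli_G _ _ _ _ _ (leb d) (fun p => (w p)%:E)) => //.
exact/measurable_EFinP.
Qed.

Lemma integral2_midpoint_r d (w : 'rV[R]_d * 'rV[R]_d -> R) :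
  measurable_fun setT w -> (forall p, 0 <= w p) ->
  (\int[leb2 d]_p (w (p.1, midpoint p.1 p.2))%:E =
   (2 ^+ d)%:E * \int[leb2 d]_p (w p)%:E)%E.
Proof.
move=> mw w0.
have mm : measurable_fun setT (fun p : 'rV[R]_d * 'rV[R]_d => w (p.1, midpoint p.1 p.2)).
  apply: (measurableT_comp mw); apply: measurable_fun_pair; first exact: measurable_fst.
  by apply: measurable_midpoint; [exact: measurable_fst|exact: measurable_snd].
rewrite !integral2_real// -ge0_integralZl//; last 2 first.
- exact: measurable_integral2l.
- by move=> x _; apply: integral_real_ge0.
apply: eq_integral => y _ /=.
apply: (@integral_midpoint R d y (fun z => w (y, z))) => //.
exact: measurableT_comp.
Qed.

Lemma integral2_midpoint_l d (w : 'rV[R]_d * 'rV[R]_d -> R) :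
  measurable_fun setT w -> (forall p, 0 <= w p) ->
  (\int[leb2 d]_p (w (midpoint p.1 p.2, p.2))%:E =
   (2 ^+ d)%:E * \int[leb2 d]_p (w p)%:E)%E.
Proof.
move=> mw w0.
have mm : measurable_fun setT (fun p : 'rV[R]_d * 'rV[R]_d => w (midpoint p.1 p.2, p.2)).
  apply: (measurableT_comp mw); apply: measurable_fun_pair; last exact: measurable_snd.
  by apply: measurable_midpoint; [exact: measurable_fst|exact: measurable_snd].
rewrite !integral2_realC// -ge0_integralZl//; last 2 first.
- exact: measurable_integral2r.
- by move=> x _; apply: integral_real_ge0.
apply: eq_integral => z _ /=; under eq_integral do rewrite midpointC.
apply: (@integral_midpoint R d z (fun y => w (y, z))) => //.
exact: measurableT_comp.
Qed.

Definition energy_density d (Q : set 'rV[R]_d) (k : 'rV[R]_d -> R)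
    (v : 'rV[R]_d -> R) (p : 'rV[R]_d * 'rV[R]_d) : R :=
  \1_Q p.1 * \1_Q p.2 * (`|v p.1 - v p.2| * k (p.1 - p.2)).

Definition energy d (Q : set 'rV[R]_d) (k : 'rV[R]_d -> R) (v : 'rV[R]_d -> R)
  : \bar R := (\int[leb2 d]_p (energy_density Q k v p)%:E)%E.

Lemma energy_density_ge0 d (Q : set 'rV[R]_d) (k v : 'rV[R]_d -> R) p :
  (forall h, 0 <= k h) -> 0 <= energy_density Q k v p.
Proof. by move=> k0; rewrite !mulr_ge0. Qed.

Lemma measurable_energy_density d (Q : set 'rV[R]_d) (k v : 'rV[R]_d -> R) :
  measurable Q -> measurable_fun setT k -> measurable_fun setT v ->
  measurable_fun setT (energy_density Q k v).
Proof.
move=> mQ mk mv; apply: measurable_funM; last first.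
  apply: measurable_funM.
    apply: measurableT_comp => //; apply: measurable_funB.
      exact: (measurableT_comp mv).
    exact: (measurableT_comp mv).
  apply: (measurableT_comp mk).
  by apply: measurable_rVB; [exact: measurable_fst|exact: measurable_snd].
have mi : measurable_fun setT (\1_Q : 'rV[R]_d -> R) by exact: measurable_indic.
apply: measurable_funM.
  exact: (measurableT_comp mi (@measurable_fst _ _ _ _)).
exact: (measurableT_comp mi (@measurable_snd _ _ _ _)).
Qed.

Lemma energy_ge0 d (Q : set 'rV[R]_d) (k v : 'rV[R]_d -> R) :
  (forall h, 0 <= k h) -> (0 <= energy Q k v)%E.
Proof. by move=> k0; apply: integral_real_ge0 => p; exact: energy_density_ge0. Qed.

Lemma le_energy d (Q : set 'rV[R]_d) (k k' v : 'rV[R]_d -> R) :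
  measurable Q -> measurable_fun setT v -> measurable_fun setT k ->
  measurable_fun setT k' -> (forall h, 0 <= k h) -> (forall h, k h <= k' h) ->
  (energy Q k v <= energy Q k' v)%E.
Proof.
move=> mQ mv mk mk' k0 kk'; apply: le_integral_real => [|||p].
- exact: measurable_energy_density.
- exact: measurable_energy_density.
- by move=> p; exact: energy_density_ge0.
- by rewrite /energy_density ler_wpM2l ?ler_wpM2l// mulr_ge0.
Qed.

Lemma energy_kernelD d (Q : set 'rV[R]_d) (k k' v : 'rV[R]_d -> R) :
  measurable Q -> measurable_fun setT v -> measurable_fun setT k ->
  measurable_fun setT k' -> (forall h, 0 <= k h) -> (forall h, 0 <= k' h) ->
  (energy Q (fun h => k h + k' h)%R v = energy Q k v + energy Q k' v)%E.
Proof.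
move=> mQ mv mk mk' k0 k'0; rewrite /energy -integral_realD.
- by apply: eq_integral => p _; rewrite /energy_density !mulrDr.
- exact: measurable_energy_density.
- exact: measurable_energy_density.
- by move=> p; exact: energy_density_ge0.
- by move=> p; exact: energy_density_ge0.
Qed.

(** Going from [y] to [z] through their midpoint turns one step [y - z] into
    two steps of half the length, and each of the substitutions
    [(y, z) -> (y, m)], [(y, z) -> (m, z)] costs a factor [2 ^ d]. *)
Lemma energy_midpoint d (Q : set 'rV[R]_d) (k k' v : 'rV[R]_d -> R) (c : R) :
  measurable Q -> (forall y z, Q y -> Q z -> Q (midpoint y z)) ->
  measurable_fun setT v -> measurable_fun setT k -> measurable_fun setT k' ->
  (forall h, 0 <= k h) -> (forall h, 0 <= k' h) -> 0 <= c ->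
  (forall h, k h <= c * k' (2^-1 *: h)) ->
  (energy Q k v <= (2 * c * 2 ^+ d)%:E * energy Q k' v)%E.
Proof.
move=> mQ Qm mv mk mk' k0 k'0 c0 kk'.
pose w := energy_density Q k' v.
have mw : measurable_fun setT w by exact: measurable_energy_density.
have w0 p : 0 <= w p by exact: energy_density_ge0.
pose wr (p : 'rV[R]_d * 'rV[R]_d) := w (p.1, midpoint p.1 p.2).
pose wl (p : 'rV[R]_d * 'rV[R]_d) := w (midpoint p.1 p.2, p.2).
have mmid : measurable_fun setT
    (fun p : 'rV[R]_d * 'rV[R]_d => midpoint p.1 p.2).
  by apply: measurable_midpoint; [exact: measurable_fst|exact: measurable_snd].
have mwr : measurable_fun setT wr.
  apply: (measurableT_comp mw); apply: measurable_fun_pair => //.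
have mwl : measurable_fun setT wl.
  by apply: (measurableT_comp mw); apply: measurable_fun_pair.
apply: (@le_trans _ _ (\int[leb2 d]_p (c * (wr p + wl p))%:E)%E).
  apply: le_integral_real => [|||[y z]].
  - exact: measurable_energy_density.
  - by apply: measurable_funM => //; exact: measurable_funD.
  - by move=> p; exact: energy_density_ge0.
  rewrite /wr /wl /w /energy_density/=.
  have [yQ|yQ] := pselect (Q y); last first.
    rewrite [X in X * _ * _ <= _]indicE memNset// !mul0r.
    by rewrite mulr_ge0// addr_ge0// !mulr_ge0.
  have [zQ|zQ] := pselect (Q z); last first.
    rewrite [X in _ * X * _ <= _]indicE memNset// mulr0 !mul0r.
    by rewrite mulr_ge0// addr_ge0// !mulr_ge0.
  rewrite !indicE !mem_set ?mul1r//; last exact: Qm.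
  have -> : y - midpoint y z = 2^-1 *: (y - z).
    by apply/rowP => i; rewrite !mxE; lra.
  have -> : midpoint y z - z = 2^-1 *: (y - z).
    by apply/rowP => i; rewrite !mxE; lra.
  rewrite -mulrDl mulrCA.
  apply: (@le_trans _ _ ((`|v y - v (midpoint y z)| + `|v (midpoint y z) - v z|) * k (y - z))).
    by rewrite ler_wpM2r// ler_distD.
  by rewrite ler_wpM2l// addr_ge0.
rewrite integral_realZ//; last 2 first.
- exact: measurable_funD.
- by move=> p; apply: addr_ge0; exact: w0.
rewrite (integral_realD _ mwr mwl); [|by move=> p; exact: w0|by move=> p; exact: w0].
rewrite /wr /wl integral2_midpoint_r// integral2_midpoint_l//.
rewrite -ge0_muleDl ?lee_fin ?exprn_ge0// -EFinD.
by rewrite muleA -EFinM (_ : c * _ = 2 * c * 2 ^+ d)//; ring.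
Qed.

End energies.

Section riesz_energies.
Context {R : realType}.
Local Notation leb d := (@lebesgue_rV R d).
Local Notation leb2 d := (leb d \x leb d)%E.

Definition riesz d (s : R) (h : 'rV[R]_d) : R := `|h| `^ (- s).

Definition near_riesz d (s t : R) (h : 'rV[R]_d) : R :=
  if `|h| <= t then riesz s h else 0.

Definition annulus_riesz d (s t u : R) (h : 'rV[R]_d) : R :=
  if t < `|h| <= u then riesz s h else 0.

Lemma riesz_ge0 d s (h : 'rV[R]_d) : 0 <= riesz s h.
Proof. exact: powR_ge0. Qed.

Lemma near_riesz_ge0 d s t (h : 'rV[R]_d) : 0 <= near_riesz s t h.
Proof. by rewrite /near_riesz; case: ifP => // _; exact: riesz_ge0. Qed.

Lemma annulus_riesz_ge0 d s t u (h : 'rV[R]_d) : 0 <= annulus_riesz s t u h.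
Proof. by rewrite /annulus_riesz; case: ifP => // _; exact: riesz_ge0. Qed.

Lemma measurable_norm_rV d : measurable_fun setT (fun h : 'rV[R]_d => `|h|).
Proof. exact: measurable_rV_norm. Qed.

Lemma measurable_riesz d (s : R) : measurable_fun setT (@riesz d s).
Proof.
apply: (measurableT_comp (measurable_powR (- s))); exact: measurable_norm_rV.
Qed.

Lemma measurable_near_riesz d (s t : R) : measurable_fun setT (@near_riesz d s t).
Proof.
apply: measurable_fun_ifT => //; last exact: measurable_riesz.
by apply: measurable_fun_ler => //; exact: measurable_norm_rV.
Qed.

Lemma measurable_annulus_riesz d (s t u : R) :
  measurable_fun setT (@annulus_riesz d s t u).
Proof.
apply: measurable_fun_ifT => //; last exact: measurable_riesz.
apply: measurable_and.
  by apply: measurable_fun_ltr => //; exact: measurable_norm_rV.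
by apply: measurable_fun_ler => //; exact: measurable_norm_rV.
Qed.

Lemma near_riesz_half d (s t : R) (h : 'rV[R]_d) :
  near_riesz s (2 * t) h = 2 `^ (- s) * near_riesz s t (2^-1 *: h).
Proof.
rewrite /near_riesz /riesz normrZ ger0_norm ?invr_ge0//.
rewrite (_ : (2^-1 * `|h| <= t) = (`|h| <= 2 * t)); last first.
  by rewrite mulrC ler_pdivrMr// mulrC.
case: ifP => _; rewrite ?mulr0// powRM// ?invr_ge0// mulrA.
by rewrite -powRM// ?invr_ge0// mulfV// powR1 mul1r.
Qed.

Lemma energy_near_double d (Q : set 'rV[R]_d) (v : 'rV[R]_d -> R) (a t : R) n :
  measurable Q -> (forall y z, Q y -> Q z -> Q (midpoint y z)) ->
  measurable_fun setT v ->
  (energy Q (near_riesz (d%:R + a) (2 ^+ n * t)) v <=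
   ((2 `^ (1 - a)) ^+ n)%:E * energy Q (near_riesz (d%:R + a) t) v)%E.
Proof.
move=> mQ Qm mv.
have -> : 2 `^ (1 - a) = 2 * 2 `^ (- (d%:R + a)) * 2 ^+ d :> R.
  rewrite -[in X in X * _ * _](powRr1 (ler0n _ 2)) -powR_mulrn//.
  rewrite -!powRD ?pnatr_eq0 ?implybT//; congr (_ `^ _); ring.
elim: n => [|n IH]; first by rewrite !expr0 mul1r mul1e.
rewrite !exprS -(mulrA 2 (2 ^+ n) t).
apply: (le_trans (energy_midpoint mQ Qm mv (measurable_near_riesz _ _)
  (measurable_near_riesz (d%:R + a) (2 ^+ n * t)) (near_riesz_ge0 _ _)
  (near_riesz_ge0 _ _) (powR_ge0 2 (- (d%:R + a))) _)).
  by move=> h; rewrite near_riesz_half.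
rewrite [X in (_ <= X * _)%E]EFinM -muleA.
apply: lee_wpmul2l; last exact: IH.
by rewrite lee_fin !mulr_ge0 ?powR_ge0 ?exprn_ge0.
Qed.

(** Young's inequality for the exponents [1 / x] and [1 / (1 - x)]. *)
Lemma powR2_le1D (x : R) : 0 < x < 1 -> 2 `^ x <= 1 + x.
Proof.
move=> /andP[x0 x1].
have := @conjugate_powR R (2 `^ x) 1 x^-1 (1 - x)^-1 (powR_ge0 _ _) ler01.
rewrite !invr_gt0 x0 subr_gt0 x1 => /(_ isT isT).
rewrite !invrK powR1 mulr1 -powRrM mulfV ?gt_eqF// powRr1// => h.
by apply: (le_trans (h _)); lra.
Qed.

(** Jumps over distances in [(t, 64 t]] cost only [1 - a] times the energy:
    chaining midpoints, the energy of all jumps up to [64 t] is at most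
    [2 ^ (6 (1 - a))] times the energy of those up to [t], and
    [2 ^ (6 (1 - a)) - 1] is of order [1 - a]. *)
Lemma energy_annulus d (Q : set 'rV[R]_d) (v : 'rV[R]_d -> R) (a t : R) :
  0 < a < 1 -> measurable Q ->
  (forall y z, Q y -> Q z -> Q (midpoint y z)) -> measurable_fun setT v ->
  (energy Q (annulus_riesz (d%:R + a) t (2 ^+ 6 * t)) v <=
   (63 * (1 - a))%:E * energy Q (riesz (d%:R + a)) v)%E.
Proof.
move=> /andP[a0 a1] mQ Qm mv; set s := d%:R + a.
have x0 : 0 < 1 - a by rewrite subr_gt0.
have [t0|t0] := ltP t 0.
  rewrite (_ : energy Q (annulus_riesz _ _ _) v = 0%E).
    apply: mule_ge0; first by rewrite lee_fin mulr_ge0// ltW.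
    by apply: energy_ge0; exact: riesz_ge0.
  apply: integral0_eq => p _; rewrite /energy_density /annulus_riesz.
  case: ifP => [/andP[_ h]|]; rewrite ?mulr0//.
  by have := le_trans (normr_ge0 _) h; rewrite leNgt pmulr_rlt0// t0.
have near6 := energy_near_double a t 6 mQ Qm mv; rewrite -/s in near6.
have split6 : (energy Q (annulus_riesz s t (2 ^+ 6 * t)) v + energy Q (near_riesz s t) v
    <= energy Q (near_riesz s (2 ^+ 6 * t)) v)%E.
  rewrite -energy_kernelD//; try exact: annulus_riesz_ge0; try exact: near_riesz_ge0.
  - apply: le_energy => //.
    + apply: measurable_funD; [exact: measurable_annulus_riesz|exact: measurable_near_riesz].
    + exact: measurable_near_riesz.
    + by move=> h; rewrite addr_ge0 ?annulus_riesz_ge0 ?near_riesz_ge0.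
    move=> h; rewrite /annulus_riesz /near_riesz.
    case: (leP `|h| t) => ht /=; rewrite ?add0r ?addr0//.
    by rewrite (le_trans ht)// ler_peMl// exprn_ege1// ler1n.
  - exact: measurable_annulus_riesz.
  - exact: measurable_near_riesz.
have near_le : (energy Q (near_riesz s t) v <= energy Q (riesz s) v)%E.
  apply: le_energy => //; first exact: measurable_near_riesz.
  - exact: measurable_riesz.
  - exact: near_riesz_ge0.
  - by move=> h; rewrite /near_riesz; case: ifP => // _; exact: riesz_ge0.
have {near6}split6 := le_trans split6 near6.
have c0 : 0 < 63 * (1 - a) by rewrite mulr_gt0.
have nt0 : (0 <= energy Q (near_riesz s t) v)%E by apply: energy_ge0; exact: near_riesz_ge0.
have an0 : (0 <= energy Q (annulus_riesz s t (2 ^+ 6 * t)) v)%E.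
  by apply: energy_ge0; exact: annulus_riesz_ge0.
move: near_le nt0 an0 split6.
move: (energy Q (near_riesz s t) v) (energy Q (annulus_riesz _ _ _) v) (energy Q (riesz s) v).
move=> N A0 E NE N0 A00 h.
have [Ey|Efin] := eqVneq E +oo%E.
  by rewrite Ey gt0_muley ?lte_fin// leey.
have [n nE] : exists n, N = n%:E.
  exists (fine N); rewrite fineK// ge0_fin_numE//.
  by apply: le_lt_trans NE _; rewrite ltey.
subst N.
apply: (@le_trans _ _ ((63 * (1 - a))%:E * n%:E)%E); last first.
  by rewrite lee_pmul2l ?lte_fin.
have q1 : 2 `^ (1 - a) <= 1 + (1 - a).
  by apply: powR2_le1D; rewrite x0 ltrBlDr ltrDl.
have q0 := powR_ge0 2 (1 - a).
have q6 : (2 `^ (1 - a)) ^+ 6 - 1 <= 63 * (1 - a).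
  apply: (@le_trans _ _ ((1 + (1 - a)) ^+ 6 - 1)).
    by rewrite lerB// lerXn2r ?nnegrE// addr_ge0// ltW.
  have : 1 - a <= 1 by lra.
  move: (1 - a) x0 => x x0' x1.
  have x2 : x ^+ 2 <= x by rewrite expr2 ler_piMr// ltW.
  have xp0 k : 0 <= x ^+ k by rewrite exprn_ge0// ltW.
  have xk k : x ^+ k.+1 <= x.
    by rewrite exprS ler_piMr// ?(ltW x0')// exprn_ile1// ltW.
  (* The binomial coefficients below add up to 63. *)
  have := xk 1%N; have := xk 2%N; have := xk 3%N; have := xk 4%N; have := xk 5%N.
  rewrite (_ : (1 + x) ^+ 6 - 1 = 6 * x + 15 * x ^+ 2 + 20 * x ^+ 3 + 15 * x ^+ 4 + 6 * x ^+ 5 + x ^+ 6); last by ring.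
  lra.
case: A0 A00 h => [r| |] //=; rewrite -?EFinM -?EFinD ?lee_fin => r0 h //.
have n0 : 0 <= n by rewrite -lee_fin.
by have := ler_wpM2r n0 q6; lra.
Qed.

End riesz_energies.

(** * A relative isoperimetric inequality in boxes *)

Section box_isoperimetry.
Context {R : realType}.
Local Notation leb d := (@lebesgue_rV R d).
Local Notation leb2 d := (leb d \x leb d)%E.

Lemma box_midpoint d (a b y z : 'rV[R]_d) :
  box a b y -> box a b z -> box a b (midpoint y z).
Proof.
move=> hy hz i; move: (hy i) (hz i); rewrite !in_itv/= !mxE.
by move=> /andP[? ?] /andP[? ?]; apply/andP; split; lra.
Qed.

Lemma box_diam d (a b y z : 'rV[R]_d) (l : R) : 0 <= l ->
  (forall i, b ord0 i - a ord0 i <= l) ->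
  box a b y -> box a b z -> `|y - z| <= l.
Proof.
move=> l0 abl hy hz; apply/rV_normP => // i.
move: (hy i) (hz i) (abl i); rewrite !in_itv/= !mxE ler_norml.
by move=> /andP[? ?] /andP[? ?] ?; apply/andP; split; lra.
Qed.

Lemma lebesgue_rV_closed_ball d (y : 'rV[R]_d) (t : R) : 0 <= t ->
  leb d [set z | `|y - z| <= t] = ((2 * t) ^+ d)%:E.
Proof.
move=> t0.
rewrite (_ : mkset _ = [set x : 'rV[R]_d | forall i,
   x ord0 i \in `[(y - const_mx t) ord0 i, (y + const_mx t) ord0 i]]).
  rewrite lebesgue_rV_box; last by move=> i; rewrite !mxE; lra.
  rewrite -[d in RHS]card_ord -prodr_const; congr EFin; apply: eq_bigr => i _.
  by rewrite !mxE; lra.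
apply/seteqP; split => z /=.
  move=> /rV_normP-/(_ t0) h i; have := h i; rewrite !mxE ler_norml in_itv/=.
  by move=> /andP[? ?]; apply/andP; split; lra.
move=> h; apply/rV_normP => // i; have := h i; rewrite !mxE in_itv/= ler_norml.
by move=> /andP[? ?]; apply/andP; split; lra.
Qed.

Lemma measurable_near_diagonal d (Q : set 'rV[R]_d) (t : R) : measurable Q ->
  measurable [set p : 'rV[R]_d * 'rV[R]_d | Q p.1 /\ `|p.1 - p.2| <= t].
Proof.
move=> mQ; set N := [set p | _].
rewrite (_ : N = fst @^-1` Q `&` (fun p => `|p.1 - p.2|) @^-1` `]-oo, t]%classic).
  apply: measurableI.
    by rewrite -[X in measurable X]setTI; exact: measurable_fst.
  have mn : measurable_fun setT (fun p : 'rV[R]_d * 'rV[R]_d => `|p.1 - p.2|).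
    apply: measurable_rV_norm.
    by apply: measurable_rVB; [exact: measurable_fst|exact: measurable_snd].
  by rewrite -[X in measurable X]setTI; exact: mn.
by apply/seteqP; split => p; rewrite /N /= in_itv/=.
Qed.

Lemma lebesgue2_near_diagonal d (Q : set 'rV[R]_d) (t : R) :
  measurable Q -> 0 <= t ->
  (leb2 d [set p | Q p.1 /\ (`|p.1 - p.2| <= t)%R] =
   leb d Q * ((2 * t) ^+ d)%:E)%E.
Proof.
move=> mQ t0; set N := [set p | _].
have mN : measurable N by exact: measurable_near_diagonal.
rewrite -[N]setIT -integral_indic// integral2_real//.
transitivity (\int[leb d]_y (((2 * t) ^+ d)%:E * (\1_Q y)%:E))%E.
  apply: eq_integral => y _.
  have [yQ|yQ] := pselect (Q y); last first.
    rewrite [in RHS]indicE memNset// mule0 integral0_eq// => z _.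
    by rewrite indicE memNset// => -[].
  rewrite [in RHS]indicE mem_set// mule1 -(lebesgue_rV_closed_ball y t0).
  rewrite -[in RHS](setIT [set _ | _]) -integral_indic//; last exact: measurable_rV_closed_ball.
  apply: eq_integral => z _; congr EFin; rewrite !indicE; congr (nat_of_bool _)%:R.
  by apply/idP/idP => /set_mem; rewrite /N/= => h; apply/mem_set => //; case: h.
rewrite ge0_integralZl//.
- by rewrite integral_indic// setIT muleC.
- by apply/measurable_EFinP; exact: measurable_indic.
- by rewrite lee_fin exprn_ge0// mulr_ge0.
Qed.

(** Pairs of points of [A] and of its complement fill a fixed fraction of
    [Q * Q], and few of them are closer than [l / 64]. *)
Lemma box_isoperimetry d (a b : 'rV[R]_d) (A : set 'rV[R]_d) (l al : R) :
  (0 < d)%N -> 0 < al < 1 -> 0 < l ->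
  (forall i, l / 2 <= b ord0 i - a ord0 i <= l) -> measurable A ->
  (leb d (box a b) <= 4%:E * leb d (A `&` box a b))%E ->
  (2%:E * leb d (A `&` box a b) <= leb d (box a b))%E ->
  ((l `^ (d%:R - al))%:E <=
   (1008 * 4 ^+ d * (1 - al))%:E *
   energy (box a b) (riesz (d%:R + al)) (\1_A))%E.
Proof.
move=> d0 al01 l0 abl mA; have /andP[al0 al1] := al01.
set Q := box a b; set s := d%:R + al.
have mQ : measurable Q by exact: measurable_box.
have l2 : 0 < l / 2 by rewrite divr_gt0.
have ab i : 0 <= b ord0 i - a ord0 i.
  by have /andP[h _] := abl i; apply: le_trans h; exact: ltW.
pose q := \prod_i (b ord0 i - a ord0 i).
have QE : leb d Q = q%:E.
  by rewrite [LHS]lebesgue_rV_ocbox// => i; rewrite -subr_ge0.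
have q0 : 0 <= q by apply: prodr_ge0 => i _.
have ql : (l / 2) ^+ d <= q.
  rewrite -[d]card_ord -prodr_const; apply: ler_prod => i _.
  by rewrite ltW//; have /andP[] := abl i.
have [x xE] : exists x, leb d (A `&` Q) = x%:E.
  exists (fine (leb d (A `&` Q))); rewrite fineK// ge0_fin_numE//.
  apply: (@le_lt_trans _ _ (leb d Q)); last by rewrite QE ltry.
  by apply: le_measure; rewrite ?inE//; exact: measurableI.
rewrite QE xE -!EFinM !lee_fin => x4 x2.
have DE : leb d (Q `\` A) = (q - x)%:E.
  have Qfin : (leb d Q < +oo)%E by rewrite QE ltry.
  transitivity (leb d Q - leb d (Q `&` A))%E; first exact: measureD.
  by rewrite QE setIC xE.
(* With this [t] the pairs at distance at most [t] fill at most 1/16 of [Q * Q]. *)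
pose t := l / 64.
have t0 : 0 <= t by rewrite divr_ge0// ltW.
pose N := [set p : 'rV[R]_d * 'rV[R]_d | Q p.1 /\ (`|p.1 - p.2| <= t)%R].
pose S := (A `&` Q) `*` (Q `\` A).
have mS : measurable S.
  by apply: measurableX; [exact: measurableI|exact: measurableD].
have mN : measurable N by exact: measurable_near_diagonal.
have SE : leb2 d S = (x * (q - x))%:E.
  transitivity (leb d (A `&` Q) * leb d (Q `\` A))%E; last by rewrite xE DE.
  by apply: product_measure1E; [exact: measurableI|exact: measurableD].
have NE : (leb2 d N <= (q * q / 16)%:E)%E.
  rewrite lebesgue2_near_diagonal// QE -EFinM lee_fin -mulrA ler_wpM2l//.
  have -> : 2 * t = l / 2 / 16 by rewrite /t; field.
  rewrite expr_div_n ler_pM ?exprn_ge0 ?invr_ge0 ?exprn_ge0 ?(ltW l2)//.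
  rewrite lef_pV2 ?posrE ?exprn_gt0//.
  by rewrite -[X in X <= _]expr1 ler_weXn2l// ler1n.
have SNE : ((q * q / 16)%:E <= leb2 d (S `\` N))%E.
  have SU : S `<=` (S `\` N) `|` N.
    by move=> p Sp; have [Np|Np] := pselect (N p); [right|left].
  have mU : measurable ((S `\` N) `|` N) by apply: measurableU => //; exact: measurableD.
  have h : ((x * (q - x))%:E <= leb2 d (S `\` N) + (q * q / 16)%:E)%E.
    rewrite -SE; apply: (@le_trans _ _ (leb2 d ((S `\` N) `|` N))).
      by apply: le_measure => //; rewrite inE.
    apply: (@le_trans _ _ (leb2 d (S `\` N) + leb2 d N)%E); last exact: leeD2l.
    by apply: measureU2 => //; exact: measurableD.
  rewrite -(leeD2rE (x := (q * q / 16)%:E))//; apply: le_trans h.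
  by rewrite -EFinD lee_fin; nra.
have mA1 : measurable_fun setT (\1_A : 'rV[R]_d -> R) by exact: measurable_indic.
have far := @energy_annulus R d Q (\1_A) al t al01 mQ
  (@box_midpoint d a b) mA1.
rewrite -/s in far.
have lower : ((l `^ (- s))%:E * leb2 d (S `\` N) <=
    energy Q (annulus_riesz s t (2 ^+ 6 * t)) (\1_A))%E.
  rewrite -[S `\` N]setIT -integral_indic//; last exact: measurableD.
  rewrite -integral_realZ//; last 2 first.
  - by apply: measurable_indic; exact: measurableD.
  - exact: powR_ge0.
  apply: le_integral_real.
  - apply: measurable_funM => //; apply: measurable_indic; exact: measurableD.
  - apply: measurable_energy_density => //; first exact: measurable_annulus_riesz.
  - by move=> p; rewrite mulr_ge0// powR_ge0.
  move=> [y z]; rewrite [X in _ * X]indicE.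
  have [/set_mem|_] := boolP ((y, z) \in S `\` N); last first.
    by rewrite mulr0; apply: energy_density_ge0; exact: annulus_riesz_ge0.
  move=> [[/= [yA yQ] [zQ zA]] yzN].
  have tyz : t < `|y - z| by rewrite ltNge; apply/negP => h; apply: yzN.
  have yzl : `|y - z| <= l.
    by apply: (box_diam (ltW l0) _ yQ zQ) => i; have /andP[] := abl i.
  rewrite /energy_density/= !indicE (mem_set yQ) (mem_set zQ) (mem_set yA) (memNset zA) subr0 normr1 !mul1r.
  rewrite /annulus_riesz tyz/= (_ : 2 ^+ 6 * t = l); last by rewrite /t; field.
  rewrite yzl mulr1 /riesz !powRN lef_pV2 ?posrE ?powR_gt0//; last first.
    exact: le_lt_trans tyz.
  by apply: ge0_ler_powR; rewrite ?nnegrE ?addr_ge0// ltW.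
have {}lower : ((l `^ (- s) * (q * q / 16))%:E <=
    energy Q (annulus_riesz s t (2 ^+ 6 * t)) (\1_A))%E.
  apply: le_trans lower; rewrite EFinM; apply: lee_wpmul2l => //.
  by rewrite lee_fin powR_ge0.
have {far}lower := le_trans lower far.
(* [1008 = 16 * 63]: 63 comes from [energy_annulus], and [16 * 4 ^ d] from the
   lower bound [q * q / 16] with [q >= (l / 2) ^ d]. *)
have -> : 1008 * 4 ^+ d * (1 - al) = (16 * 4 ^+ d) * (63 * (1 - al)) by ring.
rewrite EFinM -muleA.
apply: (@le_trans _ _ ((16 * 4 ^+ d)%:E * (l `^ (- s) * (q * q / 16))%:E)%E).
  rewrite -EFinM lee_fin.
  have -> : d%:R - al = - s + (d%:R + d%:R) by rewrite /s; lra.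
  rewrite powRD; last by rewrite (gt_eqF l0) implybT.
  have -> : 16 * 4 ^+ d * (l `^ (- s) * (q * q / 16)) =
    l `^ (- s) * (4 ^+ d * (q * q)) by field.
  rewrite ler_wpM2l ?powR_ge0//.
  rewrite -natrD powR_mulrn ?(ltW l0)// exprD.
  have -> : l ^+ d = 2 ^+ d * (l / 2) ^+ d.
    by rewrite -exprMn; congr (_ ^+ _); field.
  have -> : (4 : R) ^+ d = 2 ^+ d * 2 ^+ d.
    by rewrite -exprMn; congr (_ ^+ _); ring.
  rewrite mulrACA ler_wpM2l ?mulr_ge0 ?exprn_ge0//.
  by apply: ler_pM => //; rewrite exprn_ge0// ltW.
by apply: lee_wpmul2l => //; rewrite lee_fin mulr_ge0 ?exprn_ge0.
Qed.

End box_isoperimetry.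

(** * The boxing inequality by bisection *)

Section bisection.
Context {R : realType}.
Local Notation leb d := (@lebesgue_rV R d).

(** A pair of points has both ends in at most one of two disjoint sets. *)
Lemma energy_superadditive d (Q Q1 Q2 : set 'rV[R]_d) (k v : 'rV[R]_d -> R) :
  measurable Q -> measurable Q1 -> measurable Q2 ->
  measurable_fun setT k -> measurable_fun setT v -> (forall h, 0 <= k h) ->
  Q1 `<=` Q -> Q2 `<=` Q -> Q1 `&` Q2 = set0 ->
  (energy Q1 k v + energy Q2 k v <= energy Q k v)%E.
Proof.
move=> mQ mQ1 mQ2 mk mv k0 Q1Q Q2Q Q12; rewrite /energy -integral_realD.
- apply: le_integral_real.
  + by apply: measurable_funD; exact: measurable_energy_density.
  + exact: measurable_energy_density.
  + by move=> p; apply: addr_ge0; exact: energy_density_ge0.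
  move=> [y z]; rewrite /energy_density/= -mulrDl ler_wpM2r ?mulr_ge0//.
  rewrite !indicE.
  have [/set_mem y1|_] := boolP (y \in Q1).
    rewrite (mem_set (Q1Q _ y1)) (memNset (_ : ~ Q2 y)); last first.
      by move=> y2; have : (Q1 `&` Q2) y by []; rewrite Q12.
    rewrite mul0r addr0 !mul1r.
    by have [/set_mem /Q1Q/mem_set ->|_] := boolP (z \in Q1).
  rewrite mul0r add0r.
  have [/set_mem /Q2Q/mem_set ->|_] := boolP (y \in Q2).
    by have [/set_mem /Q2Q/mem_set ->|_] := boolP (z \in Q2); rewrite ?mulr0 ?mulr_ge0.
  by rewrite mul0r mulr_ge0.
- exact: measurable_energy_density.
- exact: measurable_energy_density.
- by move=> p; exact: energy_density_ge0.
- by move=> p; exact: energy_density_ge0.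
Qed.

Definition set_coord d (i : 'I_d) (t : R) (x : 'rV[R]_d) : 'rV[R]_d :=
  \row_j if j == i then t else x ord0 j.

(** If [A] has density at least 1/4 in the box, isoperimetry pays for the whole
    [nu]-mass of the box.  Otherwise [A] has density at most 1/2 in both halves
    of the box, and the energies in the halves add up.  Halving the longest
    side keeps the ratio of the sides at most 2.  Points of [B] have distance
    more than [r] from the complement of [A] in the box, so the recursion stops
    once the sides are at most [r]: a box that meets [B] is then contained in
    [A], against the density at most 1/2. *)
Lemma bisection d (nu : {measure set 'rV[R]_d -> \bar R}) (A B : set 'rV[R]_d)
    (K al r : R) n :
  (0 < d)%N -> 0 < al < 1 -> 0 <= K ->
  (forall (a b : 'rV[R]_d) l, 0 < l ->
    (forall i, 0 <= b ord0 i - a ord0 i <= l) ->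
    (nu (box a b) <= (K * l `^ (d%:R - al))%:E)%E) ->
  measurable A -> measurable B -> 0 < r ->
  forall (a b : 'rV[R]_d) l, 0 < l ->
  (forall i, l / 2 <= b ord0 i - a ord0 i <= l) ->
  (forall y z, B y -> box a b y -> box a b z -> `|y - z| <= r -> A z) ->
  (2%:E * leb d (A `&` box a b) <= leb d (box a b))%E ->
  \prod_i (b ord0 i - a ord0 i) <= 2 ^+ n * (r / 2) ^+ d ->
  (nu (B `&` box a b) <= (K * (1008 * 4 ^+ d * (1 - al)))%:E *
    energy (box a b) (riesz (d%:R + al)) (\1_A))%E.
Proof.
move=> d0 al01 K0 nuK mA mB r0; have /andP[al0 al1] := al01.
have iso a b l := @box_isoperimetry R d a b A l al d0 al01.
have c0 : 0 <= 1008 * 4 ^+ d * (1 - al).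
  apply: mulr_ge0; last by rewrite subr_ge0 ltW.
  by apply: mulr_ge0; [exact: ler0n|exact: exprn_ge0].
move: (1008 * 4 ^+ d * (1 - al)) c0 iso => c c0 iso.
elim: n => [|n IH] a b l l0 abl AB Q2 vol.
- rewrite (_ : B `&` box a b = set0).
    rewrite measure0 mule_ge0 ?lee_fin ?mulr_ge0//.
    by apply: energy_ge0; exact: riesz_ge0.
  apply/seteqP; split => // y [By yab] /=.
  have lr : l <= r.
    suff : (l / 2) ^+ d <= (r / 2) ^+ d.
      by rewrite ler_pXn2r ?nnegrE ?divr_ge0 ?(ltW l0) ?(ltW r0)// ler_pM2r ?invr_gt0.
    rewrite expr0 mul1r in vol; apply: le_trans vol.
    rewrite (_ : (l / 2) ^+ d = \prod_(i < d) (l / 2)); last first.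
      by rewrite prodr_const card_ord.
    apply: ler_prod => i _.
    by rewrite divr_ge0 ?(ltW l0)//; have /andP[] := abl i.
  have boxA : A `&` box a b = box a b.
    apply/seteqP; split => [z []//|z zab]; split => //.
    apply: (AB _ _ By yab zab); apply: le_trans lr.
    by apply: (box_diam (ltW l0) _ yab zab) => i; have /andP[] := abl i.
  have ab0 i : 0 < b ord0 i - a ord0 i.
    by have /andP[h _] := abl i; apply: lt_le_trans h; rewrite divr_gt0.
  move: Q2; rewrite boxA lebesgue_rV_ocbox; last first.
    by move=> i; rewrite -subr_ge0 ltW.
  rewrite -EFinM lee_fin.
  have : 0 < \prod_i (b ord0 i - a ord0 i) by apply: prodr_gt0 => i _.
  lra.
have [h4|h4] := leP (leb d (box a b)) (4%:E * leb d (A `&` box a b))%E.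
  apply: (@le_trans _ _ (nu (box a b))).
    apply: le_measure; rewrite ?inE//; last exact: measurable_box.
    by apply: measurableI => //; exact: measurable_box.
  apply: (@le_trans _ _ (K * l `^ (d%:R - al))%:E).
    apply: nuK => // i; have /andP[h ->] := abl i.
    by rewrite andbT; apply: le_trans h; rewrite divr_ge0 ?ltW.
  rewrite !EFinM -muleA; apply: lee_wpmul2l; first by rewrite lee_fin.
  exact: iso.
have wpos i : 0 < b ord0 i - a ord0 i.
  by have /andP[h _] := abl i; apply: lt_le_trans h; rewrite divr_gt0.
pose i := [arg max_(j > Ordinal d0) (b ord0 j - a ord0 j)]%O.
have imax j : b ord0 j - a ord0 j <= b ord0 i - a ord0 i.
  by rewrite /i; case: arg_maxP => // k _; apply.
move: i imax => i imax.
set l' := b ord0 i - a ord0 i in imax.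
have l'0 : 0 < l' by exact: wpos.
have l'l : l' <= l by have /andP[] := abl i.
pose m := (a ord0 i + b ord0 i) / 2.
pose b' := set_coord i m b; pose a' := set_coord i m a.
have b'i : b' ord0 i = m by rewrite !mxE eqxx.
have a'i : a' ord0 i = m by rewrite !mxE eqxx.
have b'j j : j != i -> b' ord0 j = b ord0 j by move=> ji; rewrite !mxE (negbTE ji).
have a'j j : j != i -> a' ord0 j = a ord0 j by move=> ji; rewrite !mxE (negbTE ji).
have w1 j : l' / 2 <= b' ord0 j - a ord0 j <= l'.
  have [->|ji] := eqVneq j i.
    rewrite b'i (_ : m - _ = l' / 2); last by rewrite /m /l'; field.
    by rewrite lexx ler_pdivrMr// ler_peMr ?ler1n// ltW.
  rewrite b'j// imax andbT; have /andP[h _] := abl j; apply: le_trans h.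
  by rewrite ler_pM2r ?invr_gt0.
have w2 j : l' / 2 <= b ord0 j - a' ord0 j <= l'.
  have [->|ji] := eqVneq j i.
    rewrite a'i (_ : _ - m = l' / 2); last by rewrite /m /l'; field.
    by rewrite lexx ler_pdivrMr// ler_peMr ?ler1n// ltW.
  rewrite a'j// imax andbT; have /andP[h _] := abl j; apply: le_trans h.
  by rewrite ler_pM2r ?invr_gt0.
have p1 : \prod_j (b' ord0 j - a ord0 j) = 2^-1 * \prod_j (b ord0 j - a ord0 j).
  rewrite (bigD1 i)//= [in RHS](bigD1 i)//= mulrA b'i; congr (_ * _).
    by rewrite /m; field.
  by apply: eq_bigr => j ji; rewrite b'j.
have p2 : \prod_j (b ord0 j - a' ord0 j) = 2^-1 * \prod_j (b ord0 j - a ord0 j).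
  rewrite (bigD1 i)//= [in RHS](bigD1 i)//= mulrA a'i; congr (_ * _).
    by rewrite /m; field.
  by apply: eq_bigr => j ji; rewrite a'j.
have mab : a ord0 i <= m <= b ord0 i.
  by have := wpos i; rewrite /m => h; apply/andP; split; lra.
have /andP[am mb] := mab.
have s1 : box a b' `<=` box a b.
  move=> y h j; have := h j; rewrite !in_itv/= => /andP[-> h2] /=.
  have [ji|ji] := eqVneq j i; last by rewrite -(b'j j ji).
  by apply: le_trans h2 _; rewrite ji b'i.
have s2 : box a' b `<=` box a b.
  move=> y h j; have := h j; rewrite !in_itv/= => /andP[h2 ->]; rewrite andbT.
  have [ji|ji] := eqVneq j i; last by rewrite -(a'j j ji).
  by apply: le_lt_trans h2; rewrite ji a'i.
have s12 : box a b' `&` box a' b = set0.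
  apply/seteqP; split => // y [/(_ i) h1 /(_ i) h2].
  move: h1 h2; rewrite !in_itv/= b'i a'i => /andP[_ h1] /andP[h2 _].
  by have := lt_le_trans h2 h1; rewrite ltxx.
have su : box a b = box a b' `|` box a' b.
  apply/seteqP; split => [y h|y [/s1|/s2]//].
  have [yim|yim] := leP (y ord0 i) m; [left|right] => j; have := h j;
     rewrite !in_itv/= => /andP[h1 h2].
    rewrite h1/=; have [->|ji] := eqVneq j i; first by rewrite b'i.
    by rewrite b'j.
  rewrite h2 andbT; have [->|ji] := eqVneq j i; first by rewrite a'i.
  by rewrite a'j.
have mbox := @measurable_box R d.
have half (a1 b1 : 'rV[R]_d) : (forall j, l' / 2 <= b1 ord0 j - a1 ord0 j <= l') ->
    \prod_j (b1 ord0 j - a1 ord0 j) = 2^-1 * \prod_j (b ord0 j - a ord0 j) ->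
    box a1 b1 `<=` box a b ->
    (nu (B `&` box a1 b1) <= (K * c)%:E *
      energy (box a1 b1) (riesz (d%:R + al)) (\1_A))%E.
  move=> w p s; apply: (IH a1 b1 l') => //.
  - by move=> y z By /s yab /s zab; exact: AB.
  - have -> : leb d (box a1 b1) = ((2^-1)%:E * leb d (box a b))%E.
      rewrite [leb d (box a b)]lebesgue_rV_ocbox; last first.
        by move=> j; rewrite -subr_ge0 ltW.
      rewrite -EFinM -p; apply: lebesgue_rV_ocbox => j; rewrite -subr_ge0.
      by have /andP[h _] := w j; apply: le_trans h; rewrite divr_ge0// ltW.
    rewrite -(@lee_pmul2l _ 2%:E)// ?lte_fin// muleA -EFinM muleA -EFinM.
    rewrite mulfV// mul1e.
    apply: le_trans (ltW h4); rewrite (_ : 2 * 2 = 4)//; last by ring.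
    apply: lee_wpmul2l => //.
    by apply: le_measure; rewrite ?inE; [exact: measurableI|exact: measurableI|exact: setIS].
  - rewrite p; move: vol; rewrite exprS -mulrA => vol.
    by rewrite mulrC ler_pdivrMr// mulrC.
rewrite su setIUr.
apply: (@le_trans _ _ (nu (B `&` box a b') + nu (B `&` box a' b))%E).
  by apply: measureU2; exact: measurableI.
apply: (le_trans (leeD (half _ _ w1 p1 s1) (half _ _ w2 p2 s2))).
rewrite -ge0_muleDr; last 2 first.
- by apply: energy_ge0; exact: riesz_ge0.
- by apply: energy_ge0; exact: riesz_ge0.
apply: lee_wpmul2l; first by rewrite lee_fin mulr_ge0.
rewrite -su; apply: energy_superadditive => //.
- exact: measurable_riesz.
- exact: riesz_ge0.
Qed.

End bisection.

Section boxing.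
Context {R : realType}.
Local Notation leb d := (@lebesgue_rV R d).

(** Within the box, [A] is the increasing union of the sets of its points at
    distance at least [1 / n] from its complement; to these [bisection] applies. *)
Lemma boxing d (nu : {measure set 'rV[R]_d -> \bar R}) (A : set 'rV[R]_d)
    (K al : R) (a b : 'rV[R]_d) l :
  (0 < d)%N -> 0 < al < 1 -> 0 <= K ->
  (forall (a b : 'rV[R]_d) l, 0 < l ->
    (forall i, 0 <= b ord0 i - a ord0 i <= l) ->
    (nu (box a b) <= (K * l `^ (d%:R - al))%:E)%E) ->
  measurable A -> 0 < l ->
  (forall i, l / 2 <= b ord0 i - a ord0 i <= l) ->
  (forall y, A y -> box a b y ->
    exists2 e, 0 < e & forall z, box a b z -> `|y - z| < e -> A z) ->
  (2%:E * leb d (A `&` box a b) <= leb d (box a b))%E ->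
  (nu (A `&` box a b) <= (K * (1008 * 4 ^+ d * (1 - al)))%:E *
    energy (box a b) (riesz (d%:R + al)) (\1_A))%E.
Proof.
move=> d0 al01 K0 nuK mA l0 abl opA Q2.
have bis B r n mB r0 := @bisection R d nu A B K al r n d0 al01 K0 nuK mA mB r0 a b l l0 abl.
move: ((K * _)%:E * _)%E bis => M bis.
set Q := box a b.
have mQ : measurable Q by exact: measurable_box.
pose O n := \bigcup_(z in Q `\` A) ball z n.+1%:R^-1.
have mO n : measurable (O n).
  apply: open_measurable_rV; apply: bigcup_open => z _; exact: ball_open.
pose B n := Q `\` O n.
have mB n : measurable (B n) by exact: measurableD.
have BA n : B n `<=` A `&` Q.
  move=> y [yQ yO]; split => //; apply: contrapT => yA; apply: yO.
  by exists y => //; apply: ballxx; rewrite invr_gt0.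
have nuB n : (nu (B n) <= M)%E.
  have r0 : 0 < n.+1%:R^-1 / 2 :> R by rewrite divr_gt0// invr_gt0.
  have [N] : exists N : nat, \prod_i (b ord0 i - a ord0 i) <= 2 ^+ N * (n.+1%:R^-1 / 2 / 2) ^+ d.
    have c0 : 0 < (n.+1%:R^-1 / 2 / 2) ^+ d :> R by rewrite exprn_gt0// !divr_gt0.
    exists (Num.truncn (\prod_i (b ord0 i - a ord0 i) / (n.+1%:R^-1 / 2 / 2) ^+ d)).+1.
    rewrite -ler_pdivrMr//; apply: (le_trans (ltW (truncnS_gt _))).
    by rewrite -natrX ler_nat ltnW// ltn_expl.
  rewrite (_ : B n = B n `&` Q); last by apply/esym/setIidl => y [].
  apply: (bis _ _ _ _ r0) => // y z [yQ yO] _ zQ yz.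
  apply: contrapT => zA; apply: yO; exists z => //.
  rewrite -ball_normE /ball_/= distrC; apply: le_lt_trans yz _.
  by rewrite ltr_pdivrMr// ltr_pMr ?ltr1n// invr_gt0.
have AE : A `&` Q = \bigcup_n B n.
  apply/seteqP; split => [y [yA yQ]|y [n _ /BA//]].
  have [e e0 eA] := opA y yA yQ.
  have [k _ /(_ k (leqnn k)) /= ke] := near_infty_natSinv_lt (PosNum e0).
  exists k => //; split=> // -[z [zQ zA]].
  rewrite -ball_normE /ball_/= distrC => yz; apply: zA; apply: eA => //.
  exact: lt_trans ke.
have ndB : {homo B : n m / (n <= m)%N >-> (n <= m)%O}.
  move=> n k nk; apply/subsetPset => y [yQ yO]; split => // -[z zQA zy].
  apply: yO; exists z => //; apply: le_ball zy.
  by rewrite lef_pV2 ?posrE// ler_nat ltnS.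
rewrite AE.
have cvB := @nondecreasing_cvg_mu _ _ _ nu B mB (bigcupT_measurable _ mB) ndB.
rewrite -(cvg_lim _ cvB)//; apply: lime_le.
  by apply/cvg_ex; eexists; exact: cvB.
by apply: nearW => n; exact: nuB.
Qed.

End boxing.

(** * From sets to functions: the coarea formula *)

Section coarea.
Context {R : realType}.
Local Notation leb d := (@lebesgue_rV R d).
Local Notation leb2 d := (leb d \x leb d)%E.
Local Notation leb1 := (@lebesgue_measure R).

Lemma integral_between (m x : R) :
  (\int[leb1]_t ((m < t)%R%:R * (t < x)%R%:R)%:E = (Num.max (x - m) 0)%:E)%E.
Proof.
transitivity (\int[leb1]_t (\1_(`]m, x[%classic) t)%:E)%E.
  apply: eq_integral => t _; rewrite indicE -natrM mulnb; congr ((nat_of_bool _)%:R%:E).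
  by apply/idP/idP => [h|/set_mem]; [apply/mem_set|]; rewrite /= in_itv/=.
rewrite integral_indic// setIT [LHS](lebesgue_measure_itv `]m, x[)/= lte_fin.
case: ltP => h; first by rewrite -EFinB; congr EFin; rewrite max_l// subr_ge0 ltW.
by rewrite max_r// subr_le0.
Qed.

Lemma integral_sublevel_dist (x y : R) :
  (\int[leb1]_t (`|(t < x)%R%:R - (t < y)%R%:R|)%:E = `|x - y|%:E)%E.
Proof.
wlog xy : x y / x <= y => [h|].
  have [xy|/ltW yx] := leP x y; first exact: h.
  by rewrite distrC -h//; apply: eq_integral => t _; rewrite distrC.
transitivity (\int[leb1]_t (\1_(`[x, y[%classic) t)%:E)%E.
  apply: eq_integral => t _; rewrite indicE; congr EFin.
  have [/set_mem|] := boolP (t \in `[x, y[%classic).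
    rewrite /= in_itv/= => /andP[xt ->]; rewrite ltNge xt/= sub0r normrN normr1//.
  move=> /negP tI; have [tx|xt] := ltP t x.
    by rewrite (lt_le_trans tx xy) subrr normr0.
  have [ty|_] := ltP t y; last by rewrite subrr normr0.
  by exfalso; apply: tI; apply/mem_set; rewrite /= in_itv/= xt ty.
rewrite integral_indic// setIT [LHS](lebesgue_measure_itv `[x, y[)/= lte_fin.
rewrite distrC ger0_norm ?subr_ge0//.
move: xy; rewrite le_eqVlt => /predU1P[->|xy]; first by rewrite ltxx subrr.
by rewrite xy -EFinB.
Qed.

Lemma measurable_ltr_indicator dT (T : measurableType dT) (f g : T -> R) :
  measurable_fun setT f -> measurable_fun setT g ->
  measurable_fun setT (fun x => (f x < g x)%R%:R : R).
Proof.
move=> mf mg; rewrite (_ : (fun _ => _) = (fun x => if f x < g x then 1 else 0)).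
  by apply: measurable_fun_ifT => //; exact: measurable_fun_ltr.
by apply/funext => x; case: ifP.
Qed.

(** Integrating over the level [p.2] gives [\1_Q * max (u - m) 0]. *)
Definition layer d (Q : set 'rV[R]_d) (u : 'rV[R]_d -> R) (m : R)
    (p : 'rV[R]_d * measurableTypeR R) : R :=
  \1_Q p.1 * ((m < p.2)%R%:R * (p.2 < u p.1)%R%:R).

Lemma layer_ge0 d (Q : set 'rV[R]_d) u m p : 0 <= layer Q u m p.
Proof. by rewrite mulr_ge0. Qed.

Lemma measurable_layer d (Q : set 'rV[R]_d) (u : 'rV[R]_d -> R) (m : R) :
  measurable Q -> measurable_fun setT u -> measurable_fun setT (layer Q u m).
Proof.
move=> mQ mu.
have mQ1 : measurable_fun setT (\1_Q : 'rV[R]_d -> R) by exact: measurable_indic.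
apply: measurable_funM; first exact: (measurableT_comp mQ1 (@measurable_fst _ _ _ _)).
apply: measurable_funM; first exact: (@measurable_ltr_indicator _ _ (cst m)).
apply: (@measurable_ltr_indicator _ _ _ (fun p => u p.1)) => //.
exact: (measurableT_comp mu (@measurable_fst _ _ _ _)).
Qed.

Lemma layer_cake d (nu : {sigma_finite_measure set 'rV[R]_d -> \bar R})
    (Q : set 'rV[R]_d) (u : 'rV[R]_d -> R) (m : R) :
  measurable Q -> measurable_fun setT u ->
  (\int[nu]_y (\1_Q y * Num.max (u y - m) 0)%:E =
   \int[leb1]_t \int[nu]_y (layer Q u m (y, t))%:E)%E.
Proof.
move=> mQ mu; have mw := measurable_layer m mQ mu.
rewrite -(@fubini_tonelli _ _ _ _ _ nu leb1 (fun p => (layer Q u m p)%:E)).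
- apply: eq_integral => y _; rewrite /layer/=.
  rewrite integral_realZ//.
    by rewrite integral_between.
  apply: measurable_funM; first exact: (@measurable_ltr_indicator _ _ (cst m)).
  exact: (@measurable_ltr_indicator _ _ _ (cst (u y))).
- exact/measurable_EFinP.
- by move=> p; rewrite lee_fin layer_ge0.
Qed.

(** Makes Tonelli's theorem available for a level and a pair of points. *)
Lemma sigma_finite_lebesgue2 d :
  exists m : {sigma_finite_measure set ('rV[R]_d * 'rV[R]_d)%type -> \bar R},
    forall A, m A = leb2 d A.
Proof.
have sf : sigma_finite setT (leb2 d).
  have /sigma_finiteP[F [TF ndF Foo]] := @sigma_finiteT _ _ _ (leb d).
  exists (fun n => F n `*` F n).
    rewrite -setXTT TF predeqE => -[x y]; split.
      move=> [/= [n _ Fnx] [k _ Gky]]; exists (maxn n k) => //; split.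
      - by move: x Fnx; exact/subsetPset/ndF/leq_maxl.
      - by move: y Gky; exact/subsetPset/ndF/leq_maxr.
    by move=> [n _ []/= ? ?]; split; exists n.
  move=> k; have [? ?] := Foo k; split; first exact: measurableX.
  apply: (@le_lt_trans _ _ (leb d (F k) * leb d (F k))%E).
    rewrite le_eqVlt; apply/orP; left; apply/eqP.
    exact: (@product_measure1E _ _ _ _ _ (leb d) (leb d)).
  by rewrite lte_mul_pinfty// ge0_fin_numE.
pose m : {sigma_finite_measure set ('rV[R]_d * 'rV[R]_d)%type -> \bar R} :=
  HB.pack (Measure.sort (leb2 d)) (Measure_isSigmaFinite.Build _ _ _ (leb2 d) sf).
by exists m.
Qed.

Lemma measurable_superlevel d (u : 'rV[R]_d -> R) (t : R) :
  measurable_fun setT u -> measurable [set y | t < u y]%R.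
Proof.
move=> mu; rewrite (_ : mkset _ = u @^-1` `]t, +oo[%classic).
  by rewrite -[X in measurable X]setTI; exact: mu.
by apply/seteqP; split => y /=; rewrite in_itv/= andbT.
Qed.

(** The energy density of the indicator of [{u > q.1}], as a function of the
    level and of the pair of points together. *)
Definition superlevel_density d (Q : set 'rV[R]_d) (k u : 'rV[R]_d -> R)
    (q : measurableTypeR R * ('rV[R]_d * 'rV[R]_d)) : R :=
  \1_Q q.2.1 * \1_Q q.2.2 *
  (`|(q.1 < u q.2.1)%R%:R - (q.1 < u q.2.2)%R%:R| * k (q.2.1 - q.2.2)).

Lemma measurable_superlevel_density d (Q : set 'rV[R]_d) (k u : 'rV[R]_d -> R) :
  measurable Q -> measurable_fun setT k -> measurable_fun setT u ->
  measurable_fun setT (superlevel_density Q k u).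
Proof.
move=> mQ mk mu.
have mQ1 : measurable_fun setT (\1_Q : 'rV[R]_d -> R) by exact: measurable_indic.
have m21 : measurable_fun setT (fun q : measurableTypeR R * ('rV[R]_d * 'rV[R]_d) => q.2.1).
  exact: (measurableT_comp (@measurable_fst _ _ _ _) (@measurable_snd _ _ _ _)).
have m22 : measurable_fun setT (fun q : measurableTypeR R * ('rV[R]_d * 'rV[R]_d) => q.2.2).
  exact: (measurableT_comp (@measurable_snd _ _ _ _) (@measurable_snd _ _ _ _)).
apply: measurable_funM.
  by apply: measurable_funM; [exact: (measurableT_comp mQ1 m21)|exact: (measurableT_comp mQ1 m22)].
apply: measurable_funM.
  apply: measurableT_comp => //; apply: measurable_funB;
    apply: measurable_ltr_indicator => //.
    exact: (measurableT_comp mu m21).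
  exact: (measurableT_comp mu m22).
by apply: (measurableT_comp mk); exact: measurable_rVB.
Qed.

Lemma energy_superlevel d (Q : set 'rV[R]_d) (k u : 'rV[R]_d -> R) (t : R) :
  (energy Q k (\1_[set y | t < u y]%R) =
   \int[leb2 d]_p (superlevel_density Q k u (t, p))%:E)%E.
Proof.
have iE y : \1_[set y | t < u y]%R y = (t < u y)%R%:R :> R.
  by rewrite indicE; congr (nat_of_bool _)%:R; apply/idP/idP => [/set_mem|/mem_set].
apply: eq_integral => p _.
by rewrite /energy_density /superlevel_density/= !iE.
Qed.

Lemma superlevel_density_ge0 d (Q : set 'rV[R]_d) (k u : 'rV[R]_d -> R) q :
  (forall h, 0 <= k h) -> 0 <= superlevel_density Q k u q.
Proof. by move=> k0; rewrite !mulr_ge0. Qed.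

Lemma measurable_energy_superlevel d (Q : set 'rV[R]_d) (k u : 'rV[R]_d -> R) :
  measurable Q -> measurable_fun setT k -> (forall h, 0 <= k h) ->
  measurable_fun setT u ->
  measurable_fun setT
    (fun t : measurableTypeR R => energy Q k (\1_[set y | t < u y]%R)).
Proof.
move=> mQ mk k0 mu; have [m2 m2E] := sigma_finite_lebesgue2 d.
pose g := superlevel_density Q k u.
rewrite (_ : (fun _ => _) = fun t : measurableTypeR R => (\int[m2]_p (g (t, p))%:E)%E).
  apply: (@measurable_fun_fubini_tonelli_F _ _ _ _ _ m2 (fun q => (g q)%:E)).
    by apply/measurable_EFinP; exact: measurable_superlevel_density.
  by move=> q; rewrite lee_fin superlevel_density_ge0.
apply/funext => t; rewrite energy_superlevel.
by apply: eq_measure_integral => A _ _; exact/esym/m2E.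
Qed.

(** The coarea formula for the nonlocal energy: [`|x - y|] is the measure of
    the set of levels [t] that separate [x] from [y]. *)
Lemma coarea d (Q : set 'rV[R]_d) (k u : 'rV[R]_d -> R) :
  measurable Q -> measurable_fun setT k -> (forall h, 0 <= k h) ->
  measurable_fun setT u ->
  (\int[leb1]_t energy Q k (\1_[set y | t < u y]%R) = energy Q k u)%E.
Proof.
move=> mQ mk k0 mu; have [m2 m2E] := sigma_finite_lebesgue2 d.
pose g := superlevel_density Q k u.
have gE0 q : (0 <= (g q)%:E)%E by rewrite lee_fin superlevel_density_ge0.
have mgE : measurable_fun setT (EFin \o g).
  by apply/measurable_EFinP; exact: measurable_superlevel_density.
have E2 (f : 'rV[R]_d * 'rV[R]_d -> \bar R) :
    (\int[leb2 d]_p f p = \int[m2]_p f p)%E.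
  by apply: eq_measure_integral => A _ _; exact/esym/m2E.
under eq_integral do rewrite energy_superlevel E2.
rewrite (@fubini_tonelli _ _ _ _ _ leb1 m2 (fun q => (g q)%:E) mgE gE0).
rewrite /energy E2; apply: eq_integral => -[y z] _; rewrite /g/superlevel_density/=.
under eq_integral => t _ do rewrite [X in _ * X]mulrC mulrA.
rewrite integral_realZ//; last 2 first.
- apply: measurableT_comp => //; apply: measurable_funB.
    exact: (@measurable_ltr_indicator _ _ _ (cst (u y))).
  exact: (@measurable_ltr_indicator _ _ _ (cst (u z))).
- by rewrite !mulr_ge0.
rewrite integral_sublevel_dist -EFinM /energy_density/=; congr EFin; ring.
Qed.

(** For a level [t] above the median the boxing inequality applies to
    [{u > t}]; integrating in [t] gives the bound on the positive part. *)
Lemma positive_part_oscillation d (nu : {sigma_finite_measure set 'rV[R]_d -> \bar R})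
    (K al : R) (a b : 'rV[R]_d) l (u : 'rV[R]_d -> R) (m : R) :
  (0 < d)%N -> 0 < al < 1 -> 0 <= K ->
  (forall (a b : 'rV[R]_d) l, 0 < l ->
    (forall i, 0 <= b ord0 i - a ord0 i <= l) ->
    (nu (box a b) <= (K * l `^ (d%:R - al))%:E)%E) ->
  0 < l -> (forall i, l / 2 <= b ord0 i - a ord0 i <= l) ->
  measurable_fun setT u ->
  (forall y, box a b y -> forall e, 0 < e -> exists2 r, 0 < r &
    forall z, box a b z -> `|y - z| < r -> `|u y - u z| < e) ->
  (forall t, m < t ->
    (2%:E * leb d ([set y | t < u y]%R `&` box a b) <= leb d (box a b))%E) ->
  (\int[nu]_y (\1_(box a b) y * Num.max (u y - m) 0)%:E <=
   (K * (1008 * 4 ^+ d * (1 - al)))%:E *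
    energy (box a b) (riesz (d%:R + al)) u)%E.
Proof.
move=> d0 al01 K0 nuK l0 abl mu cu med.
have bx A (mA : measurable A) := @boxing R d nu A K al a b l d0 al01 K0 nuK mA l0 abl.
have c0 : 0 <= K * (1008 * 4 ^+ d * (1 - al)).
  have /andP[_ al1] := al01.
  apply: (mulr_ge0 K0); apply: mulr_ge0; last by rewrite subr_ge0 ltW.
  by apply: mulr_ge0; [exact: ler0n|exact: exprn_ge0].
move: (K * (1008 * 4 ^+ d * (1 - al))) c0 bx => c c0 bx.
set Q := box a b; set k := riesz (d%:R + al).
have mQ : measurable Q by exact: measurable_box.
have mk : measurable_fun setT k by exact: measurable_riesz.
have k0 h : 0 <= k h by exact: riesz_ge0.
rewrite layer_cake// -(coarea mQ mk k0 mu).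
rewrite -ge0_integralZl//; last 2 first.
- exact: measurable_energy_superlevel.
- by move=> t _; exact: energy_ge0.
have mS t : measurable [set y | t < u y]%R by exact: measurable_superlevel.
apply: ge0_le_integral => //.
- by move=> t _; apply: integral_real_ge0 => y; exact: layer_ge0.
- apply: (@measurable_fun_fubini_tonelli_G _ _ _ _ _ nu (fun q => (layer Q u m q)%:E)).
    by apply/measurable_EFinP; exact: measurable_layer.
  by move=> q; rewrite lee_fin layer_ge0.
- by apply: emeasurable_funM => //; exact: measurable_energy_superlevel.
move=> t _; have [tm|mt] := leP t m.
  rewrite integral0_eq; first by rewrite mule_ge0 ?lee_fin// energy_ge0.
  by move=> y _; rewrite /layer/= ltNge tm/= mul0r mulr0.
apply: (@le_trans _ _ (nu ([set y | t < u y]%R `&` Q))).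
  rewrite -[X in nu X]setIT -integral_indic//; last exact: measurableI.
  rewrite le_eqVlt; apply/orP; left; apply/eqP.
  apply: eq_integral => y _; rewrite /layer/= mt mul1r.
  rewrite !indicE in_setI -natrM mulnb andbC; congr ((nat_of_bool (_ && _))%:R%:E).
  by apply/idP/idP => [/mem_set|/set_mem].
apply: bx => //; last exact: med.
move=> y /= ty yQ; have [|r r0 ur] := cu y yQ (u y - t); first by rewrite subr_gt0.
exists r => // z zQ /(ur z zQ); rewrite ltr_distl => /andP[_]; lra.
Qed.

End coarea.

Section median.
Context {R : realType}.
Local Notation leb d := (@lebesgue_rV R d).

(** The supremum of the levels [t] for which [{u > t}] has more than half of the
    volume. *)
Lemma median_exists d (Q : set 'rV[R]_d) (u : 'rV[R]_d -> R) (M : R) :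
  measurable Q -> (0 < leb d Q < +oo)%E -> measurable_fun setT u ->
  (forall y, Q y -> `|u y| <= M) ->
  exists m, (forall t, m < t ->
      (2%:E * leb d ([set y | t < u y]%R `&` Q) <= leb d Q)%E) /\
    (forall t, - m < t ->
      (2%:E * leb d ([set y | t < - u y]%R `&` Q) <= leb d Q)%E).
Proof.
move=> mQ /andP[Q0 Qoo] mu uM.
have [q qE] : exists q, leb d Q = q%:E.
  by exists (fine (leb d Q)); rewrite fineK// ge0_fin_numE.
have q0 : 0 < q by rewrite -lte_fin -qE.
have finI (A : set 'rV[R]_d) : measurable A -> exists x, leb d (A `&` Q) = x%:E.
  move=> mA; exists (fine (leb d (A `&` Q))); rewrite fineK// ge0_fin_numE//.
  by apply: le_lt_trans Qoo; apply: le_measure; rewrite ?inE//; exact: measurableI.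
pose S := [set t : R | (leb d Q < 2%:E * leb d ([set y | t < u y]%R `&` Q))%E].
have S0 : S (- M - 1).
  rewrite /S/= (_ : _ `&` Q = Q).
    by rewrite qE -EFinM lte_fin; lra.
  apply/setIidr => y /uM; rewrite ler_norml => /andP[h _] /=; lra.
have SM : ubound S M.
  move=> t; rewrite /S/=; apply: contraPP => /negP; rewrite -ltNge => Mt.
  rewrite (_ : _ `&` Q = set0) ?measure0 ?mule0.
    by move=> h; have := lt_trans Q0 h; rewrite ltxx.
  apply/seteqP; split => // y [/= ty /uM]; rewrite ler_norml => /andP[_ h].
  by have := lt_trans Mt (lt_le_trans ty h); rewrite ltxx.
have supS : has_sup S by split; [exists (- M - 1)|exists M].
exists (sup S); split => [t tS|t tS].
  rewrite leNgt; apply/negP => St.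
  by have := ub_le_sup supS.2 St; rewrite leNgt tS.
have e0 : 0 < sup S + t by rewrite addrC -[X in _ + X]opprK subr_gt0.
have [t' St'] := sup_adherent e0 supS; rewrite opprD addNKr => tt'.
have [x xE] := finI _ (measurable_superlevel t' mu).
have [y yE] := finI _ (measurable_superlevel t (measurableT_comp (@oppr_measurable R setT) mu)).
rewrite qE yE -EFinM lee_fin.
move: St'; rewrite /S/= qE xE -EFinM lte_fin => St'.
suff : x + y <= q by lra.
rewrite -lee_fin -qE EFinD -xE -yE.
have mA : measurable [set y0 | t < - u y0]%R.
  exact: (measurable_superlevel t (measurableT_comp (@oppr_measurable R setT) mu)).
apply: (@le_trans _ _ (leb d (([set y | t' < u y]%R `&` Q) `|` ([set y | t < - u y]%R `&` Q)))).
  rewrite le_eqVlt; apply/orP; left; apply/eqP/esym/measureU; [exact: measurableI (measurable_superlevel _ mu) mQ|exact: measurableI|].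
  apply/seteqP; split => // z [[/= h1 _] [/= h2 _]].
  suff : (0 : R) < 0 by rewrite ltxx.
  lra.
apply: le_measure; rewrite ?inE//.
- by apply: measurableU; apply: measurableI => //; exact: measurable_superlevel.
- by move=> z [[]|[]].
Qed.

Lemma energyN d (Q : set 'rV[R]_d) (k u : 'rV[R]_d -> R) :
  energy Q k (fun y => - u y) = energy Q k u.
Proof.
apply: eq_integral => p _; rewrite /energy_density; congr (_ * (_ * _))%:E.
by rewrite -opprD normrN.
Qed.

(** The positive part of [u - m] and, by symmetry, that of [m - u]. *)
Lemma cube_oscillation d (al : R) (a b : 'rV[R]_d) (l : R) (u : 'rV[R]_d -> R) (M : R) :
  (0 < d)%N -> 0 < al < 1 ->
  0 < l -> (forall i, l / 2 <= b ord0 i - a ord0 i <= l) ->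
  measurable_fun setT u ->
  (forall y, box a b y -> forall e : R, 0 < e -> exists2 r : R, 0 < r &
    forall z, box a b z -> `|y - z| < r -> `|u y - u z| < e) ->
  (forall y, box a b y -> `|u y| <= M) ->
  exists m : R, forall (nu : {sigma_finite_measure set 'rV[R]_d -> \bar R}) (K : R),
    0 <= K ->
    (forall (a b : 'rV[R]_d) (l : R), 0 < l ->
      (forall i, 0 <= b ord0 i - a ord0 i <= l) ->
      (nu (box a b) <= (K * l `^ (d%:R - al))%:E)%E) ->
    (\int[nu]_y (\1_(box a b) y * `|u y - m|)%:E <=
     (2016 * 4 ^+ d * K * (1 - al))%:E *
       energy (box a b) (riesz (d%:R + al)) u)%E.
Proof.
move=> d0 al01 l0 abl mu cu uM.
have mQ := measurable_box a b.
have mN : measurable_fun setT (fun y => - u y).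
  exact: (measurableT_comp (@oppr_measurable R setT) mu).
have [|m [medp medn]] := median_exists mQ _ mu uM.
  have wpos i : 0 < b ord0 i - a ord0 i.
    by have /andP[h _] := abl i; apply: lt_le_trans h; rewrite divr_gt0.
  rewrite lebesgue_rV_ocbox; last by move=> i; rewrite -subr_ge0 ltW.
  by rewrite ltry andbT lte_fin; apply: prodr_gt0.
exists m => nu K K0 nuK.
have mQ1 : measurable_fun setT (\1_(box a b) : 'rV[R]_d -> R) by exact: measurable_indic.
have hp := positive_part_oscillation d0 al01 K0 nuK l0 abl mu cu medp.
have hn : (\int[nu]_y (\1_(box a b) y * Num.max (- u y - - m) 0)%:E <=
   (K * (1008 * 4 ^+ d * (1 - al)))%:E *
    energy (box a b) (riesz (d%:R + al)) u)%E.
  rewrite -(energyN _ _ u); apply: (positive_part_oscillation d0 al01 K0 nuK l0 abl mN _ medn).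
  move=> y yQ e e0; have [r r0 ur] := cu y yQ e e0; exists r => // z zQ yz.
  by rewrite -opprD normrN; exact: ur.
have mmax (v : 'rV[R]_d -> R) : measurable_fun setT v ->
    measurable_fun setT (fun y => \1_(box a b) y * Num.max (v y) 0).
  by move=> mv; apply: measurable_funM => //; apply: measurable_maxr.
rewrite (_ : (\int[nu]_y _)%E = (\int[nu]_y (\1_(box a b) y * Num.max (u y - m) 0 +
  \1_(box a b) y * Num.max (- u y - - m) 0)%:E)%E); last first.
  apply: eq_integral => y _; congr EFin; rewrite -mulrDr; congr (_ * _).
  have [h|h] := leP (u y) m.
    by rewrite ler0_norm ?subr_le0// max_r ?subr_le0// max_l; lra.
  by rewrite gtr0_norm ?subr_gt0// max_l ?subr_ge0 ?ltW// max_r; lra.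
rewrite integral_realD; first last.
- by move=> y; rewrite mulr_ge0// le_max lexx orbT.
- by move=> y; rewrite mulr_ge0// le_max lexx orbT.
- by apply: mmax; exact: measurable_funB.
- by apply: mmax; exact: measurable_funB.
apply: (le_trans (leeD hp hn)).
have E0 : (0 <= energy (box a b) (riesz (d%:R + al)) u)%E.
  by apply: energy_ge0; exact: riesz_ge0.
have c0 : 0 <= K * (1008 * 4 ^+ d * (1 - al)).
  have /andP[_ al1] := al01.
  apply: (mulr_ge0 K0); apply: mulr_ge0; last by rewrite subr_ge0 ltW.
  by apply: mulr_ge0; [exact: ler0n|exact: exprn_ge0].
(* [2016 = 2 * 1008], one [1008] for each sign of [u - m]. *)
have -> : 2016 * 4 ^+ d * K * (1 - al) =
    K * (1008 * 4 ^+ d * (1 - al)) + K * (1008 * 4 ^+ d * (1 - al)) by ring.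
move: (K * (1008 * 4 ^+ d * (1 - al))) c0 => c c0.
by rewrite EFinD ge0_muleDl ?lee_fin.
Qed.

End median.

(** * Patches *)

Section trace_poincare_inequality.
Context {R : realType}.
Local Notation leb d := (@lebesgue_rV R d).
Local Notation leb2 d := (leb d \x leb d)%E.

Lemma integral_indicator d (T : measurableType d) (m : {measure set T -> \bar R})
    (Q : set T) (f : T -> R) :
  (\int[m]_(x in Q) (f x)%:E = \int[m]_x (\1_Q x * f x)%:E)%E.
Proof.
rewrite integral_mkcond; apply: eq_integral => x _.
by rewrite patchE indicE; case: (x \in Q); rewrite ?mul1r ?mul0r.
Qed.

Lemma enorm_le d (x : 'rV[R]_d) : enorm x <= d%:R * `|x|.
Proof.
rewrite /enorm -(ger0_norm (mulr_ge0 (ler0n R d) (normr_ge0 x))) -sqrtr_sqr.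
rewrite ler_sqrt ?sqr_ge0//.
apply: (@le_trans _ _ (\sum_(i < d) `|x| ^+ 2)).
  apply: ler_sum => i _.
  by have := rV_coord_le x i; rewrite ler_norml => /andP[? ?]; nra.
rewrite (_ : \sum_(i < d) _ = d%:R * `|x| ^+ 2); last by rewrite sumr_const card_ord mulr_natl.
rewrite exprMn ler_wpM2r ?sqr_ge0//.
by rewrite -natrX ler_nat; case: d {x} => // d; rewrite leq_pmull.
Qed.

Lemma norm_le_enorm d (x : 'rV[R]_d) : `|x| <= enorm x.
Proof.
apply/rV_normP => [|i]; first exact: sqrtr_ge0.
rewrite -sqrtr_sqr ler_sqrt; last by apply: sumr_ge0 => j _; exact: sqr_ge0.
by rewrite (bigD1 i)//= lerDl; apply: sumr_ge0 => j _; exact: sqr_ge0.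
Qed.

Lemma enorm_gt0 d (x : 'rV[R]_d) : x != 0 -> 0 < enorm x.
Proof. by move=> x0; apply: lt_le_trans (norm_le_enorm x); rewrite normr_gt0. Qed.

Lemma measurable_enorm d : measurable_fun setT (@enorm R d).
Proof.
apply: (@measurableT_comp _ _ _ _ _ _ (@Num.sqrt R)).
  by apply: continuous_measurable_fun; exact: sqrt_continuous.
apply: measurable_sum => i; apply: measurable_funX; exact: measurable_coord.
Qed.

(** All that the proofs use of the bound by the Hausdorff content; it holds for
    Lebesgue measure as well. *)
Definition frostman d (Om : set 'rV[R]_d) (s K : R) (nu : set 'rV[R]_d -> \bar R) :=
  forall (A : set 'rV[R]_d) x r, measurable A -> A `<=` Om -> 0 < r ->
    (forall y, A y -> `|y - x| <= r) -> (nu A <= (K * r `^ s)%:E)%E.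

Definition gagliardo d (Om : set 'rV[R]_d) (al : R) (phi : 'rV[R]_d -> R) : \bar R :=
  (\int[leb d]_(z in Om) \int[leb d]_(y in Om)
     (`|phi y - phi z| / enorm (y - z) `^ (al + d%:R))%:E)%E.

(** The constant [m] is chosen before the measure.  So one [m] serves the given
    measure and Lebesgue measure alike, and the latter can compare constants
    chosen on different sets. *)
Definition trace_poincare d (Om O : set 'rV[R]_d) := exists C : R, 0 <= C /\
  forall (al M : R) (phi : 'rV[R]_d -> R), 0 < al < 1 ->
  (forall x, Om x -> {for x, continuous phi}) -> (forall x, Om x -> `|phi x| <= M) ->
  exists m : R, forall (nu : {measure set 'rV[R]_d -> \bar R}) (K : R), 0 <= K ->
    frostman Om (d%:R - al) K nu ->
    (\int[nu]_(x in O) `|phi x - m|%:E <=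
      (C * K * (1 - al))%:E * gagliardo Om al phi)%E.

Lemma continuous_on_measurable d (Om : set 'rV[R]_d) (phi : 'rV[R]_d -> R) :
  open Om -> (forall x, Om x -> {for x, continuous phi}) -> measurable_fun Om phi.
Proof.
move=> oOm cphi.
apply: (measurability _ (RGenOpens.measurableE R)) => _ [_ [a [b ->] <-]].
apply: open_measurable_rV; rewrite openE => x [Omx phix].
apply: filterI; first exact: open_nbhs_nbhs.
by apply: (cphi x Omx); apply: open_nbhs_nbhs; split => //; exact: interval_open.
Qed.

Lemma measurable_patch d (Om : set 'rV[R]_d) (phi : 'rV[R]_d -> R) : open Om ->
  (forall x, Om x -> {for x, continuous phi}) ->
  measurable_fun setT (fun x => \1_Om x * phi x).
Proof.
move=> oOm cphi; have mOm := open_measurable_rV oOm.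
have mphi := continuous_on_measurable oOm cphi.
rewrite (_ : (fun _ => _) = phi \_ Om); first by apply/(measurable_restrictT _ _).1.
by apply/funext => x; rewrite patchE indicE; case: (x \in Om); rewrite ?mul1r ?mul0r.
Qed.

(** Carries a measure on a patch over to the box that parametrizes it. *)
Lemma pushforward_restriction d (nu : {measure set 'rV[R]_d -> \bar R})
    (Q : set 'rV[R]_d) (S : 'rV[R]_d -> 'rV[R]_d) :
  measurable Q -> measurable_fun setT S -> (nu (S @^-1` Q) < +oo)%E ->
  exists nu' : {sigma_finite_measure set 'rV[R]_d -> \bar R},
    (forall A, nu' A = nu (S @^-1` A `&` S @^-1` Q)) /\
    (forall h : 'rV[R]_d -> R, measurable_fun setT h -> (forall x, 0 <= h x) ->
      (\int[nu']_y (\1_Q y * h y)%:E = \int[nu]_(x in S @^-1` Q) (h (S x))%:E)%E).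
Proof.
move=> mQ mS Voo.
have mV : measurable (S @^-1` Q) by rewrite -[X in measurable X]setTI; exact: mS.
pose p : {measure set 'rV[R]_d -> \bar R} :=
  measure_function_pushforward__canonical__measure_function_Measure (mrestr nu mV) mS.
have sf : sigma_finite setT p.
  exists (fun=> setT); first by rewrite bigcup_const//; exists 0%N.
  move=> k; split => //; apply: le_lt_trans Voo.
  by rewrite /p/= /pushforward /mrestr preimage_setT setTI.
pose nu' : {sigma_finite_measure set 'rV[R]_d -> \bar R} :=
  HB.pack (Measure.sort p) (Measure_isSigmaFinite.Build _ _ _ p sf).
exists nu'; split => // h mh h0; rewrite -integral_indicator.
transitivity (\int[pushforward (mrestr nu mV) S]_(y in Q) (h y)%:E)%E.
  by apply: eq_measure_integral => A _ _.
rewrite ge0_integral_pushforward//; last 2 first.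
- by apply: measurable_funTS; exact/measurable_EFinP.
- by move=> y _; rewrite lee_fin.
apply: eq_measure_integral => A _ AV.
by rewrite /= /mrestr setIidl.
Qed.

Lemma integral2_preserving d (T : 'rV[R]_d -> 'rV[R]_d) (w : 'rV[R]_d * 'rV[R]_d -> R) :
  measurable_fun setT T ->
  (forall A, measurable A -> leb d (T @^-1` A) = leb d A) ->
  measurable_fun setT w -> (forall p, 0 <= w p) ->
  (\int[leb2 d]_p (w (T p.1, T p.2))%:E = \int[leb2 d]_p (w p)%:E)%E.
Proof.
move=> mT pT mw w0.
have iT (h : 'rV[R]_d -> R) : measurable_fun setT h -> (forall x, 0 <= h x) ->
    (\int[leb d]_x (h (T x))%:E = \int[leb d]_x (h x)%:E)%E.
  move=> mh h0; rewrite -[RHS]mul1e.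
  apply: (@integral_pushforward_scale _ _ _ _ _ _ _ 1) => //.
  by move=> A mA; rewrite mul1e; exact: pT.
have mT1 : measurable_fun setT (fun p : 'rV[R]_d * 'rV[R]_d => T p.1).
  exact: (measurableT_comp mT (@measurable_fst _ _ _ _)).
have mT2 : measurable_fun setT (fun p : 'rV[R]_d * 'rV[R]_d => T p.2).
  exact: (measurableT_comp mT (@measurable_snd _ _ _ _)).
pose wl (p : 'rV[R]_d * 'rV[R]_d) := w (T p.1, p.2).
have mwl : measurable_fun setT wl.
  by apply: (measurableT_comp mw); apply: measurable_fun_pair.
transitivity (\int[leb2 d]_p (wl p)%:E)%E.
  have mww : measurable_fun setT (fun p : 'rV[R]_d * 'rV[R]_d => w (T p.1, T p.2)).
    by apply: (measurableT_comp mw); apply: measurable_fun_pair.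
  rewrite [LHS](integral2_real mww (fun p => w0 _)) [RHS](integral2_real mwl (fun p => w0 _)).
  apply: eq_integral => y _; apply: (iT (fun z => w (T y, z))); last by move=> z.
  exact: (measurable_fun_pair2 (T y) mw).
rewrite [LHS](integral2_realC mwl (fun p => w0 _)) [RHS](integral2_realC mw w0).
apply: eq_integral => z _; apply: (iT (fun y => w (y, z))); last by move=> y.
exact: (measurable_fun_pair1 z mw).
Qed.

(** The substitution by [T] in both variables leaves the integral unchanged, and
    as [T] is Lipschitz the kernel changes by a bounded factor. *)
Lemma energy_le_gagliardo d (Om Q : set 'rV[R]_d) (T : 'rV[R]_d -> 'rV[R]_d)
    (L al : R) (phi : 'rV[R]_d -> R) :
  open Om -> measurable Q -> measurable_fun setT T ->
  (forall A, measurable A -> leb d (T @^-1` A) = leb d A) -> injective T ->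
  (forall y, Q y -> Om (T y)) -> 1 <= L ->
  (forall y z, Q y -> Q z -> `|T y - T z| <= L * `|y - z|) ->
  0 < al < 1 ->
  (forall x, Om x -> {for x, continuous phi}) ->
  (energy Q (riesz (d%:R + al)) (fun y => \1_Om (T y) * phi (T y))%R <=
   ((d.+1%:R * L) ^+ d.+1)%:E * gagliardo Om al phi)%E.
Proof.
move=> oOm mQ mT pT injT TQ L1 TL /andP[al0 al1] cphi.
have mOm := open_measurable_rV oOm.
have mOm1 : measurable_fun setT (\1_Om : 'rV[R]_d -> R) by exact: measurable_indic.
pose f x := \1_Om x * phi x.
have mf : measurable_fun setT f by exact: measurable_patch.
have [g gp] : exists g : 'rV[R]_d * 'rV[R]_d -> R, forall p, g p =
    \1_Om p.2 * (\1_Om p.1 * (`|f p.1 - f p.2| / enorm (p.1 - p.2) `^ (al + d%:R))).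
  by eexists.
have g0 p : 0 <= g p by rewrite gp !mulr_ge0// invr_ge0 powR_ge0.
have mg : measurable_fun setT g.
  rewrite (funext gp).
  apply: measurable_funM; first exact: (measurableT_comp mOm1 (@measurable_snd _ _ _ _)).
  apply: measurable_funM; first exact: (measurableT_comp mOm1 (@measurable_fst _ _ _ _)).
  apply: measurable_funM.
    apply: measurableT_comp => //; apply: measurable_funB.
      exact: (measurableT_comp mf (@measurable_fst _ _ _ _)).
    exact: (measurableT_comp mf (@measurable_snd _ _ _ _)).
  rewrite (_ : (fun _ => _) = fun p => enorm (p.1 - p.2) `^ (- (al + d%:R))).
    apply: (measurableT_comp (measurable_powR _)).
    apply: (measurableT_comp (@measurable_enorm d)).
    by apply: measurable_rVB; [exact: measurable_fst|exact: measurable_snd].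
  by apply/funext => p; rewrite powRN.
have gE : gagliardo Om al phi = (\int[leb2 d]_p (g p)%:E)%E.
  rewrite (integral2_realC mg g0) /gagliardo integral_mkcond; apply: eq_integral => z _.
  rewrite patchE; case: ifPn => [/set_mem zO|zO]; last first.
    by rewrite integral0_eq// => y _; rewrite gp/= indicE (negbTE zO) mul0r.
  rewrite integral_indicator; apply: eq_integral => y _; rewrite gp/= /f !indicE.
  rewrite (mem_set zO) !mul1r.
  by have [/set_mem yO|yO] := boolP (y \in Om); rewrite ?mul1r ?mul0r.
have [c cE] : exists c : R, c = (d.+1%:R * L) ^+ d.+1 by eexists.
have dL1 : 1 <= d.+1%:R * L by rewrite mulr_ege1// ler1n.
have c0 : 0 <= c by rewrite cE exprn_ge0// (le_trans ler01).
pose T2 (p : 'rV[R]_d * 'rV[R]_d) := (T p.1, T p.2).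
have mT2 : measurable_fun setT T2.
  apply: measurable_fun_pair.
    exact: (measurableT_comp mT (@measurable_fst _ _ _ _)).
  exact: (measurableT_comp mT (@measurable_snd _ _ _ _)).
have gT2 := integral2_preserving mT pT mg g0.
have mgT : measurable_fun setT (fun p => g (T2 p)) by exact: (measurableT_comp mg mT2).
rewrite (etrans gE (esym gT2)) -cE.
rewrite -(@integral_realZ _ _ _ (leb2 d) c (fun p => g (T2 p)) mgT (fun p => g0 _) c0).
apply: le_integral_real.
- exact: (measurable_energy_density mQ (measurable_riesz _) (measurableT_comp mf mT)).
- exact: (measurable_funM (measurable_cst c) mgT).
- by move=> p; apply: energy_density_ge0; exact: riesz_ge0.
move=> [y z]; rewrite /energy_density /T2/= -/(f _) -/(f _).
have [yQ|yQ] := pselect (Q y); last first.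
  rewrite (_ : \1_Q y = 0 :> R) ?mul0r; first exact: mulr_ge0 c0 (g0 _).
  by rewrite indicE memNset.
have [zQ|zQ] := pselect (Q z); last first.
  rewrite (_ : \1_Q z = 0 :> R) ?mulr0 ?mul0r; first exact: mulr_ge0 c0 (g0 _).
  by rewrite indicE memNset.
have [->|yz] := eqVneq y z.
  by rewrite subrr normr0 mul0r mulr0; exact: mulr_ge0 c0 (g0 _).
rewrite gp/=.
rewrite !indicE (mem_set yQ) (mem_set zQ) (mem_set (TQ y yQ)) (mem_set (TQ z zQ)) !mul1r.
rewrite [leRHS]mulrCA; apply: ler_wpM2l; first exact: normr_ge0.
have yz0 : 0 < `|y - z| by rewrite normr_gt0 subr_eq0.
have Tyz0 : 0 < enorm (T y - T z).
  by apply: enorm_gt0; rewrite subr_eq0; apply: contra yz => /eqP/injT ->.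
rewrite /riesz -powRN (addrC al).
set s := d%:R + al.
have s0 : 0 <= s by rewrite addr_ge0// ltW.
have dLyz : enorm (T y - T z) <= d.+1%:R * L * `|y - z|.
  apply: (le_trans (enorm_le _)); rewrite -mulrA; apply: ler_pM => //.
    by rewrite ler_nat.
  exact: TL.
apply: (@le_trans _ _ ((d.+1%:R * L) `^ s * enorm (T y - T z) `^ (- s))); last first.
  rewrite ler_wpM2r ?powR_ge0// cE -powR_mulrn ?(le_trans ler01)//.
  by apply: ler_powR => //; rewrite /s -natr1 lerD2l ltW.
have L0 : 0 < L by exact: lt_le_trans ltr01 L1.
have dLp : 0 < d.+1%:R * L by exact: lt_le_trans ltr01 dL1.
rewrite !powRN -ler_pdivrMl ?powR_gt0// -invfM -powRM ?(ltW dLp)//.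
rewrite lef_pV2 ?posrE ?powR_gt0 ?mulr_gt0//.
apply: ge0_ler_powR => //; rewrite ?nnegrE ?(ltW Tyz0)//.
by rewrite mulr_ge0 ?(ltW dLp).
Qed.

End trace_poincare_inequality.

Section chart_patches.
Context {R : realType}.
Local Notation leb d := (@lebesgue_rV R d).

(** [T] being Lipschitz on the box, images of small boxes lie in small balls, so
    the measure transported to the box is again Frostman. *)
Lemma chart_trace_poincare d (Om O : set 'rV[R]_d) (T S : 'rV[R]_d -> 'rV[R]_d)
    (L : R) (a b : 'rV[R]_d) (l : R) :
  (0 < d)%N -> open Om -> measurable O ->
  measurable_fun setT T -> measurable_fun setT S -> cancel T S -> cancel S T ->
  (forall A, measurable A -> leb d (T @^-1` A) = leb d A) ->
  0 < l -> (forall i, l / 2 <= b ord0 i - a ord0 i <= l) ->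
  (forall y, box a b y -> Om (T y)) -> 1 <= L ->
  (forall y z, box a b y -> box a b z -> `|T y - T z| <= L * `|y - z|) ->
  (forall x, O x -> box a b (S x)) -> trace_poincare Om O.
Proof.
move=> d0 oOm mO mT mS TK SK pT l0 abl TQ L1 TL OQ.
have mQ := measurable_box a b.
have mOm := open_measurable_rV oOm.
have L0 : 0 < L by exact: lt_le_trans ltr01 L1.
have [N NE] : exists N : R, N = 2016 * 4 ^+ d by eexists.
have N0 : 0 <= N by rewrite NE; apply: mulr_ge0; [exact: ler0n|exact: exprn_ge0].
have [c cE] : exists c : R, c = (d.+1%:R * L) ^+ d.+1 by eexists.
have c0 : 0 <= c by rewrite cE exprn_ge0// mulr_ge0// ltW.
(* [N] comes from [cube_oscillation], [L ^+ d] from the transported measure and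
   [c] from the energy. *)
exists (N * L ^+ d * c); split; first by rewrite !mulr_ge0// exprn_ge0// ltW.
move=> al M phi al01 cphi phiM; have /andP[al0 al1] := al01.
have [u uE] : exists u : 'rV[R]_d -> R, forall y, u y = \1_Om (T y) * phi (T y) by eexists.
have uQ y : box a b y -> u y = phi (T y).
  by move=> /TQ yO; rewrite uE indicE mem_set// mul1r.
have mf := measurable_patch oOm cphi.
have mu : measurable_fun setT u by rewrite (funext uE); exact: (measurableT_comp mf mT).
have cu y : box a b y -> forall e : R, 0 < e -> exists2 r : R, 0 < r &
    forall z, box a b z -> `|y - z| < r -> `|u y - u z| < e.
  move=> yQ e e0.
  have /cvgrPdist_lt/(_ e e0)/nbhs_ballP[r /= r0 rphi] := cphi _ (TQ y yQ).
  exists (r / L); first by rewrite divr_gt0.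
  move=> z zQ yz; rewrite !uQ//; apply: rphi.
  rewrite -ball_normE /ball_/=; apply: le_lt_trans (TL _ _ yQ zQ) _.
  by rewrite mulrC -ltr_pdivlMr.
have uM y : box a b y -> `|u y| <= M by move=> yQ; rewrite uQ//; apply: phiM; exact: TQ.
have [m mP] := cube_oscillation d0 al01 l0 abl mu cu uM.
exists m => nu K K0 frnu.
have bQ : box a b b.
  move=> i; rewrite in_itv/= lexx andbT -subr_gt0.
  by have /andP[h _] := abl i; apply: lt_le_trans h; rewrite divr_gt0.
have mV : measurable (S @^-1` box a b) by rewrite -[X in measurable X]setTI; exact: mS.
have VOm : S @^-1` box a b `<=` Om by move=> x /= /TQ; rewrite SK.
have Voo : (nu (S @^-1` box a b) < +oo)%E.
  apply: (@le_lt_trans _ _ (K * (L * l) `^ (d%:R - al))%:E); last exact: ltry.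
  apply: (frnu _ (T b)) => //; first by rewrite mulr_gt0.
  move=> x /= xQ; rewrite -(SK x); apply: le_trans (TL _ _ xQ bQ) _.
  rewrite ler_wpM2l ?(ltW L0)//; apply: (box_diam (ltW l0) _ xQ bQ) => i.
  by have /andP[] := abl i.
have [nu' [nu'E nu'I]] := pushforward_restriction mQ mS Voo.
have frnu' (a' b' : 'rV[R]_d) (l' : R) : 0 < l' ->
    (forall i, 0 <= b' ord0 i - a' ord0 i <= l') ->
    (nu' (box a' b') <= (K * L ^+ d * l' `^ (d%:R - al))%:E)%E.
  move=> l'0 ab'; rewrite nu'E.
  set A := _ `&` _.
  have mA : measurable A.
    apply: measurableI => //; rewrite -[X in measurable X]setTI; apply: (mS) => //.
    exact: measurable_box.
  have [[x0 [/= x01 x02]]|A0] := pselect (A !=set0); last first.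
    rewrite (_ : A = set0) ?measure0 ?lee_fin ?mulr_ge0 ?powR_ge0 ?exprn_ge0 ?(ltW L0)//.
    by apply/seteqP; split => // x Ax; apply: A0; exists x.
  apply: (@le_trans _ _ (K * (L * l') `^ (d%:R - al))%:E).
    apply: (frnu _ x0) => //; first by move=> x [_ /VOm].
      by rewrite mulr_gt0.
    move=> x [/= x1 x2]; rewrite -(SK x) -(SK x0); apply: le_trans (TL _ _ x2 x02) _.
    rewrite ler_wpM2l ?(ltW L0)//; apply: (box_diam (ltW l'0) _ x1 x01) => i.
    by have /andP[] := ab' i.
  rewrite lee_fin -mulrA ler_wpM2l// powRM ?(ltW L0) ?(ltW l'0)//.
  rewrite ler_wpM2r ?powR_ge0// -powR_mulrn ?(ltW L0)//.
  by apply: ler_powR => //; rewrite gerBl ltW.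
have KL0 : 0 <= K * L ^+ d by rewrite mulr_ge0// exprn_ge0// ltW.
have {mP}mP := mP nu' _ KL0 frnu'.
rewrite -NE in mP.
have en : (energy (box a b) (riesz (d%:R + al)) u <= c%:E * gagliardo Om al phi)%E.
  rewrite cE (funext uE); apply: energy_le_gagliardo => //.
  exact: can_inj TK.
have -> : N * L ^+ d * c * K * (1 - al) = N * (K * L ^+ d) * (1 - al) * c by ring.
rewrite EFinM -muleA.
have x0 : 0 <= N * (K * L ^+ d) * (1 - al) by rewrite !mulr_ge0 ?exprn_ge0 ?(ltW L0) ?subr_ge0 ?(ltW al1).
apply: le_trans (lee_wpmul2l _ en); last by rewrite lee_fin.
apply: le_trans mP.
rewrite nu'I; last 2 first.
- by apply: measurableT_comp => //; exact: measurable_funB.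
- by move=> x.
have OV : O `<=` S @^-1` box a b by move=> x /OQ.
have eqf (A : set 'rV[R]_d) : A `<=` S @^-1` box a b ->
    (\int[nu]_(x in A) `|phi x - m|%:E = \int[nu]_(x in A) `|\1_Om x * phi x - m|%:E)%E.
  move=> AV; apply: eq_integral => x /set_mem/AV/VOm xO.
  by rewrite indicE mem_set// mul1r.
rewrite eqf//.
rewrite [leRHS](_ : _ = (\int[nu]_(x in S @^-1` box a b) `|\1_Om x * phi x - m|%:E)%E); last first.
  by apply: eq_integral => x _; rewrite uE SK.
apply: ge0_subset_integral => //.
apply: measurable_funTS; apply/measurable_EFinP; apply: measurableT_comp => //.
exact: measurable_funB.
Qed.

End chart_patches.

(** * Patches at the boundary *)

Section smooth_lipschitz.
Context {R : realType}.

Lemma set_coord_derive d (g : 'rV[R]_d -> R) (w : 'rV[R]_d) (i : 'I_d) (s : R) :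
  derivable g (set_coord i s w) (delta_mx ord0 i) ->
  is_derive s (1 : R) (fun t => g (set_coord i t w))
    ('D_(delta_mx ord0 i) g (set_coord i s w)).
Proof.
move=> dg.
have E : (fun h : R => h^-1 *: (((fun t => g (set_coord i t w)) \o shift s) (h *: (1 : R)) -
      g (set_coord i s w))) =
   (fun h : R => h^-1 *: ((g \o shift (set_coord i s w)) (h *: delta_mx ord0 i) -
      g (set_coord i s w))).
  apply/funext => h /=; congr (_ *: (g _ - _)).
  apply/rowP => j; rewrite !mxE eqxx/= [_%:A]mulr1.
  by case: eqVneq => [_|_]; rewrite ?mulr1// mulr0 add0r.
by apply: DeriveDef; rewrite /derivable /derive E.
Qed.

Lemma set_coord_lipschitz d (g : 'rV[R]_d -> R) (w : 'rV[R]_d) (i : 'I_d) (M : R) s t :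
  (forall x, derivable g x (delta_mx ord0 i)) ->
  (forall u, Num.min s t <= u <= Num.max s t ->
    `|'D_(delta_mx ord0 i) g (set_coord i u w)| <= M) ->
  `|g (set_coord i s w) - g (set_coord i t w)| <= M * `|s - t|.
Proof.
move=> dg; wlog st : s t / s <= t => [h|].
  have [st|ts] := orP (le_total s t); first exact: h.
  move=> gM; rewrite distrC [`|s - t|]distrC; apply: h => //.
  by move=> u; rewrite minC maxC; exact: gM.
rewrite (min_idPl st) (max_idPr st) => gM.
have df u : is_derive u (1 : R) (fun t => g (set_coord i t w))
    ('D_(delta_mx ord0 i) g (set_coord i u w)) by exact: set_coord_derive.
have cf : {within `[s, t], continuous (fun t => g (set_coord i t w))}.
  by apply: derivable_within_continuous => u _; have [] := df u.
have [c cst E] := MVT_segment st (fun u _ => df u) cf.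
rewrite distrC E normrM [`|s - t|]distrC ler_wpM2r//; apply: gM.
by move: cst; rewrite in_itv.
Qed.

(** Near [q] the partial derivatives are bounded by continuity; walk from [y] to
    [z] changing one coordinate at a time. *)
Lemma smooth_lipschitz d (g : 'rV[R]_d -> R) (q : 'rV[R]_d) : smooth_on setT g ->
  exists r L : R, [/\ 0 < r, 0 <= L & forall y z, `|y - q| < r -> `|z - q| < r ->
    `|g y - g z| <= L * `|y - z|].
Proof.
move=> sg.
have cD i : {for q, continuous ('D_(delta_mx ord0 i) g)} by have [] := sg [:: i] q I.
have dg x i : derivable g x (delta_mx ord0 i) by have [_] := sg [::] x I; exact.
pose M := \sum_i (`|'D_(delta_mx ord0 i) g q| + 1).
have [r r0 rM] : exists2 r : R, 0 < r & forall x i, `|x - q| < r ->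
    `|'D_(delta_mx ord0 i) g x| <= M.
  have : \forall x \near q, forall i : 'I_d, `|'D_(delta_mx ord0 i) g x| <= M.
    apply: (@filter_forall _ 'I_d (fun i x => `|'D_(delta_mx ord0 i) g x| <= M) (nbhs q)) => i.
    have /cvgrPdist_lt/(_ 1 ltr01) := cD i; apply: filterS => x xi.
    apply: (@le_trans _ _ (`|'D_(delta_mx ord0 i) g q| + 1)).
      rewrite -lerBlDl; apply: le_trans (ltW xi).
      by rewrite distrC lerB_dist.
    by rewrite /M (bigD1 i)//= lerDl; apply: sumr_ge0 => j _; rewrite addr_ge0.
  move=> /nbhs_ballP[r /= r0 rM]; exists r => // x i xr; apply: rM.
  by rewrite -ball_normE /ball_/= distrC.
have M0 : 0 <= M by apply: sumr_ge0 => j _; rewrite addr_ge0.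
exists r, (d%:R * M); split => //; first by rewrite mulr_ge0.
move=> y z yr zr.
pose w k : 'rV[R]_d := \row_j if (j < k)%N then z ord0 j else y ord0 j.
have wd : w d = z by apply/rowP => j; rewrite mxE ltn_ord.
have w0 : w 0%N = y by apply/rowP => j; rewrite mxE.
suff H k : (k <= d)%N -> `|g y - g (w k)| <= k%:R * M * `|y - z|.
  by rewrite -[in g z]wd; exact: H.
elim: k => [|k IH] kd; first by rewrite w0 subrr normr0 !mul0r.
pose i := Ordinal kd.
have wS : w k.+1 = set_coord i (z ord0 i) (w k).
  apply/rowP => j; rewrite !mxE ltnS leq_eqVlt.
  have [->|ji] := eqVneq j i; first by rewrite eqxx.
  by rewrite (_ : (j == k :> nat) = false)//; apply: contraNF ji => /eqP jk; apply/eqP/val_inj.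
have wk : w k = set_coord i (y ord0 i) (w k).
  by apply/rowP => j; rewrite !mxE; case: eqVneq => [->|//]; rewrite /= ltnn.
rewrite -natr1 mulrDl mul1r mulrDl.
apply: (le_trans (ler_distD (g (w k)) _ _)); apply: lerD; first exact/IH/ltnW.
rewrite wS {1}wk; apply: (@le_trans _ _ (M * `|y ord0 i - z ord0 i|)); last first.
  by rewrite ler_wpM2l//; have := rV_coord_le (y - z) i; rewrite !mxE.
apply: set_coord_lipschitz => // u /andP[u1 u2]; apply: rM.
apply: (@le_lt_trans _ _ (Num.max `|y - q| `|z - q|)); last by rewrite gt_max yr.
apply/rV_normP => [|j]; first by rewrite le_max normr_ge0.
have yj := rV_coord_le (y - q) j; have zj := rV_coord_le (z - q) j.
rewrite !mxE in yj zj *; have [ji|ji] := eqVneq j i; last first.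
  by case: ifP => _; rewrite le_max ?yj ?zj ?orbT.
rewrite ji in yj zj *.
have Y : `|y ord0 i - q ord0 i| <= Num.max `|y - q| `|z - q| by rewrite le_max yj.
have Z : `|z ord0 i - q ord0 i| <= Num.max `|y - q| `|z - q| by rewrite le_max zj orbT.
move: Y Z u1 u2; move: (Num.max `|y - q| _) => N.
rewrite !ler_norml => /andP[Y1 Y2] /andP[Z1 Z2].
rewrite ge_min le_max => /orP[a1|a1] /orP[a2|a2]; apply/andP; split; lra.
Qed.

End smooth_lipschitz.

Section neighbourhoods.
Context {R : realType}.

Lemma mem_rV_ball d (p x : 'rV[R]_d) (r : R) : ball p r x <-> `|x - p| < r.
Proof. by rewrite -ball_normE /ball_/= distrC. Qed.

Lemma interior_patch d (Om : set 'rV[R]_d) (p : 'rV[R]_d) :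
  (0 < d)%N -> open Om -> Om p ->
  exists N, [/\ open N, N p & trace_poincare Om (N `&` Om)].
Proof.
move=> d0 oOm pOm.
have /nbhs_ballP[r /= r0 rOm] := open_nbhs_nbhs (conj oOm pOm).
have r20 : 0 < r / 2 by rewrite divr_gt0.
exists (ball p (r / 2)); split; [exact: ball_open|exact: ballxx|].
apply: (@chart_trace_poincare R d Om _ id id 1 (p - const_mx (r / 2)) (p + const_mx (r / 2)) r) => //.
- apply: measurableI; last exact: open_measurable_rV.
  by apply: open_measurable_rV; exact: ball_open.
- by move=> i; rewrite !mxE; apply/andP; split; lra.
- move=> y yQ; apply: rOm; apply/mem_rV_ball.
  apply: (@le_lt_trans _ _ (r / 2)); last by rewrite ltr_pdivrMr// ltr_pMr// ltr1n.
  apply/rV_normP => [|i]; first exact: ltW.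
  have := yQ i; rewrite in_itv/= !mxE ler_norml => /andP[? ?].
  by apply/andP; split; lra.
- by move=> y z _ _; rewrite mul1r.
- move=> x [/mem_rV_ball xp _] i; rewrite in_itv/= !mxE.
  have := le_lt_trans (rV_coord_le (x - p) i) xp.
  by rewrite !mxE ltr_norml => /andP[? ?]; apply/andP; split; lra.
Qed.

Lemma insert_coord_dist d (i : 'I_d.+1) (t t' e : R) (y y' : 'rV[R]_d) :
  `|t - t'| <= e -> `|y - y'| <= e ->
  `|insert_coord i t y - insert_coord i t' y'| <= e.
Proof.
move=> te ye; have e0 : 0 <= e := le_trans (normr_ge0 _) te.
apply/rV_normP => // j; rewrite !mxE; case: unliftP => [k|] _ //.
by apply: le_trans ye; have := rV_coord_le (y - y') k; rewrite !mxE.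
Qed.

Lemma col'_dist d (i : 'I_d.+1) (x y : 'rV[R]_d.+1) :
  `|col' i x - col' i y| <= `|x - y|.
Proof.
apply/rV_normP => // j; rewrite !mxE.
by have := rV_coord_le (x - y) (lift i j); rewrite !mxE.
Qed.

Lemma chart_dist d (i : 'I_d.+1) b (g : 'rV[R]_d -> R) (L : R) x y : 0 <= L ->
  `|g (col' i x) - g (col' i y)| <= L * `|col' i x - col' i y| ->
  `|chart i b g x - chart i b g y| <= (1 + L) * `|x - y|.
Proof.
move=> L0 gL; apply: insert_coord_dist; last first.
  apply: (le_trans (col'_dist _ _ _)); rewrite mulrDl mul1r lerDl.
  by rewrite mulr_ge0.
rewrite -mulrBr normrM normr_sign mul1r opprD addrACA mulrDl mul1r.
apply: (le_trans (ler_normD _ _)); apply: lerD.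
  by have := rV_coord_le (x - y) i; rewrite !mxE.
by apply: (le_trans gL); rewrite ler_wpM2l// col'_dist.
Qed.

Lemma unchart_dist d (i : 'I_d.+1) b (g : 'rV[R]_d -> R) (L : R) x y : 0 <= L ->
  `|g (col' i x) - g (col' i y)| <= L * `|col' i x - col' i y| ->
  `|unchart i b g x - unchart i b g y| <= (1 + L) * `|x - y|.
Proof.
move=> L0 gL; apply: insert_coord_dist; last first.
  apply: (le_trans (col'_dist _ _ _)); rewrite mulrDl mul1r lerDl.
  by rewrite mulr_ge0.
rewrite opprD addrACA -mulrBr mulrDl mul1r.
apply: (le_trans (ler_normD _ _)); apply: lerD.
  by rewrite normrM normr_sign mul1r; have := rV_coord_le (x - y) i; rewrite !mxE.
by rewrite -opprD normrN; apply: (le_trans gL); rewrite ler_wpM2l// col'_dist.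
Qed.

(** The preimage [q] of [p] under the chart lies on the hyperplane [x i = 0]:
    [q i > 0] would put [p] in the open set, [q i < 0] outside its closure.  So
    a small half-open box above [q] parametrizes the set near [p]. *)
Lemma boundary_patch d (Om : set 'rV[R]_d) (p : 'rV[R]_d) :
  (0 < d)%N -> open Om -> smooth_boundary Om -> closure Om p -> ~ Om p ->
  exists N, [/\ open N, N p & trace_poincare Om (N `&` Om)].
Proof.
move=> d0 oOm sOm clp pOm; have [] := sOm p (conj clp pOm).
move: d0 Om p oOm sOm clp pOm; case: d => // d _ Om p oOm _ clp pOm.
move=> i [b] [g] [r] [r0 sg UE].
have cg : continuous g by move=> x; have [] := sg [::] x I.
have mg := continuous_measurable_rV cg.
pose T := chart i b g; pose S := unchart i b g.
have [q qE] : exists q, q = S p by eexists.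
have Tq : T q = p by rewrite qE; exact: unchartK.
have [r1 [L1 [r10 L10 gL]]] := smooth_lipschitz (col' i p) sg.
have [L LE] : exists L, L = 1 + L1 by eexists.
have L1' : 1 <= L by rewrite LE lerDl.
have L0 : 0 < L by exact: lt_le_trans ltr01 L1'.
have colq : col' i q = col' i p by rewrite qE col'_insert_coord.
have TL y z : `|y - q| < r1 -> `|z - q| < r1 -> `|T y - T z| <= L * `|y - z|.
  move=> yr zr; rewrite LE; apply: chart_dist => //.
  by apply: gL; rewrite -colq; apply: le_lt_trans (col'_dist _ _ _) _.
have SL y z : `|y - p| < r1 -> `|z - p| < r1 -> `|S y - S z| <= L * `|y - z|.
  move=> yr zr; rewrite LE; apply: unchart_dist => //.
  by apply: gL; apply: le_lt_trans (col'_dist _ _ _) _.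
pose r2 := r / d.+2%:R.
have r20 : 0 < r2 by rewrite divr_gt0.
have OmE x : `|x - p| < r2 -> (Om x <-> 0 < S x ord0 i).
  move=> xp; rewrite insert_coord_same subr_gt0; apply: UE.
  rewrite /eball/=; apply: (le_lt_trans (enorm_le _)).
  apply: (@le_lt_trans _ _ (d.+2%:R * `|x - p|)); first by rewrite ler_wpM2r// ler_nat.
  by rewrite mulrC -ltr_pdivlMr.
have pp (e : R) : 0 < e -> `|p - p| < e by rewrite subrr normr0.
have qi : q ord0 i = 0.
  apply/eqP; rewrite eq_le; apply/andP; split.
    by rewrite leNgt; apply/negP => qi0; apply: pOm; apply/OmE; [exact: pp|rewrite -qE].
  rewrite leNgt; apply/negP => qi0.
  pose e := Num.min (Num.min r1 r2) (- q ord0 i / L).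
  have e0 : 0 < e by rewrite !lt_min r10 r20 divr_gt0// oppr_gt0.
  have [x [xOm /mem_rV_ball]] := clp _ (nbhsx_ballx p e e0).
  rewrite !lt_min => /andP[/andP[xr1 xr2] xq].
  have /OmE-/(_ xr2) := xOm.
  have := le_trans (rV_coord_le (S x - S p) i) (SL x p xr1 (pp _ r10)).
  rewrite ltr_pdivlMr// mulrC in xq => /le_lt_trans/(_ xq).
  rewrite -qE !mxE ltr_norml => /andP[_ h1] h2; lra.
have [N [N0 Nr1 Nr2]] : exists N : R, [/\ 0 < N, N <= r1 & N <= r2 / L].
  exists (Num.min r1 (r2 / L)).
  by rewrite lt_min r10 divr_gt0// !ge_min !lexx orbT.
pose rho := N / 4.
have rho0 : 0 < rho by rewrite divr_gt0.
have rho1 : 2 * rho < r1 by rewrite /rho; lra.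
have rho2 : L * (2 * rho) < r2 by rewrite mulrC -ltr_pdivlMr// /rho; lra.
have Lrho : rho <= L * rho by rewrite ler_peMl// ltW.
(* The box of side [2 * rho] centred at [q] in the directions other than [i],
   and resting on the hyperplane in the direction [i]. *)
pose a : 'rV[R]_d.+1 := \row_j (if j == i then 0 else q ord0 j - rho).
pose c : 'rV[R]_d.+1 := \row_j (if j == i then 2 * rho else q ord0 j + rho).
have Qq y : box a c y -> `|y - q| <= 2 * rho.
  move=> yQ; apply/rV_normP => [|j]; first by rewrite mulr_ge0// ltW.
  have := yQ j; rewrite in_itv/= !mxE ler_norml; case: eqVneq => [->|_] /andP[? ?].
    by rewrite qi; apply/andP; split; lra.
  by apply/andP; split; lra.
exists (ball p (rho / L)); split; [exact: ball_open| |].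
  by apply: ballxx; rewrite divr_gt0.
apply: (@chart_trace_poincare R d.+1 Om _ T S L a c (2 * rho)) => //.
- apply: measurableI; last exact: open_measurable_rV.
  by apply: open_measurable_rV; exact: ball_open.
- exact: measurable_chart.
- exact: measurable_unchart.
- exact: chartK.
- exact: unchartK.
- by move=> A mA; exact: lebesgue_rV_chart.
- by rewrite mulr_gt0.
- by move=> j; rewrite !mxE; case: ifP => _; apply/andP; split; lra.
- move=> y yQ; have yq := Qq y yQ; apply/OmE.
    rewrite -Tq; apply: le_lt_trans rho2; apply: le_trans (TL _ _ _ _) _.
    + exact: le_lt_trans rho1.
    + by rewrite subrr normr0.
    + by rewrite ler_wpM2l// ltW.
  rewrite /S /T chartK; have := yQ i; rewrite in_itv/= !mxE eqxx.
  by case/andP.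
- by move=> y z /Qq yQ /Qq zQ; apply: TL; exact: le_lt_trans rho1.
move=> x [/mem_rV_ball xp xOm].
have xrho : `|x - p| < rho.
  by apply: (lt_le_trans xp); rewrite ler_pdivrMr// mulrC.
have Sx : `|S x - q| < rho.
  rewrite qE; apply: le_lt_trans (SL _ _ _ (pp _ r10)) _.
    by apply: (lt_trans xrho); lra.
  by rewrite mulrC -ltr_pdivlMr.
have Sxi : 0 < S x ord0 i.
  by apply/(OmE x _).1 => //; apply: (lt_trans xrho); lra.
move: (S x) Sx Sxi => w Sw wi.
move=> j; have := le_lt_trans (rV_coord_le (w - q) j) Sw.
rewrite in_itv/= !mxE ltr_norml; have [->|ji] := eqVneq j i.
  by rewrite qi subr0 wi/= => /andP[_ h]; lra.
by move=> /andP[h1 h2]; apply/andP; split; lra.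
Qed.

End neighbourhoods.

(** * Gluing patches *)

Section gluing.
Context {R : realType}.
Local Notation leb d := (@lebesgue_rV R d).

Lemma bounded_rV d (Om : set 'rV[R]_d) : bounded_set Om ->
  exists2 r : R, 1 <= r & forall y, Om y -> `|y| <= r.
Proof.
move=> [M [_ OmM]]; exists (Num.max 1 (M + 1)); first by rewrite le_max lexx.
by move=> y yO; apply: OmM => //; rewrite lt_max ltrDl ltr01 orbT.
Qed.

Lemma lebesgue_rV_open_gt0 d (O : set 'rV[R]_d) : open O -> O !=set0 ->
  (0 < leb d O)%E.
Proof.
move=> oO [p pO].
have /nbhs_ballP[r /= r0 rO] := open_nbhs_nbhs (conj oO pO).
have r20 : 0 < r / 2 by rewrite divr_gt0.
apply: (@lt_le_trans _ _ (leb d [set z | `|p - z| <= r / 2])).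
  by rewrite lebesgue_rV_closed_ball ?ltW// lte_fin exprn_gt0// mulr_gt0.
apply: le_measure; rewrite ?inE; last 2 first.
- exact: open_measurable_rV.
- move=> z /= pz; apply: rO; rewrite -ball_normE /ball_/=.
  by apply: le_lt_trans pz _; rewrite ltr_pdivrMr// ltr_pMr// ltr1n.
exact: measurable_rV_closed_ball.
Qed.

Lemma lebesgue_rV_le_ball d (A : set 'rV[R]_d) (x : 'rV[R]_d) (r : R) :
  measurable A -> 0 <= r -> (forall y, A y -> `|y - x| <= r) ->
  (leb d A <= ((2 * r) ^+ d)%:E)%E.
Proof.
move=> mA r0 Ar; rewrite -(lebesgue_rV_closed_ball x r0).
apply: le_measure; rewrite ?inE//.
  exact: measurable_rV_closed_ball.
by move=> y /Ar; rewrite /= distrC.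
Qed.

(** On a bounded set the exponent [d] can be lowered to [d - al], at the cost of
    a constant that does not depend on [al]. *)
Lemma frostman_lebesgue d (Om : set 'rV[R]_d) : bounded_set Om ->
  exists K : R, 0 <= K /\ forall al, 0 < al < 1 -> (0 < d)%N ->
    frostman Om (d%:R - al) K (leb d).
Proof.
move=> /bounded_rV[r0 r01 Omr]; have r00 : 0 < r0 by exact: lt_le_trans ltr01 r01.
have [V [V0 VE]] : exists V : R, 0 <= V /\ forall A, measurable A -> A `<=` Om ->
    (leb d A <= V%:E)%E.
  exists ((2 * r0) ^+ d); split; first by rewrite exprn_ge0// mulr_ge0// ltW.
  move=> A mA AO; apply: (@lebesgue_rV_le_ball _ _ 0) => //; first exact: ltW.
  by move=> y /AO/Omr; rewrite subr0.
have c0 : 0 <= 2 ^+ d :> R by rewrite exprn_ge0.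
exists (2 ^+ d + V); split; first by rewrite addr_ge0.
move=> al /andP[al0 al1] d0 A x r mA AO rr Ar.
have [r1|r1] := leP r 1.
  apply: (le_trans (lebesgue_rV_le_ball mA (ltW rr) Ar)).
  rewrite lee_fin exprMn; apply: ler_pM => //; first by rewrite exprn_ge0// ltW.
    by rewrite lerDl.
  rewrite -powR_mulrn ?(ltW rr)//; apply: ger_powR; first by rewrite rr r1.
  by rewrite gerBl ltW.
apply: (le_trans (VE A mA AO)); rewrite lee_fin.
apply: (@le_trans _ _ ((2 ^+ d + V) * r `^ 0)); first by rewrite powRr0 mulr1 lerDr.
rewrite ler_wpM2l ?addr_ge0//; apply: ler_powR; first exact: ltW.
by rewrite subr_ge0; apply: le_trans (ltW al1) _; rewrite ler1n.
Qed.

Lemma frostman_mass d (Om : set 'rV[R]_d) : bounded_set Om ->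
  exists D : R, 0 <= D /\ forall al K (nu : set 'rV[R]_d -> \bar R) A,
    0 < al < 1 -> (0 < d)%N ->
    0 <= K -> frostman Om (d%:R - al) K nu -> measurable A -> A `<=` Om ->
    (nu A <= (K * D)%:E)%E.
Proof.
move=> /bounded_rV[r0 r01 Omr]; have r00 : 0 < r0 by exact: lt_le_trans ltr01 r01.
exists (r0 ^+ d); split; first by rewrite exprn_ge0// ltW.
move=> al K nu A /andP[al0 al1] d0 K0 frnu mA AO.
apply: (@le_trans _ _ (K * r0 `^ (d%:R - al))%:E).
  by apply: (frnu A 0) => // y /AO/Omr; rewrite subr0.
rewrite lee_fin ler_wpM2l// -powR_mulrn ?(ltW r00)//.
by apply: ler_powR => //; rewrite gerBl ltW.
Qed.

(** Compares the constants [x] and [y] chosen on two overlapping patches, with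
    [O] their overlap. *)
Lemma integral_const_le d (m : {measure set 'rV[R]_d -> \bar R})
    (O : set 'rV[R]_d) (f : 'rV[R]_d -> R) (x y : R) :
  measurable O -> measurable_fun O f ->
  (`|x - y|%:E * m O <= \int[m]_(z in O) `|f z - x|%:E + \int[m]_(z in O) `|f z - y|%:E)%E.
Proof.
move=> mO mf.
have mfx (c : R) : measurable_fun O (fun z => `|f z - c|%:E).
  apply/measurable_EFinP; apply: measurableT_comp => //.
  by apply: measurable_funB.
rewrite -integral_cst// -ge0_integralD//.
apply: ge0_le_integral => //.
- by move=> z _; rewrite /cst lee_fin.
- by apply: emeasurable_funD.
- move=> z _; rewrite /cst -EFinD lee_fin.
  by rewrite [`|f z - x|]distrC; exact: ler_distD.
Qed.

Lemma integral_change_const d (m : {measure set 'rV[R]_d -> \bar R})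
    (O : set 'rV[R]_d) (f : 'rV[R]_d -> R) (x y : R) :
  measurable O -> measurable_fun O f ->
  (\int[m]_(z in O) `|f z - x|%:E <= \int[m]_(z in O) `|f z - y|%:E + `|x - y|%:E * m O)%E.
Proof.
move=> mO mf.
have mfx (c : R) : measurable_fun O (fun z => `|f z - c|%:E).
  apply/measurable_EFinP; apply: measurableT_comp => //.
  by apply: measurable_funB.
rewrite -integral_cst// -ge0_integralD//; last by move=> z _; rewrite /cst lee_fin.
apply: ge0_le_integral => //.
- by apply: emeasurable_funD.
- move=> z _; rewrite /cst -EFinD lee_fin [`|x - y|]distrC.
  exact: ler_distD.
Qed.

Lemma integral_setU_le d (m : {measure set 'rV[R]_d -> \bar R})
    (A B : set 'rV[R]_d) (f : 'rV[R]_d -> R) :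
  measurable A -> measurable B -> measurable_fun (A `|` B) f ->
  (forall x, 0 <= f x) ->
  (\int[m]_(z in A `|` B) (f z)%:E <=
   \int[m]_(z in A) (f z)%:E + \int[m]_(z in B) (f z)%:E)%E.
Proof.
move=> mA mB mf f0.
have -> : A `|` B = A `|` (B `\` A) by rewrite setUDr setDv setD0.
have mfE : measurable_fun (A `|` B) (fun z => (f z)%:E) by exact/measurable_EFinP.
rewrite ge0_integral_setU//.
- apply: leeD2l; apply: ge0_subset_integral => //; first exact: measurableD.
    by apply: measurable_funS mfE; [exact: measurableU|exact: subsetUr].
  by move=> x _; rewrite lee_fin.
- exact: measurableD.
- apply: measurable_funS mfE; first exact: measurableU.
  by apply: setUS; exact: subDsetl.
- by move=> x _; rewrite lee_fin.
- by rewrite disj_set2E setDIK.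
Qed.

End gluing.

Section connected_gluing.
Context {R : realType}.
Local Notation leb d := (@lebesgue_rV R d).

Lemma gagliardo_ge0 d (Om : set 'rV[R]_d) al phi : (0 <= gagliardo Om al phi)%E.
Proof.
apply: integral_ge0 => z _; apply: integral_ge0 => y _.
by rewrite lee_fin mulr_ge0// invr_ge0 powR_ge0.
Qed.

(** The Lebesgue measure of the overlap times [|m1 - m2|] is bounded by the two
    inequalities for Lebesgue measure. *)
Lemma trace_poincare_union d (Om O1 O2 : set 'rV[R]_d) :
  (0 < d)%N -> open Om -> bounded_set Om -> open O1 -> open O2 ->
  O1 `<=` Om -> O2 `<=` Om -> O1 `&` O2 !=set0 ->
  trace_poincare Om O1 -> trace_poincare Om O2 -> trace_poincare Om (O1 `|` O2).
Proof.
move=> d0 oOm bOm oO1 oO2 O1Om O2Om O12 [C1 [C10 H1]] [C2 [C20 H2]].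
have [K0 [K00 frleb]] := frostman_lebesgue bOm.
have [D [D0 massD]] := frostman_mass bOm.
have mO1 := open_measurable_rV oO1; have mO2 := open_measurable_rV oO2.
have mI : measurable (O1 `&` O2) by exact: measurableI.
have I0 : (0 < leb d (O1 `&` O2))%E.
  by apply: lebesgue_rV_open_gt0 => //; exact: openI.
have [v [v0 vE]] : exists v : R, 0 < v /\ leb d (O1 `&` O2) = v%:E.
  have fin : leb d (O1 `&` O2) \is a fin_num.
    rewrite ge0_fin_numE//; apply: le_lt_trans (ltry (K0 * D)).
    (* Any exponent shows that the mass is finite. *)
    have h : 0 < (2^-1 : R) < 1 by rewrite invr_gt0 ltr0n invf_lt1// ltr1n.
    by apply: (massD _ _ _ _ h d0 K00 (frleb _ h d0)) => // x [/O1Om].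
  exists (fine (leb d (O1 `&` O2))); rewrite fineK//; split => //.
  by rewrite fine_gt0// I0/= -ge0_fin_numE.
(* [C1 + C2] comes from the two patches, the rest from replacing [m2] by [m1]
   on [O2]. *)
exists (C1 + C2 + D * (v^-1 * ((C1 + C2) * K0))).
have C120 : 0 <= C1 + C2 by rewrite addr_ge0.
have X0 : 0 <= v^-1 * ((C1 + C2) * K0) by rewrite !mulr_ge0// invr_ge0 ltW.
split; first by rewrite addr_ge0// mulr_ge0.
move=> al M phi al01 cphi phiM.
have [m1 m1P] := H1 al M phi al01 cphi phiM.
have [m2 m2P] := H2 al M phi al01 cphi phiM.
have e0 : 0 <= 1 - al by have /andP[_ al1] := al01; rewrite subr_ge0 ltW.
move: (1 - al) e0 m1P m2P => e e0 m1P m2P.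
have E0 := gagliardo_ge0 Om al phi.
move: (gagliardo Om al phi) E0 m1P m2P => E E0 m1P m2P.
have mphi := continuous_on_measurable oOm cphi.
have mphiS (O : set 'rV[R]_d) : O `<=` Om -> measurable_fun O phi.
  by move=> OOm; apply: measurable_funS mphi => //; exact: open_measurable_rV.
have mphic (O : set 'rV[R]_d) c : O `<=` Om -> measurable_fun O (fun z => `|phi z - c|).
  by move=> OOm; apply: measurableT_comp => //; apply: measurable_funB => //; exact: mphiS.
have diff : (`|m2 - m1|%:E <= (v^-1 * ((C1 + C2) * K0 * e))%:E * E)%E.
  have h1 := m1P (leb d) K0 K00 (frleb al al01 d0).
  have h2 := m2P (leb d) K0 K00 (frleb al al01 d0).
  have h : (`|m1 - m2|%:E * leb d (O1 `&` O2) <= ((C1 + C2) * K0 * e)%:E * E)%E.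
    apply: le_trans (integral_const_le (leb d) m1 m2 mI (mphiS _ _)) _.
      by move=> x [/O1Om].
    have -> : (C1 + C2) * K0 * e = C1 * K0 * e + C2 * K0 * e by ring.
    rewrite EFinD ge0_muleDl ?lee_fin ?mulr_ge0//; apply: leeD.
      apply: le_trans h1; apply: ge0_subset_integral => //.
      by apply/measurable_EFinP; exact: mphic.
    apply: le_trans h2; apply: ge0_subset_integral => //.
    by apply/measurable_EFinP; exact: mphic.
  rewrite vE in h; rewrite distrC EFinM -muleA.
  rewrite -(@lee_pmul2r _ v%:E)// ?lte_fin//.
  by rewrite muleAC -[X in (_ <= X * _)%E]EFinM mulVf ?gt_eqF// mul1e.
exists m1 => nu K KK0 frnu.
have h1 := m1P nu K KK0 frnu; have h2 := m2P nu K KK0 frnu.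
apply: (@le_trans _ _ (\int[nu]_(x in O1) `|phi x - m1|%:E +
    \int[nu]_(x in O2) `|phi x - m1|%:E)%E).
  apply: integral_setU_le => //; apply: mphic => x [/O1Om|/O2Om]//.
have h3 : (\int[nu]_(x in O2) `|phi x - m1|%:E <= (C2 * K * e)%:E * E +
   (v^-1 * ((C1 + C2) * K0 * e))%:E * E * (K * D)%:E)%E.
  apply: le_trans (integral_change_const nu m1 m2 mO2 (mphiS _ O2Om)) _.
  apply: leeD => //; rewrite distrC; apply: lee_pmul => //.
  by apply: massD al01 d0 KK0 frnu mO2 O2Om.
apply: le_trans (leeD h1 h3) _.
rewrite muleAC -EFinM addeA.
rewrite -!ge0_muleDl ?adde_ge0 ?lee_fin ?mulr_ge0 ?invr_ge0 ?(ltW v0)//.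
rewrite -!EFinD le_eqVlt; apply/orP; left; apply/eqP; congr (_%:E * _)%E; ring.
Qed.

(** As long as there are two sets, connectedness makes the last one overlap with
    another, or be empty, or be everything; overlapping sets are merged. *)
Lemma trace_poincare_finite_union d (Om : set 'rV[R]_d) n (f : nat -> set 'rV[R]_d) :
  (0 < d)%N -> open Om -> bounded_set Om -> connected Om -> Om !=set0 ->
  (forall i, (i < n)%N -> open (f i)) -> (forall i, (i < n)%N -> trace_poincare Om (f i)) ->
  Om = \bigcup_(i in [set i | (i < n)%N]) f i -> trace_poincare Om Om.
Proof.
move=> d0 oOm bOm cOm Om0; elim: n f => [|n IH] f fo fg OmE.
  by case: Om0 => x; rewrite OmE => -[].
have fOm i : (i < n.+1)%N -> f i `<=` Om by move=> ni x fx; rewrite OmE; exists i.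
pose U := \bigcup_(i in [set i | (i < n)%N]) f i.
have OmU : Om = U `|` f n.
  rewrite OmE; apply/seteqP; split => [x [i /=]|x [[i /= ni fx]|fx]].
  - by rewrite ltnS leq_eqVlt => /predU1P[-> fx|ni fx]; [right|left; exists i].
  - by exists i => //=; rewrite ltnS ltnW.
  - by exists n => //=.
have oU : open U by apply: bigcup_open => i /= ni; apply: fo; rewrite ltnS ltnW.
have [fn0|fn0] := pselect (f n !=set0); last first.
  apply: (IH f) => [i ni|i ni|]; [by apply: fo; rewrite ltnS ltnW|by apply: fg; rewrite ltnS ltnW|].
  rewrite OmU (_ : f n = set0) ?setU0//.
  by apply/seteqP; split => // x fx; apply: fn0; exists x.
have [[x [[i /= ni fix_] fnx]]|disj] := pselect (U `&` f n !=set0); last first.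
  suff fnE : f n = Om by have := fg n (ltnSn n); rewrite fnE.
  apply: cOm => //.
    by exists (f n); [exact: fo|apply/esym/setIidr; exact: fOm].
  exists (~` U); first exact: open_closedC.
  apply/seteqP; split => [x fx|x]; last by rewrite {1}OmU => -[[]//].
  by split; [exact: fOm fx|move=> Ux; apply: disj; exists x].
pose f' j := if j == i then f i `|` f n else f j.
apply: (IH f') => [j nj|j nj|].
- rewrite /f'; case: eqP => _; last by apply: fo; rewrite ltnS ltnW.
  by apply: openU; apply: fo => //; rewrite ltnS ltnW.
- rewrite /f'; case: eqP => _; last by apply: fg; rewrite ltnS ltnW.
  have ni1 : (i < n.+1)%N by rewrite ltnS ltnW.
  apply: trace_poincare_union => //; [exact: fo|exact: fo|exact: fOm|exact: fOm| |exact: fg|exact: fg].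
  by exists x.
- rewrite OmU; apply/seteqP; split => [y [[j /= nj fy]|fy]|y [j /= nj]].
  + exists j => //; rewrite /f'; case: eqP => [ji|//]; by left; rewrite -ji.
  + by exists i => //; rewrite /f' eqxx; right.
  + by rewrite /f'; case: eqP => [_ [fy|fy]|_ fy]; [left; exists i|right|left; exists j].
Qed.

Lemma compact_closure_bounded d (Om : set 'rV[R]_d) :
  bounded_set Om -> compact (closure Om).
Proof.
move=> bOm; have [r r1 Omr] := bounded_rV bOm.
have clOm : closure Om `<=` [set y | `|y| <= r].
  have cl : closed [set y : 'rV[R]_d | `|y| <= r].
    rewrite (_ : mkset _ = (fun y => `|y|) @^-1` `]-oo, r]%classic).
      by apply: closed_comp => [y _|]; [exact: norm_continuous|exact: interval_closed].
    by apply/seteqP; split => z; rewrite /= in_itv/=.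
  by rewrite [X in _ `<=` X](closure_id _).1//; exact: closureS.
apply: bounded_closed_compact; last exact: closed_closure.
exists r; split; first exact: num_real.
by move=> s rs y /clOm /= yr; apply: le_trans yr (ltW rs).
Qed.

Lemma trace_poincare_compact d (Om : set 'rV[R]_d) :
  (0 < d)%N -> open Om -> bounded_set Om -> connected Om -> Om !=set0 ->
  (forall p, closure Om p -> exists N, [/\ open N, N p & trace_poincare Om (N `&` Om)]) ->
  trace_poincare Om Om.
Proof.
move=> d0 oOm bOm cOm Om0 H.
have H' p : exists N, closure Om p -> [/\ open N, N p & trace_poincare Om (N `&` Om)].
  have [clp|clp] := pselect (closure Om p); last by exists setT.
  by have [N HN] := H p clp; exists N.
have [N HN] := choice H'.
have := compact_closure_bounded bOm.
rewrite compact_cover => /(_ _ (closure Om) N).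
case.
- by move=> p /HN[].
- by move=> p clp; exists p => //; have [] := HN p clp.
move=> D' D'cl cov.
pose s : seq 'rV[R]_d := finmap.enum_fset D'.
have sD p : p \in s -> closure Om p by move=> ps; apply/set_mem/D'cl.
apply: (@trace_poincare_finite_union d Om (size s) (fun k => N (nth 0 s k) `&` Om)) => //.
- move=> k ks; apply: openI => //.
  by have /sD/HN[] : nth 0 s k \in s by exact: mem_nth.
- move=> k ks.
  by have /sD/HN[] : nth 0 s k \in s by exact: mem_nth.
- apply/seteqP; split => [x xO|x [k _ []//]].
  have [p /= pD Npx] := cov x (subset_closure xO).
  exists (index p s) => /=; first by rewrite index_mem.
  by split => //; rewrite nth_index.
Qed.

End connected_gluing.

(** * The Hausdorff content *)

Section content.
Context {R : realType}.
Local Notation leb d := (@lebesgue_rV R d).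

(** On [[1, 2]] the integrand is at least [exp (- 2)]. The value 0 is the one
    that a divergent integral would have; [omega] is then 0 as well. *)
Lemma Gamma_lower (x : R) : 1 <= x -> Gamma x = 0 \/ expR (- 2) <= Gamma x.
Proof.
move=> x1; rewrite /Gamma /Rintegral.
set I := (X in fine X).
have I2 : ((expR (- 2))%:E <= I)%E.
  have mf : measurable_fun setT (fun t : R => t `^ (x - 1) * expR (- t)).
    apply: measurable_funM; first exact: measurable_powR.
    apply: (measurableT_comp (@measurable_expR R)).
    exact: oppr_measurable.
  apply: (@le_trans _ _ (\int[@lebesgue_measure R]_(t in `[1%R, 2%R]) (expR (- 2))%:E)%E).
    rewrite integral_cst//= [X in (_ * X)%E](lebesgue_measure_itv `[1%R, 2%R])/= lte_fin ltr1n.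
    by rewrite -EFinB -EFinM lee_fin (_ : 2 - 1 = 1) ?mulr1//; lra.
  apply: (@le_trans _ _ (\int[@lebesgue_measure R]_(t in `[1%R, 2%R]) (t `^ (x - 1) * expR (- t))%:E)%E).
    apply: ge0_le_integral => //.
    - by apply/measurable_EFinP; exact: measurable_funTS.
    move=> t; rewrite /= in_itv/= => /andP[t1 t2]; rewrite lee_fin.
    rewrite -[leLHS]mul1r; apply: ler_pM; rewrite ?expR_ge0//.
      apply: (@le_trans _ _ (t `^ 0)); first by rewrite powRr0.
      by apply: ler_powR => //; rewrite subr_ge0.
    by rewrite ler_expR lerN2.
  apply: ge0_subset_integral => //.
  - by apply/measurable_EFinP; exact: measurable_funTS.
  - by move=> t _; rewrite lee_fin mulr_ge0 ?powR_ge0 ?expR_ge0.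
  - move=> t; rewrite /= !in_itv/= => /andP[t1 _]; rewrite andbT.
    exact: lt_le_trans t1.
move: I I2 => [r| |] //=; first by rewrite lee_fin; right.
by left.
Qed.

Lemma omega_upper (s : R) (d : nat) : 0 <= s <= d%:R -> omega s <= pi ^+ d * expR 2.
Proof.
move=> /andP[s0 sd]; rewrite /omega.
have p1 : 1 <= pi :> R by apply: le_trans (pi_ge2 R); rewrite ler1n.
have pid : pi `^ (s / 2) <= pi ^+ d :> R.
  rewrite -powR_mulrn ?pi_ge0//; apply: ler_powR => //.
  by apply: le_trans sd; rewrite ler_pdivrMr// ler_peMr// ler1n.
have x1 : 1 <= s / 2 + 1 by rewrite lerDr divr_ge0.
have [->|G2] := Gamma_lower x1.
  by rewrite invr0 mulr0 mulr_ge0 ?exprn_ge0 ?pi_ge0 ?expR_ge0.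
apply: ler_pM => //; first exact: powR_ge0.
  by rewrite invr_ge0 (le_trans _ G2)// expR_ge0.
rewrite -[leRHS]invrK -expRN lef_pV2 ?posrE ?expR_gt0//.
by apply: lt_le_trans G2; exact: expR_gt0.
Qed.

Lemma hausdorff_content_ball d (s r : R) (x : 'rV[R]_d) (A : set 'rV[R]_d) :
  0 < s -> 0 <= r -> A `<=` eball x r ->
  (hausdorff_content s A <= (omega s * r `^ s)%:E)%E.
Proof.
move=> s0 r0 Ar; apply: ereal_inf_lbound.
exists (fun=> x), (fun i => if i == 0%N then r else 0); split.
- by move=> [|i].
- by move=> y /Ar yr; exists 0%N.
apply/esym/lim_near_cst => //.
near=> n.
have [k ->] : exists k, n = k.+1.
  by exists n.-1; rewrite prednK//; near: n; exact: nbhs_infty_gt.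
rewrite big_nat_recl//= big1 ?adde0// => i _.
by rewrite powR0 ?mulr0// gt_eqF.
Unshelve. all: by end_near. Qed.

(** A ball of radius [r] for the sup norm is covered by one Euclidean ball of
    radius [(d + 1) r]. *)
Lemma frostman_content d (Om : set 'rV[R]_d) : (0 < d)%N ->
  exists K : R, 0 <= K /\ forall (al : R) (mu : {measure set 'rV[R]_d -> \bar R}),
    0 < al < 1 ->
    (forall A : set 'rV[R]_d, measurable A -> A `<=` Om ->
        (mu A <= hausdorff_content (d%:R - al) A)%E) ->
    frostman Om (d%:R - al) K mu.
Proof.
move=> d0; pose W : R := pi ^+ d * expR 2.
have W0 : 0 <= W by rewrite mulr_ge0 ?exprn_ge0 ?pi_ge0 ?expR_ge0.
exists (W * d.+1%:R ^+ d); split; first by rewrite mulr_ge0// exprn_ge0.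
move=> al mu /andP[al0 al1] muH A x r mA AO r0 Ar.
have s0 : 0 < d%:R - al.
  by rewrite subr_gt0; apply: lt_le_trans al1 _; rewrite ler1n.
have dr0 : 0 < d.+1%:R * r by rewrite mulr_gt0.
apply: (le_trans (muH A mA AO)).
apply: (le_trans (hausdorff_content_ball s0 (ltW dr0) (x := x) _)).
  move=> y /Ar yx; rewrite /eball/=; apply: (le_lt_trans (enorm_le _)).
  apply: (@le_lt_trans _ _ (d%:R * r)); first by rewrite ler_wpM2l.
  by rewrite ltr_pM2r// ltr_nat.
rewrite lee_fin powRM ?(ltW r0)// mulrA ler_wpM2r ?powR_ge0//.
have sd : d%:R - al <= d%:R by rewrite gerBl ltW.
apply: (@le_trans _ _ (W * d.+1%:R `^ (d%:R - al))).
  by rewrite ler_wpM2r ?powR_ge0// omega_upper// (ltW s0).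
rewrite ler_wpM2l// -powR_mulrn//; apply: ler_powR => //; by rewrite ler1n.
Qed.

Lemma bounded_on_open d (Om : set 'rV[R]_d) (phi : 'rV[R]_d -> R) :
  bounded_set Om -> {within closure Om, continuous phi} ->
  exists M, forall x, Om x -> `|phi x| <= M.
Proof.
move=> bOm cphi.
have := compact_bounded (continuous_compact cphi (compact_closure_bounded bOm)).
move=> [M [_ HM]]; exists (M + 1) => x xO; apply: (HM (M + 1)); first by rewrite ltrDl.
by exists x => //; exact: subset_closure.
Qed.

(** Jensen's inequality for the mean over [Om]. *)
Lemma mean_close d (Om : set 'rV[R]_d) (phi : 'rV[R]_d -> R) (m M v : R) :
  measurable Om -> leb d Om = v%:E -> 0 < v -> measurable_fun Om phi ->
  (forall x, Om x -> `|phi x| <= M) ->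
  ((`|mean Om phi - m| * v)%:E <= \int[leb d]_(x in Om) `|phi x - m|%:E)%E.
Proof.
move=> mOm vE v0 mphi phiM.
have Ofin : (leb d Om < +oo)%E by rewrite vE ltry.
have iphi : (leb d).-integrable Om (EFin \o phi).
  apply: measurable_bounded_integrable => //.
  exists M; split; first exact: num_real.
  by move=> N MN x /phiM /le_trans; apply; exact: ltW.
have icst : (leb d).-integrable Om (EFin \o cst m).
  by apply: measurable_bounded_integrable => //; exact: bounded_cst.
have isub : (leb d).-integrable Om (EFin \o (fun x => phi x - m)).
  apply: measurable_bounded_integrable => //; first exact: measurable_funB.
  exists (M + `|m|); split; first exact: num_real.
  move=> N MN x /phiM h; apply: le_trans (ltW MN).
  by apply: le_trans (ler_normB _ _) _; exact: lerD.
have E : (mean Om phi - m) * v = \int[leb d]_(x in Om) (phi x - m).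
  rewrite RintegralB// Rintegral_cst//= vE/= /mean vE/= mulrBl mulrAC mulVf ?gt_eqF//.
  by rewrite mul1r.
rewrite -[X in _ * X](gtr0_norm v0) -normrM E.
rewrite EFin_normr_Rintegral//; apply: le_abse_integral => //.
by apply/measurable_EFinP; exact: measurable_funB.
Qed.

End content.

(** * The inequality *)

Theorem theorem1p6 (R : realType) (d : nat) (Omega : set 'rV[R]_d) :
  (0 < d)%N ->
  open Omega -> bounded_set Omega -> connected Omega ->
  smooth_boundary Omega ->
  exists C : R, 0 < C /\
    forall (alpha : R) (phi : 'rV[R]_d -> R)
      (mu : {measure set 'rV[R]_d -> \bar R}),
      0 < alpha < 1 ->
      smooth_on_closure Omega phi ->
      (forall A : set 'rV[R]_d, measurable A -> A `<=` Omega ->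
        (mu A <= hausdorff_content (d%:R - alpha) A)%E) ->
      (\int[mu]_(x in Omega) `|phi x - mean Omega phi|%:E <=
        (C * (1 - alpha))%:E *
        \int[@lebesgue_rV R d]_(z in Omega) \int[@lebesgue_rV R d]_(y in Omega)
          (`|phi y - phi z| / enorm (y - z) `^ (alpha + d%:R))%:E)%E.
Proof.
move=> d0 oOm bOm cOm sOm.
have [Om0|Om0] := pselect (Omega !=set0); last first.
  have -> : Omega = set0 by apply/seteqP; split => // x xO; apply: Om0; exists x.
  by exists 1; split => // al phi mu _ _ _; rewrite !integral_set0 mule0.
have [C [C0 good]] : trace_poincare Omega Omega.
  apply: trace_poincare_compact => // p clp.
  have [pO|pO] := pselect (Omega p); first exact: interior_patch.
  exact: boundary_patch.
have [K [K0 muK]] := frostman_content Omega d0.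
have [K1 [K10 lebK]] := frostman_lebesgue bOm.
have [D [D0 massD]] := frostman_mass bOm.
have mOm := open_measurable_rV oOm.
have [v [v0 vE]] : exists v : R, 0 < v /\ lebesgue_rV Omega = v%:E.
  (* Any exponent shows that the mass is finite. *)
  have h : 0 < (2^-1 : R) < 1 by rewrite invr_gt0 ltr0n invf_lt1// ltr1n.
  have fin : lebesgue_rV Omega \is a fin_num.
    rewrite ge0_fin_numE//; apply: le_lt_trans (ltry (K1 * D)).
    exact: (massD _ _ _ _ h d0 K10 (lebK _ h d0)).
  exists (fine (lebesgue_rV Omega)); rewrite fineK//; split => //.
  by rewrite fine_gt0// lebesgue_rV_open_gt0//= -ge0_fin_numE.
(* The second summand pays for replacing [m] by the mean; adding 1 makes the
   constant positive. *)
exists (C * K + v^-1 * (C * K1) * (K * D) + 1).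
have X0 : 0 <= v^-1 * (C * K1) by rewrite !mulr_ge0// invr_ge0 ltW.
have Y0 : 0 <= C * K + v^-1 * (C * K1) * (K * D) 
  by apply: addr_ge0; [exact: mulr_ge0|exact: (mulr_ge0 X0 (mulr_ge0 K0 D0))].
split; first by rewrite ltr_wpDl.
move=> al phi mu al01 [sphi cphi _] /(muK _ _ al01) frmu.
have [M phiM] := bounded_on_open bOm cphi.
have cphiO x : Omega x -> {for x, continuous phi} by move=> xO; have [] := sphi [::] x xO.
have mphi := continuous_on_measurable oOm cphiO.
have [m mP] := good al M phi al01 cphiO phiM.
have h1 := mP mu K K0 frmu.
have h2 := mP (@lebesgue_rV R d) K1 K10 (lebK al al01 d0).
have e0 : 0 <= 1 - al by have /andP[_ al1] := al01; rewrite subr_ge0 ltW.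
rewrite -/(gagliardo Omega al phi).
have E0 := gagliardo_ge0 Omega al phi.
move: (1 - al) e0 h1 h2 => e e0 h1 h2.
move: (gagliardo Omega al phi) E0 h1 h2 => E E0 h1 h2.
have h3 : (`|mean Omega phi - m|%:E <= (v^-1 * (C * K1) * e)%:E * E)%E.
  rewrite -(@lee_pmul2r _ v%:E)// ?lte_fin// -EFinM.
  apply: le_trans (le_trans (mean_close m mOm vE v0 mphi phiM) h2) _.
  rewrite muleAC -EFinM (_ : v^-1 * (C * K1) * e * v = C * K1 * e)//.
  by rewrite mulrAC [X in X * e]mulrAC mulVf ?gt_eqF// mul1r.
apply: le_trans (integral_change_const mu (mean Omega phi) m mOm mphi) _.
have h4 : (`|mean Omega phi - m|%:E * mu Omega <=
    (v^-1 * (C * K1) * e)%:E * E * (K * D)%:E)%E.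
  by apply: lee_pmul => //; exact: (massD _ _ _ _ al01 d0 K0 frmu).
apply: (le_trans (leeD h1 h4)).
rewrite muleAC -EFinM -ge0_muleDl ?lee_fin ?mulr_ge0 ?invr_ge0 ?(ltW v0)//.
apply: lee_wpmul2r => //; rewrite -EFinD lee_fin.
have -> : C * K * e + v^-1 * (C * K1) * e * (K * D) =
  (C * K + v^-1 * (C * K1) * (K * D)) * e by ring.
by rewrite ler_wpM2r// lerDl.
Qed.
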